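(* Let $v=s_3$. Then the GIT quotient $T\backslash\!\backslash (X^{v}_{w_{3,7}})^{ss}_T(\mathcal{L}(7\omega_3))$ is isomorphic to $\mathbb{P}^1\times\mathbb{P}^1$, and the descent of the line bundle $\mathcal{L}(7\omega_3)$ to the GIT quotient is $\mathcal{O}(2)\boxtimes\mathcal{O}(1)$.
   Context: $G=SL(7,\mathbb{C})$, $T$ is the subgroup of diagonal matrices, $B$ (resp. $B^-$) the subgroup of upper (resp. lower) triangular matrices, $s_i=(i,i+1)\in S_7$, and $G_{3,7}$ is the Grassmannian of $3$-dimensional subspaces of $\mathbb{C}^7$. A minimal-length coset representative $w\in S_7$ (one with $w(1)<w(2)<w(3)$ and $w(4)<\dots<w(7)$) is identified with $[w(1),w(2),w(3)]$; e.g. $s_3$ corresponds to $[1,2,4]$. Put $e_w=[e_{w(1)}\wedge e_{w(2)}\wedge e_{w(3)}]$; $X(w)$ is the closure of $Be_w$, $X^v$ the closure of $B^-e_v$, $X^v_w=X(w)\cap X^v$, and $w_{3,7}=[3,5,7]$. $\mathcal{L}(\omega_3)$ is the pullback of $\mathcal{O}(1)$ under the Plücker embedding with its natural $T$-linearization, and $\mathcal{L}(7\omega_3)=\mathcal{L}(\omega_3)^{\otimes7}$. The semistable locus $X^{ss}_T(\mathcal{L})$ is the set of points of $X$ at which some $T$-invariant section over $X$ of a positive power of $\mathcal{L}$ does not vanish, and the GIT quotient is $T\backslash\!\backslash X^{ss}_T(\mathcal{L})=\mathrm{Proj}\bigoplus_{m\ge0}H^0(X,\mathcal{L}^{\otimes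 m})^T$. The descent of $\mathcal L$ is the line bundle on the GIT quotient whose pullback to $X^{ss}_T(\mathcal{L})$ is $T$-equivariantly isomorphic to $\mathcal{L}$. $\mathcal{O}(a)\boxtimes\mathcal{O}(b)$ denotes the external tensor product on $\mathbb{P}^1\times\mathbb{P}^1$. *)

(* Defs.v *)
From mathcomp Require Import all_boot all_order all_algebra all_fingroup.
From mathcomp Require Import boolp classical_sets functions reals.
From mathcomp Require Import complex mpoly.
Set Implicit Arguments.
Unset Strict Implicit.
Unset Printing Implicit Defensive.
Import GRing.Theory.
Local Open Scope classical_set_scope.
Local Open Scope ring_scope.

(* Varieties are treated classically, as spaces with functions: a set of      *)
(* (closed) points, its Zariski open subsets, and for each open subset U the  *)
(* F-valued functions that are regular on U. Functions "on U" are total; only *)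
(* their restriction to U matters.                                            *)
Record fspace (F : fieldType) := FSpace {
  pt :> Type;
  opn : set (set pt);
  regular : set pt -> set (pt -> F)
}.

Definition morphism (F : fieldType) (X Y : fspace F) (f : X -> Y) : Prop :=
  forall W : set Y, opn W ->
    opn (f @^-1` W) /\
    forall h : Y -> F, regular W h -> regular (f @^-1` W) (h \o f).

Definition isomorphism (F : fieldType) (X Y : fspace F) (f : X -> Y) : Prop :=
  morphism f /\
  exists2 g : Y -> X, morphism g & cancel f g /\ cancel g f.

Definition zclosure (F : fieldType) (X : fspace F) (S : set X) : set X :=
  [set x | forall U : set X, opn U -> U x -> exists2 y, S y & U y].

Definition subspace (F : fieldType) (X : fspace F) (S : set X) : fspace F :=
  @FSpace F (set_type S)
    [set U | exists2 W : set X, opn W & U = [set x | W (\val x)]]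
    (fun U => [set f | forall x, U x ->
       exists W : set X, exists h : X -> F,
         [/\ opn W, W (\val x), regular W h
           & forall y, U y -> W (\val y) -> f y = h (\val y)]]).

Definition incl (F : fieldType) (X : fspace F) (S : set X) :
  subspace S -> X := fun x : set_type S => \val x.

(* The product in the category of spaces with functions: its basic open sets  *)
(* are the nonvanishing loci of elements of O(U) (x) O(V), and its regular    *)
(* functions are locally quotients of such elements.                          *)
Definition tensor_fun (F : fieldType) (X Y : fspace F) (U : set X) (V : set Y) :
  set (X * Y -> F) :=
  [set h | exists n (f : 'I_n -> X -> F) (g : 'I_n -> Y -> F),
     [/\ forall i, regular U (f i), forall i, regular V (g i)
       & forall z, h z = \sum_(i < n) f i z.1 * g i z.2]].

Definition prodspace (F : fieldType) (X Y : fspace F) : fspace F :=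
  @FSpace F (X * Y)%type
    [set O | forall z, O z ->
       exists (U : set X) (V : set Y) (k : X * Y -> F),
         [/\ opn U, opn V & tensor_fun U V k] /\
         [/\ (U `*` V) z, k z != 0
           & forall z', (U `*` V) z' -> k z' != 0 -> O z']]
    (fun O => [set f | forall z, O z ->
       exists (U : set X) (V : set Y) (h k : X * Y -> F),
         [/\ opn U, opn V, tensor_fun U V h & tensor_fun U V k] /\
         [/\ (U `*` V) z, k z != 0
           & forall z', O z' -> (U `*` V) z' -> k z' != 0 ->
               f z' = h z' / k z']]).

Definition line (F : fieldType) (n : nat) :=
  {l : {vspace 'cV[F]_n} | \dim l == 1%N}.

Definition peval (F : fieldType) (n : nat) (p : {mpoly F[n]}) (v : 'cV[F]_n) : F :=
  p.@[fun i => v i ord0].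

(* projspace F n is P(F^n), of dimension n - 1. *)
Definition projopn (F : fieldType) (n : nat) : set (set (line F n)) :=
  [set U | exists2 S : set {mpoly F[n]},
     (forall p, S p -> exists d, p \is d.-homog)
     & U = [set l : line F n | exists p v, [/\ S p, v \in val l & peval p v != 0]]].

Definition projspace (F : fieldType) (n : nat) : fspace F :=
  @FSpace F (line F n) (@projopn F n)
    (fun U => [set f | forall l, U l ->
       exists (W : set (line F n)) (d : nat) (p q : {mpoly F[n]}),
         [/\ projopn W, W l, p \is d.-homog, q \is d.-homog
           & forall l' v, U l' -> W l' -> v \in val l' -> v != 0 ->
               peval q v != 0 /\ f l' = peval p v / peval q v]]).

(* A line bundle is presented by its fibres and its regular sections. Fibres  *)
(* are spaces of F-valued functions on an auxiliary type; as with functions,  *)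
(* only the values on U of a section over U matter.                           *)
Record bundle (F : fieldType) (X : fspace F) := Bundle {
  amb : Type;
  fib : X -> set (amb -> F);
  sec : set X -> set (X -> amb -> F)
}.
Arguments amb {F X} _.
Arguments fib {F X} _ _ _.
Arguments sec {F X} _ _ _.

Definition smul (F : fieldType) (A : Type) (c : F) (f : A -> F) : A -> F :=
  fun a => c * f a.

Definition line_bundle (F : fieldType) (X : fspace F) (M : bundle X) : Prop :=
  (forall (U : set X) (s : X -> amb M -> F), opn U ->
     (sec M U s <-> forall x, U x ->
        exists W : set X, [/\ opn W, W x, W `<=` U & sec M W s])) /\
  (forall x : X, exists (U : set X) (e : X -> amb M -> F),
     [/\ opn U, U x,
         forall y, U y -> e y <> 0 /\ fib M y = range (fun c : F => smul c (e y))
       & forall (W : set X) s, opn W -> W `<=` U ->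
           (sec M W s <-> exists2 g : X -> F, regular W g
                          & forall y, W y -> s y = smul (g y) (e y))]).

Definition pullback (F : fieldType) (X Y : fspace F) (f : X -> Y)
  (M : bundle Y) : bundle X :=
  @Bundle F X (amb M) (fun x => fib M (f x))
    (fun U => [set s | forall x, U x ->
       exists (V : set X) (W : set Y) (g : X -> F) (e : Y -> amb M -> F),
         [/\ opn V, V x & V `<=` U] /\
         [/\ opn W, V `<=` f @^-1` W, regular V g, sec M W e
           & forall y, V y -> s y = smul (g y) (e (f y))]]).

(* The tensor product of two lines of functions consists of the pure tensors. *)
Definition pure (F : fieldType) (A B : Type) (f : A -> F) (g : B -> F) :
  A * B -> F := fun z => f z.1 * g z.2.

Definition tensor (F : fieldType) (X : fspace F) (M N : bundle X) : bundle X :=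
  @Bundle F X (amb M * amb N)%type
    (fun x => [set h | exists f g, [/\ fib M x f, fib N x g & h = pure f g]])
    (fun U => [set s | forall x, U x ->
       exists (W : set X) (a : X -> amb M -> F) (b : X -> amb N -> F),
         [/\ opn W, W x & W `<=` U] /\
         [/\ sec M W a, sec N W b & forall y, W y -> s y = pure (a y) (b y)]]).

Definition boxtimes (F : fieldType) (X Y : fspace F)
  (M : bundle X) (N : bundle Y) : bundle (prodspace X Y) :=
  tensor (@pullback F (prodspace X Y) X fst M)
         (@pullback F (prodspace X Y) Y snd N).

(* O(d) = O(1)^(x)d on P(F^n): the fibre at a line l consists of the          *)
(* functions on l that are homogeneous of degree d, extended by 0 off l; the  *)
(* fibre of O(1) is thus the dual of l.                                       *)
Definition serre_fib (F : fieldType) (n d : nat) (l : line F n) :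
  set ('cV[F]_n -> F) :=
  [set f | (forall (c : F) v, v \in val l -> f (c *: v) = c ^+ d * f v) /\
           (forall v, v \notin val l -> f v = 0)].

Definition serre (F : fieldType) (n d : nat) : bundle (projspace F n) :=
  @Bundle F (projspace F n) 'cV[F]_n (@serre_fib F n d)
    (fun U => [set s | (forall l, U l -> serre_fib d l (s l)) /\
       forall l, U l ->
         exists (W : set (line F n)) (k : nat) (p q : {mpoly F[n]}),
           [/\ projopn W, W l, p \is (k + d)%N.-homog, q \is k.-homog
             & forall l' v, U l' -> W l' -> v \in val l' -> v != 0 ->
                 peval q v != 0 /\ s l' v = peval p v / peval q v]]).

Definition bundle_iso (F : fieldType) (X : fspace F) (M N : bundle X)
  (Psi : X -> (amb M -> F) -> (amb N -> F)) : Prop :=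
  [/\ forall x, set_bij (fib M x) (fib N x) (Psi x),
      forall x (c : F) f g, fib M x f -> fib M x g ->
        Psi x (smul c f + g) = smul c (Psi x f) + Psi x g
    & forall (U : set X) s, opn U -> (forall x, U x -> fib M x (s x)) ->
        (sec M U s <-> sec N U (fun x => Psi x (s x)))].

(* The graded algebra is the external direct sum of the pieces A m, with the  *)
(* pointwise product A m x A n -> A (m + n). A homogeneous ideal is given by  *)
(* its homogeneous pieces, and is prime iff it is so on homogeneous elements. *)
Definition relevant_prime (F : fieldType) (X B : Type)
  (A p : nat -> set (X -> B -> F)) : Prop :=
  [/\ forall m, p m `<=` A m,
      forall m, p m 0,
      forall m a b, p m a -> p m b -> p m (a + b)
    & forall m n a b, A m a -> p n b -> p (m + n)%N (a * b)] /\
  [/\ forall m n a b, A m a -> A n b -> p (m + n)%N (a * b) -> p m a \/ p n b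
    & exists m a, [/\ (0 < m)%N, A m a & ~ p m a]].

(* The closed points of Proj: primes maximal among those that do not contain  *)
(* the irrelevant ideal.                                                      *)
Definition proj_points (F : fieldType) (X B : Type)
  (A : nat -> set (X -> B -> F)) : set (nat -> set (X -> B -> F)) :=
  [set p | relevant_prime A p /\
     forall q, relevant_prime A q -> (forall m, p m `<=` q m) -> q = p].

(* For p in D(b), the value at p of a / b is the scalar c with a - c b in p. *)
Definition Proj (F : fieldType) (X B : Type)
  (A : nat -> set (X -> B -> F)) : fspace F :=
  @FSpace F (set_type (proj_points A))
    [set U | exists2 S : nat -> set (X -> B -> F),
       (forall m, S m `<=` A m)
       & U = [set p | exists m a, S m a /\ ~ (\val p) m a]]
    (fun U => [set f | forall p, U p -> exists m a b,
       [/\ A m a, A m b, ~ (\val p) m b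
         & forall q, U q -> ~ (\val q) m b -> (\val q) m (a - (fun x => smul (f q) (b x)))]]).

(* The exterior cube of F^7, with coordinates indexed by the 3-subsets I of   *)
(* {0, ..., 6} (indices are shifted by one from {1, ..., 7}): coordinate I    *)
(* refers to the basis vector given by the wedge of the e_i, i in I taken in  *)
(* increasing order.                                                          *)
Definition triple := {I : {set 'I_7} | #|I| == 3%N}.
Definition N := #|{: triple}|.
Definition elt (i : 'I_N) (a : 'I_3) : 'I_7 :=
  nth ord0 (enum (val (enum_val i : triple))) a.

Definition wedge3 (F : fieldType) (g : 'M[F]_7) : 'M[F]_N :=
  \matrix_(i, j) \det (\matrix_(a < 3, b < 3) g (elt i a) (elt j b)).

Definition wedge_act (F : fieldType) (g : 'M[F]_7) (l : {vspace 'cV[F]_N}) :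
  {vspace 'cV[F]_N} := (linfun (mulmx (wedge3 g)) @: l)%VS.

Definition evec (F : fieldType) (I : {set 'I_7}) : 'cV[F]_N :=
  \col_i (val (enum_val i : triple) == I)%:R.

Definition SL7 (F : fieldType) : set 'M[F]_7 := [set g | \det g = 1].
Definition torus (F : fieldType) : set 'M[F]_7 :=
  [set g | SL7 g /\ is_diag_mx g].
Definition borel (F : fieldType) : set 'M[F]_7 :=
  [set g | SL7 g /\ is_trig_mx g^T].
Definition opp_borel (F : fieldType) : set 'M[F]_7 :=
  [set g | SL7 g /\ is_trig_mx g].

(* s_ i = (i, i + 1) in one-based notation. *)
Definition s_ (i : nat) : 'S_7 := tperm (inord i.-1) (inord i).
Definition coset_triple (w : 'S_7) : {set 'I_7} :=
  [set w i | i : 'I_7 & (i < 3)%N]%SET.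
(* [3,5,7] in one-based notation. *)
Definition w37 : {set 'I_7} := [set inord 2; inord 4; inord 6]%SET.

(* Closures are taken in P(wedge^3 F^7), where the Grassmannian is closed. *)
Definition orbit_closure (F : fieldType) (H : set 'M[F]_7) (I : {set 'I_7}) :
  set (projspace F N) :=
  @zclosure F (projspace F N)
    [set l : line F N | exists2 b, H b & val l = wedge_act b <[evec F I]>%VS].
Definition schubert (F : fieldType) w := orbit_closure (@borel F) w.
Definition opp_schubert (F : fieldType) v := orbit_closure (@opp_borel F) v.
Definition richardson (F : fieldType) (v w : {set 'I_7}) : set (projspace F N) :=
  schubert w `&` opp_schubert v.
Arguments richardson : clear implicits.

(* L(k omega_3) on a subvariety of P(wedge^3 F^7). *)
Definition Lomega (F : fieldType) (X : set (projspace F N)) (k : nat) :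
  bundle (subspace X) := pullback (@incl F _ X) (serre F N k).

(* The graph of the action of t on X; it is a function when X is T-stable. *)
Definition moves (F : fieldType) (X : set (projspace F N)) (t : 'M[F]_7)
  (x y : subspace X) : Prop :=
  val (incl y) = wedge_act t (val (incl x)).

(* H^0(X, L(k omega_3))^T; t maps the fibre at x to the fibre at t x by       *)
(* f |-> f \o t^-1.                                                           *)
Definition inv_sections (F : fieldType) (X : set (projspace F N)) (k : nat) :
  set (subspace X -> 'cV[F]_N -> F) :=
  [set s | sec (Lomega X k) setT s /\
     forall t, torus t -> forall x y : subspace X, moves t x y ->
       forall v, s y (wedge3 t *m v) = s x v].
Arguments inv_sections {F} X k _.

Definition inv_ring (F : fieldType) (X : set (projspace F N)) (k : nat)
  (m : nat) := inv_sections X (k * m)%N.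
Arguments inv_ring {F} X k m _.

Definition semistable (F : fieldType) (X : set (projspace F N)) (k : nat) :
  set (subspace X) :=
  [set x | exists m s, [/\ (0 < m)%N, inv_ring X k m s & s x <> 0]].
Arguments semistable {F} X k _.

Definition git_quotient (F : fieldType) (X : set (projspace F N)) (k : nat) :
  fspace F := Proj (inv_ring X k).

(* pi x is the ideal of the invariant sections vanishing at x; this           *)
(* determines pi.                                                             *)
Definition quotient_map (F : fieldType) (X : set (projspace F N)) (k : nat)
  (pi : subspace (semistable X k) -> git_quotient X k) : Prop :=
  forall x m, \val (pi x : set_type _) m =
              [set s | inv_ring X k m s /\ s (incl x) = 0].

(* T acts trivially on the quotient, hence the linearization of the pullback  *)
(* of M identifies the fibres at x and t x.                                   *)
Definition is_descent (F : fieldType) (X : set (projspace F N)) (k : nat)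
  (pi : subspace (semistable X k) -> git_quotient X k)
  (M : bundle (git_quotient X k)) : Prop :=
  line_bundle M /\
  exists Psi : subspace (semistable X k) -> ('cV[F]_N -> F) -> (amb M -> F),
    @bundle_iso F (subspace (semistable X k))
      (pullback (@incl F _ (semistable X k)) (Lomega X k)) (pullback pi M) Psi /\
    forall t, torus t ->
      forall x y : subspace (semistable X k), moves t (incl x) (incl y) ->
      forall f g, fib (Lomega X k) (incl x) f -> fib (Lomega X k) (incl y) g ->
        (forall v, g (wedge3 t *m v) = f v) -> Psi y g = Psi x f.

(* Main.v *)
Require Import Defs.
From mathcomp Require Import all_boot all_order all_algebra all_fingroup.
From mathcomp Require Import boolp classical_sets functions reals.
From mathcomp Require Import complex mpoly.
From mathcomp Require Import ring zify.

(** Write a point of the Grassmannian as a 3-dimensional subspace V. It lies in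
    the Richardson variety X iff V meets the span of e_1, e_2, e_3, meets the
    span of e_1, ..., e_5 in dimension at least 2, and meets the span of
    e_4, ..., e_7. So a general V is spanned by vectors a, b, c supported on the
    coordinates 1-3, 1-5 and 4-7, and diagonal matrices bring it to the slice
    a = (1,1,1,0,0,0,0), b = (0,u0,u1,1,1,0,0), c = (0,0,0,w0,w1,1,1).
    The tori that remain scale u = (u0,u1) and w = (w0,w1) independently, so that the
    quotient ought to be the product of the projective lines with coordinates u and w,
    and an invariant section of degree 7m, restricted to the slice, is
    bihomogeneous in (u,w) of bidegree (2m,m).

    Three facts turn this into a proof. First, every semistable point is a
    torus translate of a slice point with u and w nonzero (balanced_slice): the
    Hilbert-Mumford criterion (hilbert_mumford), applied to the one-parameter
    subgroups that scale a subset Z of the coordinates, says that some nonzero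
    Pluecker coordinate p_I has 7 |I inter Z| <= 3 |Z|, and with Cramer's rule and
    the coordinates that vanish on X this forces the normal form. Second, the
    restriction of an invariant section of degree 7m to the slice is a
    polynomial (slice_value_biform): near u = w = 0 it is a ratio p/q with q
    nonzero at the centre, and bihomogeneity singles out one component of p.
    Third, every biform of bidegree (2m,m) occurs (liftable_biform): it is
    enough to lift the six monomials of bidegree (2,1), and explicit monomials of
    degree 7 in the Pluecker coordinates do that. Sections of positive degree
    vanish at unstable points, hence in positive degree the ring of invariants is
    the ring of biforms of bidegree (2m,m), which is the section ring of
    O(2) [x] O(1).

    The closed points of Proj are then found by a Nullstellensatz in two affine
    coordinates (prime_ideal_zero, relevant_vanishing), and both Proj and the
    product of projective lines carry the topology and the functions given by
    ratios of biforms (Q_ratio, P1xP1_ratio), whence the isomorphism. For the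
    descent, the monomials u_i^2 w_j and their lifts to invariant forms trivialise
    O(2) [x] O(1) and L(7 omega_3) over corresponding open sets, and matching
    these frames defines the isomorphism of bundles (Psi_iso). *)

Set Implicit Arguments.
Unset Strict Implicit.
Unset Printing Implicit Defensive.
Import GRing.Theory.
Local Open Scope classical_set_scope.
Local Open Scope ring_scope.

Local Notation incl := Defs.incl.
Local Notation morphism := Defs.morphism.

(** * Spaces whose structure is given by ratios *)

Section RatioSpaces.
Variable F : fieldType.

Definition graded_family (V : Type) (G : nat -> set (V -> F)) : Prop :=
  [/\ forall c, G 0%N (fun=> c),
      forall m a b, G m a -> G m b -> G m (a + b)
    & forall m n a b, G m a -> G n b -> G (m + n)%N (a * b)].

(** Projective spaces, their subspaces, products of projective lines and Proj
    all have this shape: V is a space of representatives, r picks one for each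
    point, and G m consists of the homogeneous functions of degree m, whose
    values at a representative have no meaning but whose ratios do. The facts
    below about open sets, regular functions and bundles are proved once, for
    all of them. *)
Record ratio_space (X : fspace F) (V : Type) (r : X -> V)
    (G : nat -> set (V -> F)) : Prop := RatioSpace {
  ratio_graded : graded_family G;
  ratio_opn : forall U : set X, opn U <->
    forall x, U x -> exists m a, [/\ G m a, a (r x) != 0
      & forall y, a (r y) != 0 -> U y];
  ratio_reg : forall (U : set X) f, regular U f <->
    forall x, U x -> exists m a b, [/\ G m a, G m b, b (r x) != 0
      & forall y, U y -> b (r y) != 0 -> f y = a (r y) / b (r y)] }.

Lemma graded_scale V (G : nat -> set (V -> F)) m c a :
  graded_family G -> G m a -> G m (fun v => c * a v).
Proof.
case=> Gc _ GM Ga; have := GM _ _ _ _ (Gc c) Ga; rewrite add0n.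
by congr (G m _); apply/funext.
Qed.

Section Good.
Variables (X : fspace F) (V : Type) (r : X -> V) (G : nat -> set (V -> F)).
Hypothesis XG : ratio_space r G.

Lemma ratio_opnT : opn [set: X].
Proof.
apply/(ratio_opn XG) => x _; exists 0%N, (fun=> 1); split=> //.
- by have [+ _ _] := ratio_graded XG; apply.
- exact: oner_neq0.
Qed.

Lemma ratio_opnI (U W : set X) : opn U -> opn W -> opn (U `&` W).
Proof.
move=> /(ratio_opn XG) oU /(ratio_opn XG) oW; apply/(ratio_opn XG) => x [Ux Wx].
have [m [a [Ga ax aU]]] := oU _ Ux; have [n [b [Gb bx bW]]] := oW _ Wx.
exists (m + n)%N, (a * b); split.
- by have [_ _ +] := ratio_graded XG; apply.
- exact: mulf_neq0.
- move=> y; rewrite mulf_eq0 negb_or => /andP[ay by_].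
  by split; [apply: aU | apply: bW].
Qed.

Lemma ratio_regS (U W : set X) f : W `<=` U -> regular U f -> regular W f.
Proof.
move=> WU /(ratio_reg XG) rf; apply/(ratio_reg XG) => x Wx.
have [m [a [b [Ga Gb bx fab]]]] := rf _ (WU _ Wx).
by exists m, a, b; split=> // y /WU; apply: fab.
Qed.

Lemma ratio_reg_local (U : set X) f :
  (forall x, U x -> exists (W : set X) h, [/\ opn W, W x, regular W h
     & forall y, U y -> W y -> f y = h y]) -> regular U f.
Proof.
move=> H; apply/(ratio_reg XG) => x Ux.
have [W [h [/(ratio_opn XG) oW Wx /(ratio_reg XG) rh fh]]] := H x Ux.
have [m [a [b [Ga Gb bx hab]]]] := rh _ Wx.
have [n [c [Gc cx cW]]] := oW _ Wx.
have [_ _ GM] := ratio_graded XG.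
exists (m + n)%N, (a * c), (b * c); split; [exact: GM | exact: GM |exact: mulf_neq0|].
move=> y Uy; rewrite mulf_eq0 negb_or => /andP[by0 cy0].
by rewrite fh ?hab //; [rewrite -mulf_div divff // mulr1| exact: cW|exact: cW].
Qed.

Lemma ratio_reg_cst (U : set X) c : regular U (fun=> c).
Proof.
apply/(ratio_reg XG) => x _; exists 0%N, (fun=> c), (fun=> 1).
have [Gc _ _] := ratio_graded XG.
by split=> //; [exact: oner_neq0 | move=> y _ _; rewrite divr1].
Qed.

Lemma ratio_regM (U : set X) f g :
  regular U f -> regular U g -> regular U (f * g).
Proof.
move=> /(ratio_reg XG) rf /(ratio_reg XG) rg; apply/(ratio_reg XG) => x Ux.
have [m [a [b [Ga Gb bx fab]]]] := rf _ Ux.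
have [n [c [d [Gc Gd dx gcd]]]] := rg _ Ux.
have [_ _ GM] := ratio_graded XG.
exists (m + n)%N, (a * c), (b * d); split; [exact: GM|exact: GM|exact: mulf_neq0|].
move=> y Uy; rewrite mulf_eq0 negb_or => /andP[by0 dy0].
by rewrite -mulf_div -fab // -gcd.
Qed.

Lemma ratio_regD (U : set X) f g :
  regular U f -> regular U g -> regular U (f + g).
Proof.
move=> /(ratio_reg XG) rf /(ratio_reg XG) rg; apply/(ratio_reg XG) => x Ux.
have [m [a [b [Ga Gb bx fab]]]] := rf _ Ux.
have [n [c [d [Gc Gd dx gcd]]]] := rg _ Ux.
have [_ GD GM] := ratio_graded XG.
exists (m + n)%N, (a * d + b * c), (b * d).
split; [by apply: GD; exact: GM|exact: GM|exact: mulf_neq0|].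
move=> y Uy; rewrite mulf_eq0 negb_or => /andP[by0 dy0].
change (f y + g y = (a (r y) * d (r y) + b (r y) * c (r y)) / (b (r y) * d (r y))).
by rewrite fab // gcd // addf_div // (mulrC (b _) (c _)).
Qed.

Lemma ratio_opnD m a : G m a -> opn [set x | a (r x) != 0].
Proof.
by move=> Ga; apply/(ratio_opn XG) => x ax; exists m, a; split.
Qed.

End Good.

(** It suffices to pull ratios back to ratios; the degree may change, and the
    new ratio may depend on the point near which it is needed. *)
Lemma ratio_morphism (X Y : fspace F) V V' (r : X -> V) (r' : Y -> V') G G'
    (f : X -> Y) : ratio_space r G -> ratio_space r' G' ->
  (forall x m a b, G' m a -> G' m b -> b (r' (f x)) != 0 ->
     exists m' a' b', [/\ G m' a', G m' b', b' (r x) != 0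
       & forall y, b' (r y) != 0 -> b (r' (f y)) != 0 /\
           a (r' (f y)) / b (r' (f y)) = a' (r y) / b' (r y)]) ->
  Defs.morphism f.
Proof.
move=> XG YG H W oW; split.
  apply/(ratio_opn XG) => x Wfx.
  have [m [b [Gb bx bW]]] := (ratio_opn YG W).1 oW _ Wfx.
  have [m' [a' [b' [_ Gb' b'x b'H]]]] := H x m b b Gb Gb bx.
  by exists m', b'; split=> // y /b'H[/bW].
move=> h /(ratio_reg YG) rh; apply/(ratio_reg XG) => x Wfx.
have [m [a [b [Ga Gb bx hab]]]] := rh _ Wfx.
have [m' [a' [b' [Ga' Gb' b'x b'H]]]] := H x m a b Ga Gb bx.
exists m', a', b'; split=> // y Wfy /b'H[by0 <-].
exact: hab.
Qed.

Lemma ratio_subspace (X : fspace F) V (r : X -> V) G (S : set X) :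
  ratio_space r G ->
  @ratio_space (subspace S) V (fun x : set_type S => r (\val x)) G.
Proof.
move=> XG; split; first exact: ratio_graded XG.
- move=> U; split.
    move=> [W oW ->] x /= Wx.
    have [m [a [Ga ax aW]]] := (ratio_opn XG W).1 oW _ Wx.
    by exists m, a; split=> // y /aW.
  move=> H; exists [set x | exists m a, [/\ G m a, a (r x) != 0
     & forall y : set_type S, a (r (\val y)) != 0 -> U y]].
    apply/(ratio_opn XG) => x [m [a [Ga ax aU]]]; exists m, a; split=> // y ay.
    by exists m, a.
  apply/seteqP; split=> x /=; first by move=> /H[m [a ?]]; exists m, a.
  by move=> [m [a [Ga ax]]]; apply.
- move=> U f; split=> H x Ux.
    have [W [h [/(ratio_opn XG) oW Wx /(ratio_reg XG) rh fh]]] := H x Ux.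
    have [m [a [b [Ga Gb bx hab]]]] := rh _ Wx.
    have [n [c [Gc cx cW]]] := oW _ Wx.
    have [_ _ GM] := ratio_graded XG.
    exists (m + n)%N, (a * c), (b * c).
    split; [exact: GM | exact: GM |exact: mulf_neq0|].
    move=> y Uy; rewrite mulf_eq0 negb_or => /andP[by0 cy0].
    by rewrite fh ?hab //; [rewrite -mulf_div divff // mulr1| exact: cW|exact: cW].
  have [m [a [b [Ga Gb bx fab]]]] := H x Ux.
  exists [set y | b (r y) != 0], (fun y => a (r y) / b (r y)); split=> //.
  + exact: (ratio_opnD XG Gb).
  + by apply/(ratio_reg XG) => y by0; exists m, a, b; split.
Qed.

End RatioSpaces.

(** * Trivialising sections of line bundles *)

Section Frames.
Variable F : fieldType.

(** The condition on (U, e) in the definition of a line bundle, isolated so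
    that frames can be transported from one bundle to another. *)
Definition frame (X : fspace F) (M : bundle X) (U : set X)
    (e : X -> amb M -> F) : Prop :=
  [/\ opn U,
      forall y, U y -> e y <> 0 /\ fib M y = range (fun c : F => smul c (e y))
    & forall (W : set X) s, opn W -> W `<=` U ->
        (sec M W s <-> exists2 g : X -> F, regular W g
                       & forall y, W y -> s y = smul (g y) (e y))].
Arguments frame {X} M U e.

Definition sec_restricts (X : fspace F) (M : bundle X) : Prop :=
  forall (U W : set X) s, opn W -> W `<=` U -> sec M U s -> sec M W s.

Definition sec_local (X : fspace F) (M : bundle X) : Prop :=
  forall (U : set X) (s : X -> amb M -> F), opn U ->
     (sec M U s <-> forall x, U x ->
        exists W : set X, [/\ opn W, W x, W `<=` U & sec M W s]).

Lemma smul_inj A (e : A -> F) c d : e <> 0 -> smul c e = smul d e -> c = d.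
Proof.
move=> e0 cd; apply: contrapT => /eqP cNd; apply: e0; apply/funext => a.
have /eqP := congr1 (@^~ a) cd; rewrite /smul -subr_eq0 -mulrBl mulf_eq0 subr_eq0.
by rewrite (negPf cNd) => /eqP.
Qed.

Lemma smulA A (e : A -> F) c d : smul c (smul d e) = smul (c * d) e.
Proof. by apply/funext => a; rewrite /smul mulrA. Qed.

Lemma smulDl A (e : A -> F) c d : smul (c + d) e = smul c e + smul d e.
Proof. by apply/funext => a; exact: mulrDl. Qed.

Lemma smul1 A (e : A -> F) : smul 1 e = e.
Proof. by apply/funext => a; rewrite /smul mul1r. Qed.

Lemma pure_neq0 A B (f : A -> F) (g : B -> F) : f <> 0 -> g <> 0 ->
  pure f g <> 0.
Proof.
move=> f0 g0 fg0; apply: f0; apply/funext => a.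
apply: contrapT => /eqP fa; apply: g0; apply/funext => b.
by have /eqP := congr1 (@^~ (a, b)) fg0; rewrite mulf_eq0 (negPf fa) => /eqP.
Qed.

Lemma pure_smul A B (f : A -> F) (g : B -> F) c d :
  pure (smul c f) (smul d g) = smul (c * d) (pure f g).
Proof. by apply/funext => -[a b]; rewrite /pure /smul mulrACA. Qed.

Lemma pullback_local (X Y : fspace F) (f : X -> Y) (M : bundle Y) :
  sec_local (pullback f M).
Proof.
move=> U s oU; split=> [sU x Ux|H x Ux]; first by exists U; split=> // y.
have [W [oW Wx WU sW]] := H x Ux.
have [V [W' [g [e [[oV Vx VW] R]]]]] := sW x Wx.
exists V, W', g, e; split=> //; split=> //; exact: subset_trans VW WU.
Qed.

Section OnGood.
Variables (X : fspace F) (V : Type) (r : X -> V) (G : nat -> set (V -> F)).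
Hypothesis XG : ratio_space r G.

Lemma pullback_restricts (Y : fspace F) (f : X -> Y) (M : bundle Y) :
  sec_restricts (pullback f M).
Proof.
move=> U W s oW WU sU x Wx.
have [V0 [W' [g [e [[oV Vx VU] [oW' VW' rg se sge]]]]]] := sU x (WU _ Wx).
exists (V0 `&` W), W', g, e; split; [split|split] => //.
- exact: (ratio_opnI XG).
- by move=> y [+ _]; exact: VW'.
- by apply: (ratio_regS XG) rg => y [].
- by move=> y [+ _]; exact: sge.
Qed.

Lemma tensor_restricts (M M' : bundle X) :
  sec_restricts M -> sec_restricts M' -> sec_restricts (tensor M M').
Proof.
move=> Mr Mr' U W s oW WU sU x Wx.
have [V0 [a [b [[oV Vx VU] [sa sb sab]]]]] := sU x (WU _ Wx).
have oVW := ratio_opnI XG oV oW.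
exists (V0 `&` W), a, b; split; [split|split] => //.
- by apply: Mr sa => // y [].
- by apply: Mr' sb => // y [].
- by move=> y [+ _]; exact: sab.
Qed.

Lemma frame_section (M : bundle X) (U : set X) e : frame M U e -> sec M U e.
Proof.
case=> oU _ Usec; apply/Usec => //; exists (fun=> 1).
  exact: (ratio_reg_cst XG).
by move=> y _; rewrite smul1.
Qed.

(** The coefficient of a section with respect to a frame is unique, so local
    regularity of the coefficients glues. *)
Lemma frame_glue (A : Type) (W : set X) (s e : X -> A -> F) :
  (forall y, W y -> e y <> 0) ->
  (forall x, W x -> exists (V : set X) g, [/\ opn V, V x, regular V g
     & forall y, W y -> V y -> s y = smul (g y) (e y)]) ->
  exists2 g : X -> F, regular W g & forall y, W y -> s y = smul (g y) (e y).
Proof.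
move=> e0 H.
pose g y := xget 0 [set c : F | s y = smul c (e y)].
have gE y : W y -> s y = smul (g y) (e y).
  move=> Wy; have [V0 [h [_ Vy _ sh]]] := H y Wy.
  rewrite /g; case: xgetP => [c _ //|]; move=> /(_ (h y)); case.
  exact: sh.
exists g => //; apply: (ratio_reg_local XG) => x Wx.
have [V0 [h [oV Vx rh sh]]] := H x Wx; exists V0, h; split=> // y Wy Vy.
by apply: (smul_inj (e0 _ Wy)); rewrite -gE // sh.
Qed.

(** Local sections of the pullback are multiples of pulled back sections, and
    those are multiples of the pulled back frame; the two coefficients multiply. *)
Lemma frame_pullback (Y : fspace F) V' (r' : Y -> V') G' (f : X -> Y)
    (M : bundle Y) (U : set Y) e :
  ratio_space r' G' -> Defs.morphism f -> sec_restricts M ->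
  frame M U e -> frame (pullback f M) (f @^-1` U) (e \o f).
Proof.
move=> YG fm Mr fr; have [oU Ue Usec] := fr; split.
- by have [] := fm _ oU.
- by move=> y /Ue.
- move=> W s oW WU; split; last first.
    move=> [g rg sge] x Wx; exists W, U, g, e; split=> //; split=> //.
    by apply/Usec => //; exists (fun=> 1); [exact: (ratio_reg_cst YG) |
       move=> y _; rewrite smul1].
  move=> sW; apply: frame_glue => [y /WU/Ue[]//|x Wx].
  have [V0 [W' [g [e' [[oV Vx VW] [oW' VW' rg se' sge]]]]]] := sW x Wx.
  have oWU := ratio_opnI YG oW' oU.
  have /Usec[//|y []//|g' rg' e'E] : sec M (W' `&` U) e'.
    by apply: Mr se' => // y [].
  exists V0, (g * (g' \o f)); split=> //.
    apply: (ratio_regM XG) => //; apply: (ratio_regS XG) (_ : regular (f @^-1` (W' `&` U)) _).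
      by move=> y Vy; split; [exact: VW' | apply: WU; exact: VW].
    by have [_] := fm _ oWU; apply.
  move=> y Wy Vy; rewrite sge // e'E ?smulA //.
  by split; [exact: VW' | exact: WU].
Qed.

Lemma frame_tensor (M M' : bundle X) (U : set X) e e' :
  sec_restricts M -> sec_restricts M' ->
  frame M U e -> frame M' U e' ->
  frame (tensor M M') U (fun x => pure (e x) (e' x)).
Proof.
move=> Mr Mr' fr fr'; have [oU Ue Usec] := fr; have [_ Ue' Usec'] := fr'.
split=> //.
- move=> y Uy; have [e0 fe] := Ue _ Uy; have [e0' fe'] := Ue' _ Uy.
  split; first exact: pure_neq0.
  apply/seteqP; split=> h /=.
    rewrite fe fe' => -[_ [_ [[c _ <-] [d _ <-] ->]]].
    by exists (c * d) => //; rewrite pure_smul.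
  move=> [c _ <-]; exists (smul c (e y)), (e' y).
  rewrite fe fe'; split; [by exists c | by exists 1 => //; rewrite smul1|].
  by rewrite -[e' y in RHS]smul1 pure_smul mulr1.
- move=> W s oW WU; split; last first.
    move=> [g rg sge] x Wx; exists W, (fun x => smul (g x) (e x)), e'.
    split; first by split=> // y.
    split.
    + by apply: (Usec W _ oW WU).2; exists g.
    + exact: Mr' (frame_section fr').
    + by move=> y Wy; rewrite sge // -[e' y in RHS]smul1 pure_smul mulr1.
  move=> sW; apply: frame_glue => [y /WU Uy|x Wx].
    by apply: pure_neq0; [have [] := Ue _ Uy | have [] := Ue' _ Uy].
  have [V0 [a [b [[oV Vx VW] [sa sb sab]]]]] := sW x Wx.
  have VU := subset_trans VW WU.
  have [g rg aE] := (Usec _ _ oV VU).1 sa.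
  have [g' rg' bE] := (Usec' _ _ oV VU).1 sb.
  exists V0, (g * g'); split=> //; first exact: (ratio_regM XG).
  by move=> y Wy Vy; rewrite sab // aE // bE // pure_smul.
Qed.

Lemma frame_restrict (M : bundle X) (U W : set X) e :
  opn W -> W `<=` U -> frame M U e -> frame M W e.
Proof.
move=> oW WU [oU Ue Usec]; split=> // [y /WU/Ue //|W' s oW' W'W].
by apply: Usec => //; exact: subset_trans W'W WU.
Qed.

Lemma frames_line_bundle (M : bundle X) : sec_local M ->
  (forall x, exists (U : set X) e, U x /\ frame M U e) -> line_bundle M.
Proof.
move=> Ml H; split=> // x.
by have [U [e [Ux [oU Ue Usec]]]] := H x; exists U, e; split.
Qed.

(** On the common domain of two matching frames a section and its image have
    the same coefficient function, and sections are determined locally. *)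
Lemma frames_bundle_iso (M N : bundle X) Psi :
  sec_local M -> sec_local N -> sec_restricts M -> sec_restricts N ->
  (forall x, exists (U : set X) e e', [/\ U x, frame M U e, frame N U e'
     & forall y c, U y -> Psi y (smul c (e y)) = smul c (e' y)]) ->
  @bundle_iso F X M N Psi.
Proof.
move=> Ml Nl Mr Nr H; split.
- move=> x; have [U [e [e' [Ux [oU Ue _] [_ Ue' _] Pe]]]] := H x.
  have [e0 ->] := Ue _ Ux; have [e0' ->] := Ue' _ Ux; split.
  + by move=> _ /= [c _ <-]; rewrite Pe //; exists c.
  + move=> f g /[!inE] -[c _ <-] [d _ <-].
    by rewrite !Pe // => /(smul_inj e0') ->.
  + by move=> _ [c _ <-]; exists (smul c (e x)); [exists c | rewrite Pe].
- move=> x c f g; have [U [e [e' [Ux [oU Ue _] [_ Ue' _] Pe]]]] := H x.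
  have [_ ->] := Ue _ Ux => -[a _ <-] [b _ <-].
  rewrite smulA -smulDl.
  by rewrite !Pe // smulA -smulDl.
- move=> U s oU sf; split=> sU.
    apply/Nl => // x Ux; have [V0 [e [e' [Vx fM fN Pe]]]] := H x.
    have [oV Ve Vsec] := fM; have [_ _ Vsec'] := fN.
    have oUV := ratio_opnI XG oU oV.
    exists (U `&` V0); split=> //.
    have /Vsec[//|y []//|g rg sE] : sec M (U `&` V0) s by apply: Mr sU => // y [].
    have sub : U `&` V0 `<=` V0 by move=> y [].
    apply: (Vsec' _ _ oUV sub).2.
    by exists g => // y [Uy Vy]; rewrite sE // Pe.
  apply/Ml => // x Ux; have [V0 [e [e' [Vx fM fN Pe]]]] := H x.
  have [oV Ve Vsec] := fM; have [_ Ve' Vsec'] := fN.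
  have oUV := ratio_opnI XG oU oV.
  exists (U `&` V0); split=> //.
  have /Vsec'[//|y []//|g rg sE] : sec N (U `&` V0) (fun x => Psi x (s x)).
    by apply: Nr sU => // y [].
  have sub : U `&` V0 `<=` V0 by move=> y [].
  apply: (Vsec _ _ oUV sub).2.
  exists g => // y [Uy Vy]; have := sf y Uy; have [e0 ->] := Ve _ Vy.
  move=> -[c _ sc]; rewrite -sc; congr smul.
  have [e0' _] := Ve' _ Vy; apply: (smul_inj e0').
  by rewrite -sE // -sc Pe.
Qed.

End OnGood.
End Frames.
Arguments frame {F X} M U e.

(** * Projective space *)

Section Lines.
Variables (F : fieldType) (n : nat).
Implicit Types (l : line F n) (v : 'cV[F]_n).

Definition lrep l : 'cV[F]_n := vpick (val l).

Lemma dim_line l : \dim (val l) = 1%N.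
Proof. by apply/eqP; exact: (valP l). Qed.

Lemma lrep_neq0 l : lrep l != 0.
Proof. by rewrite vpick0 -dimv_eq0 dim_line. Qed.

Lemma line_span l v : v \in val l -> v != 0 -> val l = <[v]>%VS.
Proof.
move=> vl v0; apply/esym/eqP; rewrite eqEdim -memvE vl /= dim_line.
by rewrite dim_vline v0.
Qed.

Lemma lrep_mem l : lrep l \in val l. Proof. exact: memv_pick. Qed.

Lemma lrep_span l : val l = <[lrep l]>%VS.
Proof. exact: line_span (lrep_mem l) (lrep_neq0 l). Qed.

Lemma mem_line l v : v \in val l -> exists c, v = c *: lrep l.
Proof. by rewrite lrep_span => /vlineP. Qed.

Lemma memZ_line l c v : v \in val l -> c *: v \in val l.
Proof. exact: memvZ. Qed.

Lemma mem_line2 l v w : v \in val l -> v != 0 -> w \in val l ->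
  exists c, w = c *: v.
Proof. by move=> vl v0; rewrite (line_span vl v0) => /vlineP. Qed.

Lemma line_subproof v : v != 0 -> \dim <[v]>%VS == 1%N.
Proof. by move=> v0; rewrite dim_vline v0. Qed.

Definition mkline v (v0 : v != 0) : line F n :=
  exist (fun l : {vspace 'cV[F]_n} => \dim l == 1%N) _ (line_subproof v0).

Lemma mkline_mem v (v0 : v != 0) : v \in val (mkline v0).
Proof. exact: memv_line. Qed.

Lemma line_eq l l' v : v != 0 -> v \in val l -> v \in val l' -> l = l'.
Proof.
by move=> v0 vl vl'; apply: val_inj; rewrite (line_span vl v0) (line_span vl' v0).
Qed.

(** Forms are kept as functions rather than polynomials: products, sums and
    substitutions are then pointwise. *)
Definition form d : set ('cV[F]_n -> F) :=
  [set f | exists2 p : {mpoly F[n]}, p \is d.-homog & f = peval p].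

Lemma pevalZ d (p : {mpoly F[n]}) c v : p \is d.-homog ->
  peval p (c *: v) = c ^+ d * peval p v.
Proof.
move=> /dhomogP hp; rewrite /peval !mevalE mulr_sumr.
rewrite big_seq [in RHS]big_seq; apply: eq_bigr => m /hp /= md.
rewrite mulrCA; congr (_ * _); rewrite -md mdegE expr_sum -big_split /=.
by apply: eq_bigr => i _; rewrite mxE exprMn.
Qed.

Lemma pevalM (p q : {mpoly F[n]}) v : peval (p * q) v = peval p v * peval q v.
Proof. exact: mevalM. Qed.

Lemma formZ d f c v : form d f -> f (c *: v) = c ^+ d * f v.
Proof. by case=> p hp ->; exact: pevalZ. Qed.

Lemma form_cst c : form 0 (fun=> c).
Proof.
exists c%:MP; last by apply/funext => v; rewrite /peval mevalC.
by rewrite -[c%:MP]mulr1 mul_mpolyC dhomogZ ?dhomog1.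
Qed.

Lemma formD d f g : form d f -> form d g -> form d (f + g).
Proof.
move=> [p hp ->] [q hq ->]; exists (p + q); first exact: dhomogD.
by apply/funext => v; rewrite /peval mevalD.
Qed.

Lemma formM d e f g : form d f -> form e g -> form (d + e) (f * g).
Proof.
move=> [p hp ->] [q hq ->]; exists (p * q); first exact: dhomogM.
by apply/funext => v; rewrite /peval mevalM.
Qed.

Lemma form_graded : graded_family form.
Proof. by split; [exact: form_cst|exact: formD|exact: formM]. Qed.

Lemma form_scale d c f : form d f -> form d (fun v => c * f v).
Proof. exact: graded_scale form_graded. Qed.

Lemma form_exp d f k : form d f -> form (d * k) (fun v => f v ^+ k).
Proof.
move=> df; elim: k => [|k IH].
  by rewrite muln0; under [X in form _ X]eq_fun do rewrite expr0; exact: form_cst.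
by rewrite mulnS; under [X in form _ X]eq_fun do rewrite exprS; exact: formM.
Qed.

Lemma form_coord i : form 1 (fun v => v i ord0).
Proof.
exists 'X_i; last by apply/funext => v; rewrite /peval mevalXU.
by rewrite dhomogX /= mdeg1.
Qed.

Lemma exists_coord v : v != 0 -> exists i, v i ord0 != 0.
Proof.
move=> v0; apply: contrapT => /forallNP H; move/eqP: v0; apply.
by apply/colP => i; rewrite mxE; apply/eqP; have /negP := H i; rewrite negbK.
Qed.

(** An open set of projective space is determined by the forms that vanish off
    it, and a neighbourhood of a point can be shrunk to the nonvanishing locus of
    one form, by which numerator and denominator are then multiplied. *)
Lemma projspace_ratio : @ratio_space F (projspace F n) _ lrep form.
Proof.
have ratD (W : set (line F n)) l : projopn W -> W l ->
    exists d f, [/\ form d f, f (lrep l) != 0 & forall l', f (lrep l') != 0 -> W l'].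
  move=> [S Sh ->] [p [v [Sp vl pv]]]; have [d hp] := Sh _ Sp.
  exists d, (peval p); split; first by exists p.
  - have [c vE] := mem_line vl; move: pv.
    by rewrite vE (pevalZ _ _ hp) mulf_eq0 negb_or => /andP[].
  - by move=> l' pl'; exists p, (lrep l'); split=> //; exact: lrep_mem.
have Dopn d (p : {mpoly F[n]}) : p \is d.-homog ->
    projopn [set l | peval p (lrep l) != 0].
  move=> hp; exists [set p]; first by move=> _ ->; exists d.
  apply/seteqP; split=> l /=.
    by move=> pl; exists p, (lrep l); split=> //; exact: lrep_mem.
  move=> [_ [v [-> vl]]]; have [c ->] := mem_line vl.
  by rewrite (pevalZ _ _ hp) mulf_eq0 negb_or => /andP[].
split; first exact: form_graded.
- move=> U; split; first by move=> oU l; exact: ratD.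
  move=> H.
  exists [set p : {mpoly F[n]} | (exists d, p \is d.-homog) /\
     forall l, peval p (lrep l) != 0 -> U l]; first by move=> p [].
  apply/seteqP; split=> l /=.
    move=> /H[d [_ [[p hp ->] pl pU]]].
    by exists p, (lrep l); split=> //; [split=> //; exists d | exact: lrep_mem].
  move=> [p [v [[[d hp] pU] vl]]]; have [c ->] := mem_line vl.
  by rewrite (pevalZ _ _ hp) mulf_eq0 negb_or => /andP[_ /pU].
- move=> U f; split=> H l Ul.
    have [W [d [p [q [oW Wl hp hq pq]]]]] := H l Ul.
    have [e [g [hg gl gW]]] := ratD _ _ oW Wl.
    exists (d + e)%N, (peval p * g), (peval q * g); split.
    + by apply: formM => //; exists p.
    + by apply: formM => //; exists q.
    + apply: mulf_neq0 => //.
      by have [] := pq l (lrep l) Ul Wl (lrep_mem _) (lrep_neq0 _).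
    + move=> l' Ul'; rewrite mulf_eq0 negb_or => /andP[ql' gl'].
      have [_ ->] := pq l' (lrep l') Ul' (gW _ gl') (lrep_mem _) (lrep_neq0 _).
      by rewrite -mulf_div divff // mulr1.
  have [d [_ [_ [[p hp ->] [q hq ->] ql pq]]]] := H l Ul.
  exists [set l | peval q (lrep l) != 0], d, p, q; split=> //; first exact: Dopn hq.
  move=> l' v Ul' ql' vl' v0; have [c vE] := mem_line vl'.
  have c0 : c != 0 by apply: contraNneq v0 => c0; rewrite vE c0 scale0r.
  rewrite vE !(pevalZ _ _ hp) !(pevalZ _ _ hq) pq // mulf_neq0 ?expf_neq0 //.
  by rewrite -mulf_div divff ?mul1r // expf_neq0.
Qed.

(** The value 0 off the line is the one that the fibres of O(d) prescribe. *)
Definition form_section (f : 'cV[F]_n -> F) l v : F :=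
  if v \in val l then f v else 0.

Lemma serre_fibP d l f g : serre_fib d l f -> serre_fib d l g ->
  f (lrep l) = g (lrep l) -> f = g.
Proof.
move=> [fh f0] [gh g0] fg; apply/funext => v.
have [vl|vl] := boolP (v \in val l); last by rewrite f0 ?g0.
by have [c ->] := mem_line vl; rewrite fh ?gh ?fg //; exact: lrep_mem.
Qed.

Lemma form_section_fib d f l : form d f -> serre_fib d l (form_section f l).
Proof.
move=> df; rewrite /form_section; split=> [c v vl|v /negPf->//].
by rewrite memZ_line // vl (formZ _ _ df).
Qed.

Lemma serre_fib_smul d l c f : serre_fib d l f -> serre_fib d l (smul c f).
Proof.
move=> [fh f0]; rewrite /smul; split=> [a v vl|v vl]; first by rewrite fh // mulrCA.
by rewrite f0 // mulr0.
Qed.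

Lemma serre_restricts d : sec_restricts (serre F n d).
Proof.
move=> U W s oW WU [sf H]; split=> [l /WU/sf//|l /WU/H].
move=> [V [k [p [q [oV Vl hp hq pq]]]]]; exists V, k, p, q; split=> // l' v /WU.
exact: pq.
Qed.

Lemma form_section_rep f l : form_section f l (lrep l) = f (lrep l).
Proof. by rewrite /form_section lrep_mem. Qed.

(** The coefficient of a section s with respect to the form f is s / f,
    computed at any representative. *)
Lemma serre_frame d f : form d f ->
  frame (serre F n d) [set l | f (lrep l) != 0] (form_section f).
Proof.
move=> df; have PG := projspace_ratio; have oD := ratio_opnD PG df; split=> //.
- move=> l /= fl; split.
    move=> s0; have := congr1 (@^~ (lrep l)) s0; rewrite form_section_rep => f0.
    by rewrite f0 eqxx in fl.
  apply/seteqP; split=> h /=.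
    move=> hf; exists (h (lrep l) / f (lrep l)) => //.
    apply: serre_fibP (serre_fib_smul _ (form_section_fib l df)) hf _.
    by rewrite /smul form_section_rep divfK.
  by move=> [c _ <-]; exact: (serre_fib_smul c (form_section_fib l df)).
- move=> W s oW WD; split.
    move=> [sf H]; exists (fun l => s l (lrep l) / f (lrep l)).
      apply/(ratio_reg PG) => l Wl; have fl := WD _ Wl.
      have [V [k [p [q [oV Vl hp hq pq]]]]] := H l Wl.
      have [e [g [hg gl gV]]] := (ratio_opn PG V).1 oV _ Vl.
      exists (k + d + e)%N, (peval p * g), ((peval q * f) * g); split.
      + by apply: formM => //; exists p.
      + by apply: formM => //; apply: formM => //; exists q.
      + apply: mulf_neq0 => //; apply: mulf_neq0 => //.
        by have [] := pq l (lrep l) Wl Vl (lrep_mem _) (lrep_neq0 _).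
      + move=> l' Wl'; rewrite mulf_eq0 negb_or => /andP[_ gl'].
        have [q0 ->] := pq l' (lrep l') Wl' (gV _ gl') (lrep_mem _) (lrep_neq0 _).
        by rewrite -mulf_div divff // mulr1 -mulrA -invfM.
    move=> l Wl; apply: serre_fibP (sf _ Wl) (serre_fib_smul _ (form_section_fib l df)) _.
    by rewrite /smul form_section_rep divfK //; exact: WD.
  move=> [g /(ratio_reg PG) rg sg]; split.
    by move=> l Wl; rewrite sg //; exact: (serre_fib_smul _ (form_section_fib l df)).
  move=> l Wl; have [k [_ [_ [[p hp ->] [q hq ->] ql pq]]]] := rg l Wl.
  case: (df) => f' hf' fE.
  exists [set l | peval q (lrep l) != 0], k, (p * f'), q; split=> //.
  + by apply: (ratio_opnD PG) (_ : form k _); exists q.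
  + exact: dhomogM.
  move=> l' v Wl' ql' vl' v0; have [c vE] := mem_line vl'.
  have c0 : c != 0 by apply: contraNneq v0 => c0; rewrite vE c0 scale0r.
  split; first by rewrite vE (pevalZ _ _ hq) mulf_neq0 // expf_neq0.
  rewrite sg // /smul /form_section vl' pq // fE pevalM.
  rewrite vE !(pevalZ _ _ hp) !(pevalZ _ _ hq) -[X in _ = X / _]mulrA.
  by rewrite -mulf_div divff ?mul1r ?expf_neq0 // mulrAC.
Qed.

End Lines.
Arguments form {F} n d.

(** * Bihomogeneous forms and the product of two projective lines *)

Section Biforms.
Variables (F : fieldType).

Definition vec2 := 'cV[F]_2.

Definition biform (i j : nat) : set (vec2 * vec2 -> F) :=
  [set P | exists2 s : seq ({mpoly F[2]} * {mpoly F[2]}),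
     all (fun fg => (fg.1 \is i.-homog) && (fg.2 \is j.-homog)) s
     & P = fun z => \sum_(fg <- s) peval fg.1 z.1 * peval fg.2 z.2].

Lemma biform_pure i j (f g : vec2 -> F) :
  form 2 i f -> form 2 j g -> biform i j (fun z => f z.1 * g z.2).
Proof.
move=> [p hp ->] [q hq ->]; exists [:: (p, q)]; first by rewrite /= hp hq.
by apply/funext => z; rewrite big_seq1.
Qed.

Lemma biformD i j P Q : biform i j P -> biform i j Q -> biform i j (P + Q).
Proof.
move=> [s hs ->] [s' hs' ->]; exists (s ++ s'); first by rewrite all_cat hs.
by apply/funext => z; rewrite big_cat.
Qed.

Lemma biform0 i j : biform i j (fun=> 0).
Proof. by exists [::] => //; apply/funext => z; rewrite big_nil. Qed.

Lemma biform_sum i j (I : eqType) (s : seq I) (a : pred I) P :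
  (forall k, k \in s -> a k -> biform i j (P k)) ->
  biform i j (fun z => \sum_(k <- s | a k) P k z).
Proof.
elim: s => [|k s IH] H.
  by under [X in biform _ _ X]eq_fun do rewrite big_nil; exact: biform0.
under [X in biform _ _ X]eq_fun do rewrite big_cons.
have {}IH := IH (fun k ks => H k (mem_behead (s := _ :: _) ks)).
have [ak|_] := boolP (a k) => //.
by apply: (biformD (H k _ ak) IH); rewrite inE eqxx.
Qed.

Lemma biformM i j i' j' P Q : biform i j P -> biform i' j' Q ->
  biform (i + i') (j + j') (P * Q).
Proof.
move=> [s hs ->] [s' hs' ->].
exists [seq (fg.1 * fg'.1, fg.2 * fg'.2) | fg <- s, fg' <- s'].
  apply/allP => _ /allpairsP[[fg fg'] [/(allP hs)/= /andP[h1 h2]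
    /(allP hs')/= /andP[h1' h2'] ->]] /=.
  by rewrite !dhomogM.
apply/funext => z; rewrite big_allpairs_dep /=.
rewrite [LHS]big_distrl /=; apply: eq_bigr => fg _.
rewrite big_distrr /=; apply: eq_bigr => fg' _.
by rewrite !pevalM mulrACA.
Qed.

Lemma biformZ i j P (a b : F) u w : biform i j P ->
  P (a *: u, b *: w) = a ^+ i * b ^+ j * P (u, w).
Proof.
move=> [s hs ->]; rewrite mulr_sumr big_seq [in RHS]big_seq.
apply: eq_bigr => fg /(allP hs) /andP[h1 h2] /=.
by rewrite (pevalZ _ _ h1) (pevalZ _ _ h2) mulrACA.
Qed.

Lemma biform_cst c : biform 0 0 (fun=> c).
Proof.
have := biform_pure (form_cst _ c) (form_cst _ 1).
by congr (biform _ _ _); apply/funext => z; rewrite mulr1.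
Qed.

(** These are the forms of degree m for the line bundle O(2) [x] O(1). *)
Definition biform21 m := biform (2 * m) m.

Lemma biform21_graded : graded_family biform21.
Proof.
split; [exact: biform_cst | by move=> m; exact: biformD |].
by move=> m n P Q hP hQ; have := biformM hP hQ; rewrite -mulnDr.
Qed.

Lemma biform21M m n P Q : biform21 m P -> biform21 n Q ->
  biform21 (m + n) (P * Q).
Proof. by have [_ _ +] := biform21_graded; apply. Qed.

Lemma biform21_exp m P k : biform21 m P -> biform21 (m * k) (fun z => P z ^+ k).
Proof.
move=> hP; elim: k => [|k IH].
  by rewrite muln0; under [X in biform21 _ X]eq_fun do rewrite expr0; exact: biform_cst.
rewrite mulnS; under [X in biform21 _ X]eq_fun do rewrite exprS.
exact: biform21M.
Qed.

Definition P1 := projspace F 2.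
Definition prep (z : P1 * P1) : vec2 * vec2 := (lrep z.1, lrep z.2).

(** An element of a tensor product involves finitely many functions on each
    factor; multiplying their denominators lets it be written as one ratio. *)
Lemma common_denominator (X : fspace F) V (r : X -> V) G (U : set X) x :
  ratio_space r G -> opn U -> U x ->
  forall n (f : 'I_n -> X -> F), (forall i, regular U (f i)) ->
  exists d b (a : 'I_n -> V -> F),
    [/\ G d b, forall i, G d (a i), b (r x) != 0,
        forall y, b (r y) != 0 -> U y
      & forall i y, b (r y) != 0 -> f i y = a i (r y) / b (r y)].
Proof.
move=> XG oU Ux; have [_ _ GM] := ratio_graded XG; elim=> [f _|n IH f rf].
  have [d [b [Gb bx bU]]] := (ratio_opn XG U).1 oU _ Ux.
  by exists d, b, (fun=> b); split=> // -[].
have [d [b [a [Gb Ga bx bU fa]]]] := IH (fun i => f (lift ord_max i)) (fun i => rf _).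
have [e [a' [b' [Ga' Gb' b'x fa']]]] := (ratio_reg XG U _).1 (rf ord_max) _ Ux.
exists (d + e)%N, (b * b'),
  (fun i => if unlift ord_max i is Some j then a j * b' else b * a'); split.
- exact: GM.
- by move=> i; case: unliftP => [j _|_]; exact: GM.
- exact: mulf_neq0.
- by move=> y; rewrite mulf_eq0 negb_or => /andP[/bU].
- move=> i y; rewrite mulf_eq0 negb_or => /andP[by0 b'y].
  case: unliftP => [j ->|->].
    by rewrite fa // -mulf_div divff // mulr1.
  by rewrite fa' -?mulf_div ?divff ?mul1r //; exact: bU.
Qed.

Lemma linear_form_nonzero (v : vec2) : v != 0 -> exists2 f, form 2 1 f & f v != 0.
Proof.
by move=> /exists_coord[i vi]; exists (fun v => v i ord0) => //; exact: form_coord.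
Qed.

(** The bidegree (d, e) of the common denominator is raised to (2(d + e), d + e)
    by powers of linear forms that do not vanish at z. *)
Lemma tensor_fun_ratio (U V : set P1) k z : opn U -> opn V ->
  tensor_fun U V k -> (U `*` V) z ->
  exists m A C, [/\ biform21 m A, biform21 m C, C (prep z) != 0
    & forall z', C (prep z') != 0 -> (U `*` V) z' /\
        k z' = A (prep z') / C (prep z')].
Proof.
move=> oU oV [n [f [g [rf rg kE]]]] [Uz Vz].
have PG := projspace_ratio F 2.
have [d [b [a [Gb Ga bz bU fa]]]] := common_denominator PG oU Uz rf.
have [e [b' [a' [Gb' Ga' b'z bV ga]]]] := common_denominator PG oV Vz rg.
have [l hl lz] := linear_form_nonzero (lrep_neq0 z.1).
have [l' hl' l'z] := linear_form_nonzero (lrep_neq0 z.2).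
pose L (y : vec2 * vec2) := l y.1 ^+ (d + 2 * e) * l' y.2 ^+ d.
have hL : biform (d + 2 * e) d L.
  by have := biform_pure (form_exp (d + 2 * e) hl) (form_exp d hl'); rewrite !mul1n.
pose C (y : vec2 * vec2) := b y.1 * b' y.2 * L y.
pose A (y : vec2 * vec2) := (\sum_(i < n) a i y.1 * a' i y.2) * L y.
have E : (d + (d + 2 * e) = 2 * (d + e))%N by rewrite addnA addnn -mul2n mulnDr.
exists (d + e)%N, A, C; split.
- have := biformM (biform_sum (s := index_enum 'I_n) (a := predT) (P := fun i y => a i y.1 * a' i y.2)
    (fun i _ _ => biform_pure (Ga i) (Ga' i))) hL.
  rewrite E [(e + d)%N]addnC.
  by congr (biform _ _ _); apply/funext => y.
- by have := biformM (biform_pure Gb Gb') hL; rewrite E [(e + d)%N]addnC.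
- by rewrite /C /L /= !mulf_neq0 ?expf_neq0.
- move=> z'; rewrite /C /= !mulf_eq0 !negb_or => /andP[/andP[bz' b'z'] Lz'].
  split; first by split; [exact: bU | exact: bV].
  rewrite kE /A /C /= -mulf_div divff; last first.
    by case/andP: Lz' => ? ?; exact: mulf_neq0.
  rewrite mulr1 mulr_suml; apply: eq_bigr => i _.
  by rewrite fa // ga // mulf_div.
Qed.

(** Each term f(u) g(w) of a biform splits as a product of regular functions
    once f and g are divided by powers of fixed linear forms. *)
Lemma biform_tensor_fun m A (l l' : vec2 -> F) :
  biform21 m A -> form 2 1 l -> form 2 1 l' ->
  tensor_fun (X := P1) (Y := P1) [set x | l (lrep x) != 0] [set x | l' (lrep x) != 0]
    (fun z => A (prep z) / (l (lrep z.1) ^+ (2 * m) * l' (lrep z.2) ^+ m)).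
Proof.
move=> [s hs ->] hl hl'; have PG := projspace_ratio F 2.
exists (size s), (fun i x => peval (nth (0, 0) s i).1 (lrep x) / l (lrep x) ^+ (2 * m)),
  (fun i x => peval (nth (0, 0) s i).2 (lrep x) / l' (lrep x) ^+ m).
split.
- move=> i; apply/(ratio_reg PG) => x lx.
  have /andP[h1 _] := allP hs _ (mem_nth (0, 0) (ltn_ord i)).
  exists (2 * m)%N, (peval (nth (0, 0) s i).1), (fun v => l v ^+ (2 * m)).
  split=> //; first by exists (nth (0, 0) s i).1.
    by have := form_exp (2 * m) hl; rewrite mul1n.
  exact: expf_neq0.
- move=> i; apply/(ratio_reg PG) => x lx.
  have /andP[_ h2] := allP hs _ (mem_nth (0, 0) (ltn_ord i)).
  exists m, (peval (nth (0, 0) s i).2), (fun v => l' v ^+ m).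
  split=> //; first by exists (nth (0, 0) s i).2.
    by have := form_exp m hl'; rewrite mul1n.
  exact: expf_neq0.
- move=> z; rewrite (big_nth (0, 0)) big_mkord mulr_suml.
  by apply: eq_bigr => i _; rewrite mulf_div.
Qed.

Lemma biform_tensor_near (z : P1 * P1) :
  exists (U V : set P1) (l l' : vec2 -> F),
    [/\ opn U, opn V, (U `*` V) z,
        forall y, (U `*` V) y -> l (lrep y.1) != 0 /\ l' (lrep y.2) != 0
      & forall m A, biform21 m A -> tensor_fun (X := P1) (Y := P1) U V
          (fun z => A (prep z) / (l (lrep z.1) ^+ (2 * m) * l' (lrep z.2) ^+ m))].
Proof.
have PG := projspace_ratio F 2.
have [l hl lz] := linear_form_nonzero (lrep_neq0 z.1).
have [l' hl' l'z] := linear_form_nonzero (lrep_neq0 z.2).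
exists [set x | l (lrep x) != 0], [set x | l' (lrep x) != 0], l, l'.
split=> //; [exact: (ratio_opnD PG hl)|exact: (ratio_opnD PG hl')|].
by move=> m A hA; exact: biform_tensor_fun.
Qed.

(** The basic open sets of the product are those of the embedding by
    O(2) [x] O(1), because that bundle is ample. *)
Lemma P1xP1_ratio : @ratio_space F (prodspace P1 P1) _ prep biform21.
Proof.
have PG := projspace_ratio F 2; split; first exact: biform21_graded.
- move=> O; split=> H z Oz.
    have [U [V [k [[oU oV tk] [UVz kz kO]]]]] := H z Oz.
    have [m [A [C [hA hC Cz CH]]]] := tensor_fun_ratio oU oV tk UVz.
    exists (m + m)%N, (A * C); split; first exact: biform21M.
      have [_ kE] := CH _ Cz; move: kz; rewrite kE mulf_eq0 negb_or => /andP[Az _].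
      exact: mulf_neq0.
    move=> y; rewrite mulf_eq0 negb_or => /andP[Ay Cy].
    by have [UVy kE] := CH _ Cy; apply: kO => //; rewrite kE mulf_neq0 ?invr_neq0.
  have [m [A [hA Az AO]]] := H z Oz.
  have [U [V [l [l' [oU oV UVz ll tl]]]]] := biform_tensor_near z.
  exists U, V, (fun z => A (prep z) / (l (lrep z.1) ^+ (2 * m) * l' (lrep z.2) ^+ m)).
  split; first by split=> //; exact: tl.
  split=> //.
    by have [? ?] := ll _ UVz; rewrite mulf_neq0 // invr_neq0 // mulf_neq0 ?expf_neq0.
  by move=> y _; rewrite mulf_eq0 negb_or => /andP[/AO].
- move=> O f; split=> H z Oz.
    have [U [V [h [k [[oU oV th tk] [UVz kz fhk]]]]]] := H z Oz.
    have [m [A [C [hA hC Cz CH]]]] := tensor_fun_ratio oU oV tk UVz.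
    have [n [B [D [hB hD Dz DH]]]] := tensor_fun_ratio oU oV th UVz.
    exists (m + n + m)%N, (B * C * C), (A * D * C); split.
    + by apply: biform21M => //; rewrite addnC; exact: biform21M.
    + by apply: biform21M => //; exact: biform21M.
    + have [_ kE] := CH _ Cz; move: kz; rewrite kE mulf_eq0 negb_or => /andP[Az _].
      by rewrite !mulf_neq0.
    + move=> y Oy; rewrite !mulf_eq0 !negb_or => /andP[/andP[Ay Dy] Cy].
      have [UVy kE] := CH _ Cy; have [_ hE] := DH _ Dy.
      rewrite fhk //; last by rewrite kE mulf_neq0 ?invr_neq0.
      rewrite hE kE -[RHS]mulf_div divff // mulr1.
      by rewrite invf_div mulf_div (mulrC (D _)).
  have [m [A [B [hA hB Bz fAB]]]] := H z Oz.
  have [U [V [l [l' [oU oV UVz ll tl]]]]] := biform_tensor_near z.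
  pose L z := l (lrep z.1) ^+ (2 * m) * l' (lrep z.2) ^+ m.
  have L0 y : (U `*` V) y -> L y != 0.
    by move=> /ll[? ?]; rewrite mulf_neq0 ?expf_neq0.
  exists U, V, (fun z => A (prep z) / L z), (fun z => B (prep z) / L z).
  split; first by split=> //; exact: tl.
  split=> //; first by rewrite mulf_neq0 ?invr_neq0 // L0.
  move=> y Oy UVy; rewrite mulf_eq0 negb_or => /andP[By _].
  by rewrite fAB // invf_div mulrA divfK ?L0.
Qed.

End Biforms.

(** * Pluecker coordinates *)

Section Indices.

Definition o0 : 'I_3 := Ordinal (isT : 0 < 3)%N.
Definition o1 : 'I_3 := Ordinal (isT : 1 < 3)%N.
Definition o2 : 'I_3 := Ordinal (isT : 2 < 3)%N.

Lemma ord3P (P : 'I_3 -> Prop) : P o0 -> P o1 -> P o2 -> forall a, P a.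
Proof.
move=> p0 p1 p2 [[|[|[|//]]] lt].
- by rewrite (_ : Ordinal lt = o0) //; exact: val_inj.
- by rewrite (_ : Ordinal lt = o1) //; exact: val_inj.
- by rewrite (_ : Ordinal lt = o2) //; exact: val_inj.
Qed.

Let ltI (i j : 'I_7) := (i < j)%N.

Lemma enum_sorted (A : {set 'I_7}) : sorted ltI (enum A).
Proof.
rewrite {1}/enum_mem -enumT; apply: sorted_filter; first by move=> x y z; exact: ltn_trans.
have := iota_ltn_sorted 0 7; rewrite -val_enum_ord sorted_map //.
Qed.

Lemma enum_triple (i j k : 'I_7) : (i < j)%N -> (j < k)%N ->
  enum [set i; j; k]%SET = [:: i; j; k].
Proof.
move=> ij jk; apply: (@irr_sorted_eq _ ltI).
- by move=> x y z; exact: ltn_trans.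
- by move=> x; exact: ltnn.
- exact: enum_sorted.
- by rewrite /= /ltI ij jk.
- by move=> x; rewrite mem_enum !inE -orbA.
Qed.

Lemma card_triple (i j k : 'I_7) : i != j -> i != k -> j != k ->
  #|[set i; j; k]%SET| == 3%N.
Proof.
move=> ij ik jk; rewrite finset.setUC cardsU1 cards2 !inE negb_or ij.
by rewrite (eq_sym k) ik (eq_sym k) jk.
Qed.

Lemma triple012 : #|[set ord0; Ordinal (isT : 1 < 7)%N; Ordinal (isT : 2 < 7)%N]%SET| == 3%N.
Proof. exact: card_triple. Qed.

(** The index of the 3-subset S, with a dummy value when S is not one. *)
Definition ix (S : {set 'I_7}) : 'I_N := enum_rank 
  (insubd (exist (fun I : {set 'I_7} => #|I| == 3%N) _ triple012 : triple) S).

Lemma ixK (S : {set 'I_7}) : #|S| == 3%N -> val (enum_val (ix S) : triple) = S.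
Proof. by move=> S3; rewrite /ix enum_rankK insubdK. Qed.

Lemma elt_ix (i j k : 'I_7) : (i < j)%N -> (j < k)%N ->
  [/\ elt (ix [set i; j; k]%SET) o0 = i, elt (ix [set i; j; k]%SET) o1 = j
    & elt (ix [set i; j; k]%SET) o2 = k].
Proof.
move=> ij jk; rewrite /elt ixK ?enum_triple //; apply: card_triple.
- by rewrite neq_ltn ij.
- by rewrite neq_ltn (ltn_trans ij jk).
- by rewrite neq_ltn jk.
Qed.

Lemma elt_enum (n : 'I_N) : enum (val (enum_val n : triple)) =
  [:: elt n o0; elt n o1; elt n o2].
Proof.
have : size (enum (val (enum_val n : triple))) = 3%N.
  by rewrite -cardE; apply/eqP; exact: (valP (enum_val n : triple)).
rewrite /elt; by case: (enum _) => [|x [|y [|z []]]].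
Qed.

Lemma elt_lt n : (elt n o0 < elt n o1)%N /\ (elt n o1 < elt n o2)%N.
Proof.
have := enum_sorted (val (enum_val n : triple)).
by rewrite elt_enum /= /ltI andbT => /andP.
Qed.

Lemma elt_set n : val (enum_val n : triple) = [set elt n o0; elt n o1; elt n o2]%SET.
Proof. by apply/setP => x; rewrite -mem_enum elt_enum !inE orbA. Qed.

Lemma ix_elt n : ix [set elt n o0; elt n o1; elt n o2]%SET = n.
Proof.
rewrite -elt_set /ix; apply: (can_inj enum_valK); rewrite enum_rankK.
by apply: val_inj; rewrite insubdK //; exact: (valP (enum_val n : triple)).
Qed.

Lemma elt_neq n m : n != m -> exists a, forall b, elt n a != elt m b.
Proof.
move=> nm; apply: contrapT => /forallNP H; move/eqP: nm; apply.
have sub a : elt n a \in val (enum_val m : triple).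
  have := H a; rewrite elt_set !inE; apply: contra_notT.
  rewrite !negb_or -andbA => /and3P[h0 h1 h2].
  by apply: (ord3P (P := fun b => elt n a != elt m b)).
apply: (can_inj enum_valK); apply: val_inj; apply/eqP.
rewrite eqEcard; apply/andP; split.
  by rewrite {1}elt_set; apply/fintype.subsetP => x; rewrite !inE => /orP[/orP[]|] /eqP ->.
by rewrite (eqP (valP (enum_val n : triple))) (eqP (valP (enum_val m : triple))).
Qed.

End Indices.

Section Minors.
Variable A : comNzRingType.
Implicit Types (a b c : 'I_7 -> A).

Definition det3 a b c (i j k : 'I_7) : A :=
  a i * (b j * c k - b k * c j) - b i * (a j * c k - a k * c j)
  + c i * (a j * b k - a k * b j).

(** The Pluecker vector of the wedge product of a, b and c. *)
Definition minors a b c : 'cV[A]_N :=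
  \col_n det3 a b c (elt n o0) (elt n o1) (elt n o2).

Lemma det22 (M : 'M[A]_2) : \det M = M ord0 ord0 * M ord_max ord_max
  - M ord0 ord_max * M ord_max ord0.
Proof.
rewrite (expand_det_row _ ord0) 2!big_ord_recl big_ord0 /cofactor !det_mx11 !mxE.
pose m (k l : nat) := M (inord k) (inord l).
have mE i j : M i j = m i j by rewrite /m !inord_val.
rewrite !mE /= /bump /= expr0 expr1.
by rewrite mul1r addr0 mulN1r mulrN.
Qed.

Lemma det33 (M : 'M[A]_3) : \det M =
  M o0 o0 * (M o1 o1 * M o2 o2 - M o2 o1 * M o1 o2)
  - M o0 o1 * (M o1 o0 * M o2 o2 - M o2 o0 * M o1 o2)
  + M o0 o2 * (M o1 o0 * M o2 o1 - M o2 o0 * M o1 o1).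
Proof.
rewrite (expand_det_row _ o0) 3!big_ord_recl big_ord0 /cofactor !det22 !mxE.
pose m (k l : nat) := M (inord k) (inord l).
have mE i j : M i j = m i j by rewrite /m !inord_val.
rewrite !mE /= /bump /= expr0 expr1 sqrrN expr1n !mul1r addr0 mulN1r mulrN addrA.
by rewrite -!(mulrC (m 2 _)) // ![m 1 _ * m 2 _]mulrC.
Qed.

Lemma det3_minor (M : 'M[A]_7) (n p : 'I_N) :
  \det (\matrix_(a < 3, b < 3) M (elt n a) (elt p b)) =
  det3 (M^~ (elt p o0)) (M^~ (elt p o1)) (M^~ (elt p o2))
    (elt n o0) (elt n o1) (elt n o2).
Proof. by rewrite det33 !mxE. Qed.

End Minors.

Section Coordinates.
Variable A : comNzRingType.
Implicit Types (v : 'cV[A]_N) (a b c t : 'I_7 -> A).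

(** The coordinates of a trivector, extended to all triples of indices by
    antisymmetry. *)
Definition coord3 v (i j k : 'I_7) : A :=
  if [&& i != j, i != k & j != k] then
    (-1) ^+ ((j < i) + (k < i) + (k < j))%N * v (ix [set i; j; k]%SET) ord0
  else 0.

Lemma coord3_sorted v (i j k : 'I_7) : (i < j)%N -> (j < k)%N ->
  coord3 v i j k = v (ix [set i; j; k]%SET) ord0.
Proof.
move=> ij jk; have ik := ltn_trans ij jk.
rewrite /coord3 !neq_ltn ij ik jk /= ltnNge (ltnW ij) /= ltnNge (ltnW ik) /=.
by rewrite ltnNge (ltnW jk) mul1r.
Qed.

Lemma coord3_elt v n : coord3 v (elt n o0) (elt n o1) (elt n o2) = v n ord0.
Proof. by have [? ?] := elt_lt n; rewrite coord3_sorted // ix_elt. Qed.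

Lemma minors_sorted a b c (i j k : 'I_7) : (i < j)%N -> (j < k)%N ->
  minors a b c (ix [set i; j; k]%SET) ord0 = det3 a b c i j k.
Proof. by move=> ij jk; rewrite mxE; have [-> -> ->] := elt_ix ij jk. Qed.

Lemma coord3_minors a b c i j k : coord3 (minors a b c) i j k = det3 a b c i j k.
Proof.
have S12 (x y z : 'I_7) : [set x; y; z]%SET = [set y; x; z]%SET.
  by rewrite (finset.setUC [set x]%SET).
have S23 (x y z : 'I_7) : [set x; y; z]%SET = [set x; z; y]%SET.
  by rewrite -!finset.setUA (finset.setUC [set y]%SET).
rewrite /coord3 -!val_eqE /=.
have [ij|ij|/val_inj ->] := ltngtP i j; last by rewrite /= /det3; ring.
- have [jk|jk|/val_inj ->] := ltngtP j k; last by rewrite andbF /det3; ring.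
  + have ik := ltn_trans ij jk; rewrite ltn_eqF //= ltnNge (ltnW ik) /=.
    by rewrite minors_sorted // mul1r.
  + have [ik|ik|/val_inj ->] := ltngtP i k; last by rewrite /= /det3; ring.
    * by rewrite S23 /= minors_sorted // /det3; ring.
    * by rewrite S23 S12 /= minors_sorted // /det3; ring.
- have [jk|jk|/val_inj ->] := ltngtP j k; last by rewrite andbF /det3; ring.
  + have [ik|ik|/val_inj ->] := ltngtP i k; last by rewrite /= /det3; ring.
    * by rewrite S12 /= minors_sorted // /det3; ring.
    * by rewrite S12 S23 /= minors_sorted // /det3; ring.
  + have ki := ltn_trans jk ij; rewrite gtn_eqF //= ki /=.
    by rewrite S12 S23 S12 minors_sorted // /det3; ring.
Qed.

Lemma eq_coord3 v w : (forall i j k, coord3 v i j k = coord3 w i j k) -> v = w.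
Proof. by move=> vw; apply/colP => n; rewrite -!coord3_elt vw. Qed.

Lemma coord3Z x v i j k : coord3 (x *: v) i j k = x * coord3 v i j k.
Proof. by rewrite /coord3; case: ifP; rewrite ?mulr0 // mxE mulrCA. Qed.

(** Cramer's rule: a decomposable trivector is determined by its coordinates on
    the triples that share at least two indices with a given triple. *)
Definition cramer_rel v i j k l m n :=
  coord3 v i j k ^+ 2 * coord3 v l m n -
  det3 (fun x => coord3 v x j k) (fun x => coord3 v i x k) (fun x => coord3 v i j x) l m n.

Lemma cramer_minors a b c i j k l m n : cramer_rel (minors a b c) i j k l m n = 0.
Proof. by rewrite /cramer_rel /det3 !coord3_minors /det3; ring. Qed.

(** The action of the diagonal matrix with entries t. *)
Definition wt t (n : 'I_N) : A := t (elt n o0) * t (elt n o1) * t (elt n o2).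
Definition tor t v : 'cV[A]_N := \col_n (wt t n * v n ord0).

Lemma coord3_tor t v i j k : coord3 (tor t v) i j k = t i * t j * t k * coord3 v i j k.
Proof.
rewrite /coord3; case: ifP => [/and3P[ij ik jk]|]; last by rewrite mulr0.
rewrite mxE mulrCA; congr (_ * _).
suff -> : wt t (ix [set i; j; k]%SET) = \prod_(x in [set i; j; k]%SET) t x.
  rewrite finset.setUC big_setU1 ?big_setU1 ?big_set1 ?inE ?ij //=.
    by rewrite mulrC.
  by rewrite negb_or eq_sym ik eq_sym jk.
set S := [set i; j; k]%SET.
have S3 : #|S| == 3%N by exact: card_triple.
rewrite -big_enum /= -(ixK S3) elt_enum.
by rewrite !big_cons big_nil mulr1 /wt (ixK S3) mulrA.
Qed.

Lemma tor_minors t a b c : tor t (minors a b c) =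
  minors (fun i => t i * a i) (fun i => t i * b i) (fun i => t i * c i).
Proof. by apply/colP => n; rewrite !mxE /det3 /wt; ring. Qed.

Lemma torM t t' v : tor t (tor t' v) = tor (fun i => t i * t' i) v.
Proof. by apply/colP => n; rewrite !mxE /wt; ring. Qed.

Lemma torZ t x v : tor t (x *: v) = x *: tor t v.
Proof. by apply/colP => n; rewrite !mxE mulrCA. Qed.

Lemma tor_const x v : tor (fun=> x) v = x ^+ 3 *: v.
Proof. by apply/colP => n; rewrite !mxE /wt; ring. Qed.

End Coordinates.

Section Wedge.
Variable F : fieldType.
Implicit Types (g t : 'M[F]_7) (v : 'cV[F]_N).

Lemma wedge3_evec g (i j k : 'I_7) : (i < j)%N -> (j < k)%N ->
  wedge3 g *m evec F [set i; j; k]%SET = minors (g^~ i) (g^~ j) (g^~ k).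
Proof.
move=> ij jk; apply/colP => n; rewrite !mxE (bigD1 (ix [set i; j; k]%SET)) //= big1.
  have S3 : #|[set i; j; k]%SET| == 3%N.
    by apply: card_triple; rewrite neq_ltn ?ij ?jk ?(ltn_trans ij jk).
  rewrite addr0 !mxE ixK // eqxx mulr1 det3_minor.
  by have [-> -> ->] := elt_ix ij jk.
move=> m mS; rewrite !mxE; case: eqP; rewrite ?mulr0 // => mE.
by move: mS; rewrite -mE elt_set ix_elt eqxx.
Qed.

Lemma wedge3_diag t v : is_diag_mx t -> wedge3 t *m v = tor (fun i => t i i) v.
Proof.
move=> /is_diag_mxP td; apply/colP => n; rewrite !mxE (bigD1 n) //= big1.
  rewrite addr0 mxE det3_minor; congr (_ * _); have [e01 e12] := elt_lt n.
  have e02 := ltn_trans e01 e12.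
  have z (i j : 'I_7) : (i < j)%N -> (t i j = 0) * (t j i = 0).
    by move=> ij; split; apply: td; rewrite neq_ltn ij ?orbT.
  by rewrite /det3 !(z _ _ e01) !(z _ _ e12) !(z _ _ e02) /wt; ring.
move=> m mn; rewrite mxE det3_minor.
have [a ea] : exists a, forall b, elt n a != elt m b by apply: elt_neq; rewrite eq_sym.
have z b : t (elt n a) (elt m b) = 0 by apply: td; exact: ea.
suff -> : det3 (t^~ (elt m o0)) (t^~ (elt m o1)) (t^~ (elt m o2))
  (elt n o0) (elt n o1) (elt n o2) = 0 by rewrite mul0r.
rewrite /det3; move: a {ea} z.
by apply: ord3P => z; rewrite !z; ring.
Qed.

Lemma wedge_act_line g v : wedge_act g <[v]>%VS = <[wedge3 g *m v]>%VS.
Proof. by rewrite /wedge_act limg_line lfunE. Qed.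

Definition tmx (t : 'I_7 -> F) : 'M[F]_7 := diag_mx (\row_i t i).

Lemma tmx_torus (t : 'I_7 -> F) : \prod_i t i = 1 -> torus (tmx t).
Proof.
move=> t1; split; last exact: diag_mx_is_diag.
by change (\det (tmx t) = 1); rewrite det_diag -[RHS]t1; apply: eq_bigr => i _; rewrite mxE.
Qed.

Lemma wedge3_tmx (t : 'I_7 -> F) v : wedge3 (tmx t) *m v = tor t v.
Proof.
rewrite wedge3_diag ?diag_mx_is_diag //; congr (tor _ _).
by apply/funext => i; rewrite !mxE eqxx.
Qed.

End Wedge.

(** * The Richardson variety *)

Section Closures.
Variables (F : fieldType) (n : nat).

Lemma form_diag d (f : 'cV[F]_n -> F) (c : 'I_n -> F) : form n d f ->
  form n d (fun v => f (\col_i (c i * v i ord0))).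
Proof.
case=> p /dhomogP hp ->.
exists (\sum_(m <- msupp p) (p@_m * \prod_i c i ^+ m i) *: 'X_[m]).
  rewrite big_seq; apply: rpred_sum => m /hp /= md.
  by apply: dhomogZ; rewrite dhomogX /= md.
apply/funext => v; rewrite /peval mevalE [RHS]raddf_sum /=; apply: eq_bigr => m _.
rewrite mevalZ mevalX -mulrA -big_split /=; congr (_ * _); apply: eq_bigr => i _.
by rewrite mxE exprMn.
Qed.

Lemma form_line d (f : 'cV[F]_n -> F) (l : line F n) v : form n d f ->
  v \in val l -> v != 0 -> (f v != 0) = (f (lrep l) != 0).
Proof.
move=> hf vl v0; have [c vE] := mem_line vl.
have c0 : c != 0 by apply: contraNneq v0 => c0; rewrite vE c0 scale0r.
by rewrite vE (formZ _ _ hf) mulf_eq0 expf_eq0 (negPf c0) andbF.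
Qed.

(** The nonvanishing locus of f is an open set that misses S. *)
Lemma zclosure_form d (f : 'cV[F]_n -> F) (S : set (projspace F n)) l :
  form n d f -> (forall y, S y -> f (lrep y) = 0) -> zclosure S l -> f (lrep l) = 0.
Proof.
move=> hf fS Sl; apply: contrapT => /eqP fl.
have [y /fS fy /=] := Sl _ (ratio_opnD (projspace_ratio F n) hf) fl.
by rewrite fy eqxx.
Qed.

Lemma sub_zclosure (S : set (projspace F n)) : S `<=` zclosure S.
Proof. by move=> l Sl U oU Ul; exists l. Qed.

Definition curve (p : {mpoly F[n]}) (W : 'cV[{poly F}]_n) : {poly F} :=
  mmap polyC (fun i => W i ord0) p.

Lemma horner_curve p W x :
  (curve p W).[x] = peval p (map_mx (horner_eval x) W).
Proof.
rewrite /curve /peval mevalE -horner_evalE /mmap raddf_sum /=; apply: eq_bigr => m _.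
rewrite rmorphM rmorph_prod /= horner_evalE hornerC; congr (_ * _).
by apply: eq_bigr => i _; rewrite rmorphXn /= mxE.
Qed.

End Closures.

Section FormCoordinates.
Variable F : fieldType.

Lemma form_coord3 i j k : form N 1 (fun v : 'cV[F]_N => coord3 v i j k).
Proof.
rewrite /coord3; case: [&& i != j, i != k & j != k]; last first.
  by have := form_scale 0 (form_coord F (ix [set i; j; k]%SET));
    congr (form _ _ _); apply/funext => v; rewrite mul0r.
exact: form_scale (form_coord _ _).
Qed.

Lemma form_opp n d (f : 'cV[F]_n -> F) : form n d f -> form n d (- f).
Proof.
move=> /(form_scale (-1)); congr (form n d _).
by apply/funext => v; rewrite mulN1r.
Qed.

Lemma form_det3 n d (a b c : 'cV[F]_n -> 'I_7 -> F) i j k :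
  (forall x, form n d (a^~ x)) -> (forall x, form n d (b^~ x)) ->
  (forall x, form n d (c^~ x)) ->
  form n (d + (d + d)) (fun v => det3 (a v) (b v) (c v) i j k).
Proof.
move=> ha hb hc.
have minor2 (f g f' g' : 'cV[F]_n -> F) : form n d f -> form n d g ->
    form n d f' -> form n d g' -> form n (d + d) (f * g - f' * g').
  by move=> *; apply: formD; [|apply: form_opp]; exact: formM.
by apply: formD; [apply: formD; [|apply: form_opp]|]; apply: formM => //; exact: minor2.
Qed.

Lemma form_cramer i j k l m n :
  form N 3 (fun v : 'cV[F]_N => cramer_rel v i j k l m n).
Proof.
apply: formD; last first.
  by apply: form_opp; apply: (@form_det3 N 1) => x; exact: form_coord3.
by apply: (@formM _ _ 2 1); [exact: (form_exp 2 (form_coord3 i j k)) | exact: form_coord3].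
Qed.

End FormCoordinates.

Section Slice.
Variable A : comNzRingType.

Definition slice_a (i : 'I_7) : A := (i < 3)%:R.
Definition slice_b (u0 u1 : A) (i : 'I_7) : A := [:: 0; u0; u1; 1; 1; 0; 0]`_i.
Definition slice_c (w0 w1 : A) (i : 'I_7) : A := [:: 0; 0; 0; w0; w1; 1; 1]`_i.

(** A slice to the torus action. A general point of the Richardson variety is
    spanned by vectors supported on the first three, the first five and the last
    four coordinates; the diagonal matrices normalise all but four of their
    entries, up to adding a multiple of the first vector to the second. *)
Definition slice (u0 u1 w0 w1 : A) : 'cV[A]_N :=
  minors slice_a (slice_b u0 u1) (slice_c w0 w1).

End Slice.

Section SliceMorphism.
Variables (A B : comNzRingType) (h : {rmorphism A -> B}).

Lemma map_minors (a b c : 'I_7 -> A) :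
  map_mx h (minors a b c) = minors (h \o a) (h \o b) (h \o c).
Proof. by apply/colP => n; rewrite !mxE /det3 !(rmorphD, rmorphN, rmorphM). Qed.

Lemma map_slice u0 u1 w0 w1 :
  map_mx h (slice u0 u1 w0 w1) = slice (h u0) (h u1) (h w0) (h w1).
Proof.
have tabM s (i : 'I_7) : h s`_i = (map h s)`_i.
  have [i_lt|i_ge] := ltnP i (size s); first by rewrite (nth_map 0).
  by rewrite !nth_default ?size_map // rmorph0.
rewrite /slice map_minors; congr minors; apply/funext => i /=.
- exact: rmorph_nat.
- by rewrite /slice_b tabM /= rmorph0 rmorph1.
- by rewrite /slice_c tabM /= rmorph0 rmorph1.
Qed.

End SliceMorphism.

Notation "''i_' k" := (@Ordinal 7 k isT) (at level 8, k at level 2, format "''i_' k").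

Lemma vline_scale (F : fieldType) n (v : 'cV[F]_n) c : c != 0 -> <[c *: v]>%VS = <[v]>%VS.
Proof.
move=> c0; apply/eqP; rewrite eqEsubv -!memvE; apply/andP; split.
  by apply: memvZ; exact: memv_line.
by rewrite -{1}[v](scalerK c0); apply: memvZ; exact: memv_line.
Qed.

Lemma tmx_mulE (F : fieldType) (t : 'I_7 -> F) (b : 'M[F]_7) i j :
  (tmx t *m b) i j = t i * b i j.
Proof. by rewrite mul_diag_mx !mxE. Qed.

Section RichardsonVariety.
Variable F : closedFieldType.

Definition V3 := coset_triple (s_ 3).
Definition X := richardson F V3 w37.

Lemma V3E : V3 = [set 'i_0; 'i_1; 'i_3]%SET.
Proof.
have e2 : inord 2 = 'i_2 by apply: val_inj; rewrite /= inordK.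
have e3 : inord 3 = 'i_3 by apply: val_inj; rewrite /= inordK.
rewrite /V3 /coset_triple /s_ /= e2 e3.
apply/setP => x; apply/imsetP/idP => [[s]|].
  rewrite !inE => i3 ->; case: tpermP => [_|i3E|i2 _]; first by rewrite eqxx orbT.
    by rewrite i3E in i3.
  case: s i3 i2 => [[|[|[|//]]] lt] // _ i2; rewrite -!val_eqE //.
  by case: i2; exact: val_inj.
rewrite !inE => /orP[/orP[]|] /eqP ->.
- by exists 'i_0; rewrite ?inE ?tpermD.
- by exists 'i_1; rewrite ?inE ?tpermD.
- by exists 'i_2; rewrite ?inE ?tpermL.
Qed.

Lemma w37E : w37 = [set 'i_2; 'i_4; 'i_6]%SET.
Proof.
have e k (lt : (k < 7)%N) : inord k = Ordinal lt :> 'I_7 by apply: val_inj; rewrite /= inordK.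
by rewrite /w37 (e 2 isT) (e 4 isT) (e 6 isT).
Qed.

(** The matrix b carries the coordinate subspace of i, j, k to the span of its
    columns i, j, k. *)
Lemma orbit_minors (b : 'M[F]_7) (i j k : 'I_7) (l : line F N) :
  (i < j)%N -> (j < k)%N -> val l = wedge_act b <[evec F [set i; j; k]%SET]>%VS ->
  exists2 c, c != 0 & lrep l = c *: minors (b^~ i) (b^~ j) (b^~ k).
Proof.
move=> ij jk; rewrite wedge_act_line wedge3_evec // => lE.
have : lrep l \in val l by exact: lrep_mem.
rewrite lE => /vlineP[c lc]; exists c => //.
by apply: contraNneq (lrep_neq0 l) => c0; rewrite lc c0 scale0r.
Qed.

Lemma schubert_coord (i j k : 'I_7) l : @schubert F w37 l ->
  [&& 2 < i, 2 < j & 2 < k]%N || (1 < (4 < i) + (4 < j) + (4 < k))%N ->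
  coord3 (lrep l) i j k = 0.
Proof.
move=> Xl H; apply: (zclosure_form (form_coord3 F i j k)) Xl => y [b [_ btr]].
rewrite w37E => /orbit_minors[//|//|c _ ->].
rewrite coord3Z coord3_minors.
have z (r s : 'I_7) : (s < r)%N -> b r s = 0.
  by move=> sr; have /is_trig_mxP/(_ _ _ sr) := btr; rewrite mxE.
have z2 (r : 'I_7) : (2 < r)%N -> b r 'i_2 = 0 by move=> ?; exact: z.
have z4 (r : 'I_7) : (4 < r)%N -> b r 'i_4 = 0 by move=> ?; exact: z.
have z24 (r : 'I_7) : (4 < r)%N -> b r 'i_2 = 0 by move=> r4; apply: z2; lia.
rewrite /det3; case/orP: H => [/and3P[hi hj hk]|].
  by rewrite !z2 //; ring.
have [hi|_] := boolP (4 < i)%N; have [hj|_] := boolP (4 < j)%N;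
  have [hk|_] := boolP (4 < k)%N => // _.
- by rewrite !z24 //; ring.
- by rewrite !(z24 i, z24 j, z4 i, z4 j) //; ring.
- by rewrite !(z24 i, z24 k, z4 i, z4 k) //; ring.
- by rewrite !(z24 j, z24 k, z4 j, z4 k) //; ring.
Qed.

Lemma opp_schubert_coord (i j k : 'I_7) l : @opp_schubert F V3 l ->
  (i < 3)%N -> (j < 3)%N -> (k < 3)%N -> coord3 (lrep l) i j k = 0.
Proof.
move=> Xl hi hj hk; apply: (zclosure_form (form_coord3 F i j k)) Xl => y [b [_ btr]].
rewrite V3E => /orbit_minors[//|//|c _ ->].
rewrite coord3Z coord3_minors.
have z (r : 'I_7) : (r < 3)%N -> b r 'i_3 = 0.
  by move=> r3; have /is_trig_mxP := btr; apply.
by rewrite /det3 !z //; ring.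
Qed.

Lemma schubert_cramer i j k l m n y : @schubert F w37 y ->
  cramer_rel (lrep y) i j k l m n = 0.
Proof.
move=> Xy; apply: (zclosure_form (form_cramer F i j k l m n)) Xy => x [b _].
rewrite w37E => /orbit_minors[//|//|c _ ->].
have := cramer_minors (b^~ 'i_2) (b^~ 'i_4) (b^~ 'i_6) i j k l m n.
rewrite /cramer_rel /det3 !coord3Z => H.
by rewrite -[RHS](mulr0 (c ^+ 3)) -[in RHS]H; ring.
Qed.

(** * Torus stability *)

Lemma wt_neq0 (t : 'I_7 -> F) n : (forall i, t i != 0) -> wt t n != 0.
Proof. by move=> t0; rewrite /wt !mulf_neq0. Qed.

Lemma tor_neq0 (t : 'I_7 -> F) v : (forall i, t i != 0) -> v != 0 -> tor t v != 0.
Proof.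
move=> t0; apply: contraNneq => tv; apply/eqP/colP => n; rewrite mxE.
have /matrixP/(_ n ord0) := tv; rewrite !mxE => /eqP; rewrite mulf_eq0.
by rewrite (negPf (wt_neq0 n t0)) => /eqP.
Qed.

(** A torus element acts by a homeomorphism, since it turns forms into forms. *)
Lemma zclosure_torus (S : set (projspace F N)) (t : 'I_7 -> F) (l l' : line F N) :
  (forall i, t i != 0) ->
  (forall y y' : line F N, S y -> tor t (lrep y) \in val y' -> S y') ->
  zclosure S l -> tor t (lrep l) \in val l' -> zclosure S l'.
Proof.
move=> t0 St Sl tl U oU Ul'; have PG := projspace_ratio F N.
have [d [f [hf fl' fU]]] := (ratio_opn PG U).1 oU _ Ul'.
have hft : form N d (fun v => f (tor t v)) by exact: form_diag.
have [|y Sy fy] := Sl [set y | f (tor t (lrep y)) != 0] (ratio_opnD PG hft).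
  by rewrite /= (form_line hf tl) // tor_neq0 // lrep_neq0.
have ty0 : tor t (lrep y) != 0 by rewrite tor_neq0 // lrep_neq0.
exists (mkline ty0); first by apply: St Sy _; exact: mkline_mem.
by apply: fU; rewrite -(form_line hf (mkline_mem ty0)).
Qed.

Lemma orbit_torus (H : set 'M[F]_7) (i j k : 'I_7) (t : 'I_7 -> F)
    (y y' : line F N) :
  (i < j)%N -> (j < k)%N -> (forall b, H b -> H (tmx t *m b)) ->
  (exists2 b, H b & val y = wedge_act b <[evec F [set i; j; k]%SET]>%VS) ->
  tor t (lrep y) \in val y' -> (forall i, t i != 0) ->
  exists2 b, H b & val y' = wedge_act b <[evec F [set i; j; k]%SET]>%VS.
Proof.
move=> ij jk Ht [b Hb yE] ty t0; exists (tmx t *m b); first exact: Ht.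
have [c c0 cE] := orbit_minors ij jk yE.
rewrite (line_span ty) ?tor_neq0 ?lrep_neq0 // wedge_act_line wedge3_evec //.
rewrite cE torZ tor_minors.
have E (s : 'I_7) : (tmx t *m b)^~ s = (fun r => t r * b r s).
  by apply/funext => r; rewrite tmx_mulE.
rewrite !E.
exact: vline_scale.
Qed.

Definition torus_stable (S : set (projspace F N)) := forall t (l l' : line F N),
  \prod_i t i = 1 -> S l -> tor t (lrep l) \in val l' -> S l'.

Lemma prod_neq0 (t : 'I_7 -> F) : \prod_i t i != 0 -> forall i, t i != 0.
Proof. by move=> /prodf_neq0 t0 i; exact: t0. Qed.

Lemma orbit_closure_stable (H : set 'M[F]_7) (i j k : 'I_7) :
  (i < j)%N -> (j < k)%N ->
  (forall t b, \prod_i t i = 1 -> H b -> H (tmx t *m b)) ->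
  torus_stable (orbit_closure H [set i; j; k]%SET).
Proof.
move=> ij jk Ht t l l' t1; have t0 : forall i, t i != 0.
  by apply: prod_neq0; rewrite t1 oner_eq0.
apply: zclosure_torus => // y y' oy ty; apply: orbit_torus ty t0 => // b.
exact: Ht.
Qed.

Lemma X_stable : torus_stable X.
Proof.
have sl t (b : 'M[F]_7) : \prod_i t i = 1 -> \det b = 1 -> \det (tmx t *m b) = 1.
  move=> t1 b1; rewrite det_mulmx b1 mulr1 det_diag -[RHS]t1.
  by apply: eq_bigr => i _; rewrite mxE.
move=> t l l' t1 [Sl Ol] tl; split.
  move: Sl tl; rewrite /schubert w37E; apply: orbit_closure_stable => //.
  move=> {}t b {}t1 [b1 btr]; split; first exact: sl.
  apply/is_trig_mxP => i j ij; have /is_trig_mxP/(_ i j ij) := btr.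
  by rewrite mxE => bji; rewrite mxE tmx_mulE bji mulr0.
move: Ol tl; rewrite /opp_schubert V3E; apply: orbit_closure_stable => //.
move=> {}t b {}t1 [b1 btr]; split; first exact: sl.
apply/is_trig_mxP => i j ij; have /is_trig_mxP/(_ i j ij) := btr.
by move=> bij; rewrite tmx_mulE bij mulr0.
Qed.

(** * The slice lies in the Richardson variety *)

Lemma slice_coord035 (A : comNzRingType) (u0 u1 w0 w1 : A) :
  coord3 (slice u0 u1 w0 w1) 'i_0 'i_3 'i_5 = 1.
Proof. by rewrite coord3_minors /det3 /slice_a /slice_b /slice_c /=; ring. Qed.

Lemma coord3_0 (A : comNzRingType) i j k : coord3 (0 : 'cV[A]_N) i j k = 0.
Proof. by rewrite /coord3; case: ifP; rewrite // mxE mulr0. Qed.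

Lemma slice_neq0 (u0 u1 w0 w1 : F) : slice u0 u1 w0 w1 != 0.
Proof.
apply/eqP => s0; have := slice_coord035 u0 u1 w0 w1.
by rewrite s0 coord3_0 => /esym/eqP; rewrite oner_eq0.
Qed.

Definition slice_line (u0 u1 w0 w1 : F) : line F N := mkline (slice_neq0 u0 u1 w0 w1).

(** The spanning vectors of the slice are columns 3, 5 and 7 of a unipotent
    upper triangular matrix, so the slice lies in the orbit itself. *)
Lemma slice_schubert u0 u1 w0 w1 : @schubert F w37 (slice_line u0 u1 w0 w1).
Proof.
apply: sub_zclosure.
pose b : 'M[F]_7 := \matrix_(i, j) (if j == 'i_2 then slice_a F i else
  if j == 'i_4 then slice_b u0 u1 i else if j == 'i_6 then slice_c w0 w1 i else (i == j)%:R).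
have btr : is_trig_mx b^T.
  apply/is_trig_mxP => i j ij; rewrite !mxE.
  case: eqP => [ei|_]; first by rewrite /slice_a ltnNge; move: ij; rewrite ei /= => ->.
  case: eqP => [ei|_].
    by move: ij; rewrite ei; case: j => [[|[|[|[|[|[|[|//]]]]]]] lt].
  case: eqP => [ei|_].
    by move: ij; rewrite ei; case: j => [[|[|[|[|[|[|[|//]]]]]]] lt].
  by rewrite -val_eqE /= gtn_eqF.
exists b.
  split => //; change (\det b = 1); rewrite -det_tr det_trig // big1 // => i _.
  rewrite !mxE; case: eqP => [->//|_]; case: eqP => [->//|_].
  by case: eqP => [->//|_]; rewrite eqxx.
rewrite w37E wedge_act_line wedge3_evec //= /slice; congr (<[minors _ _ _]>%VS);
  by apply/funext => i; rewrite mxE.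
Qed.

(** When u0 and w0 do not vanish, the spanning vectors are, up to scalars,
    columns 1, 2 and 4 of a unipotent lower triangular matrix. The other slice
    points are limits along the lines on which u0 and w0 move together. *)
Lemma slice_opp_schubert u0 u1 w0 w1 : @opp_schubert F V3 (slice_line u0 u1 w0 w1).
Proof.
have PG := projspace_ratio F N.
have generic (a0 a1 c0 c1 : F) : a0 != 0 -> c0 != 0 ->
    exists2 b, @opp_borel F b &
    val (slice_line a0 a1 c0 c1) = wedge_act b <[evec F V3]>%VS.
  move=> a00 c00.
  pose b : 'M[F]_7 := \matrix_(i, j) (if j == 'i_0 then slice_a F i else
    if j == 'i_1 then a0^-1 * slice_b a0 a1 i else
    if j == 'i_3 then c0^-1 * slice_c c0 c1 i else (i == j)%:R).
  have btr : is_trig_mx b.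
    apply/is_trig_mxP => i j ij; rewrite !mxE.
    case: eqP => [ej|_]; first by move: ij; rewrite ej.
    case: eqP => [ej|_].
      by move: ij; rewrite ej; case: i => [[|[|[|[|[|[|[|//]]]]]]] lt] //= _; rewrite /slice_b /= mulr0.
    case: eqP => [ej|_].
      by move: ij; rewrite ej; case: i => [[|[|[|[|[|[|[|//]]]]]]] lt] //= _; rewrite /slice_c /= mulr0.
    by rewrite -val_eqE /= ltn_eqF.
  exists b.
    split => //; change (\det b = 1); rewrite det_trig // big1 // => i _.
    rewrite !mxE; case: eqP => [->//|_].
    case: eqP => [->|_]; first by rewrite /slice_b /= mulVf.
    case: eqP => [->|_]; first by rewrite /slice_c /= mulVf.
    by rewrite eqxx.
  rewrite V3E wedge_act_line wedge3_evec //=.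
  have -> : minors (b^~ 'i_0) (b^~ 'i_1) (b^~ 'i_3) = (a0^-1 * c0^-1) *: slice a0 a1 c0 c1.
    by apply/colP => n; rewrite !mxE /det3 !mxE /=; ring.
  by rewrite vline_scale // mulf_neq0 ?invr_neq0.
move=> U oU Us; have [d [f [[p hp ->] fs fU]]] := (ratio_opn PG U).1 oU _ Us.
pose W : 'cV[{poly F}]_N := slice ('X + u0%:P) u1%:P ('X + w0%:P) w1%:P.
have WE x : map_mx (horner_eval x) W = slice (x + u0) u1 (x + w0) w1.
  by rewrite map_slice /= /horner_eval !hornerE.
have peq (a0 a1 c0 c1 : F) : (peval p (slice a0 a1 c0 c1) != 0) =
    (peval p (lrep (slice_line a0 a1 c0 c1)) != 0).
  by apply: (form_line (d := d) _ (mkline_mem _) (slice_neq0 _ _ _ _)); exists p.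
have : curve p W * ('X + u0%:P) * ('X + w0%:P) != 0.
  rewrite !mulf_neq0 //; try exact: monic_neq0 (monicXaddC _).
  apply/eqP => c0; move: fs; rewrite -peq.
  have := horner_curve p W 0; rewrite WE !add0r c0 horner0 => <-.
  by rewrite eqxx.
move=> /closed_nonrootP[x]; rewrite /root !hornerM !hornerD hornerX !hornerC.
rewrite horner_curve WE !mulf_eq0 !negb_or => /andP[/andP[px xu] xw].
exists (slice_line (x + u0) u1 (x + w0) w1); first exact: generic.
by apply: fU; rewrite -peq.
Qed.

Lemma slice_X u0 u1 w0 w1 : X (slice_line u0 u1 w0 w1).
Proof. by split; [exact: slice_schubert|exact: slice_opp_schubert]. Qed.

End RichardsonVariety.

(** * Invariant sections *)

Section PolynomialIdentities.
Variable F : closedFieldType.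

Lemma poly_identity (A B C : {poly F}) : C != 0 ->
  (forall x, C.[x] != 0 -> A.[x] = B.[x]) -> A = B.
Proof.
move=> C0 AB; apply/eqP; rewrite -subr_eq0; apply: contraT => AB0.
have : (A - B) * C != 0 by exact: mulf_neq0.
move=> /closed_nonrootP[x]; rewrite /root hornerM hornerD hornerN mulf_eq0 negb_or.
by move=> /andP[AB1 /AB E]; rewrite E subrr eqxx in AB1.
Qed.

End PolynomialIdentities.

Section RatioMisc.
Variable F : fieldType.

Lemma incl_morphism (X0 : fspace F) V (r : X0 -> V) G (S : set X0) :
  ratio_space r G -> morphism (@Defs.incl F X0 S).
Proof.
move=> XG; apply: (ratio_morphism (ratio_subspace S XG) XG) => x m a b Ga Gb bx.
by exists m, a, b; split.
Qed.

Lemma zclosure_idem (X0 : fspace F) (S : set X0) : zclosure (zclosure S) `<=` zclosure S.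
Proof. by move=> x Sx U oU Ux; have [y Sy Uy] := Sx U oU Ux; exact: Sy. Qed.

Lemma zclosureS (X0 : fspace F) (S S' : set X0) : S `<=` S' -> zclosure S `<=` zclosure S'.
Proof. by move=> SS' x Sx U oU Ux; have [y /SS' ? ?] := Sx U oU Ux; exists y. Qed.

End RatioMisc.

Section Sections.
Variables (F : fieldType) (S : set (projspace F N)).
Let Y := subspace S.
Implicit Types (y : Y) (d : nat).

Definition yrep y : 'cV[F]_N := lrep (incl y).

Lemma Y_ratio : ratio_space yrep (form N).
Proof. exact: ratio_subspace (projspace_ratio F N). Qed.

Lemma yrep_neq0 y : yrep y != 0. Proof. exact: lrep_neq0. Qed.

Lemma yrep_mem y : yrep y \in val (incl y). Proof. exact: lrep_mem. Qed.

Lemma Lomega_frame d f : form N d f ->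
  frame (Lomega S d) [set y | f (yrep y) != 0] (fun y => form_section f (incl y)).
Proof.
move=> hf; exact: (frame_pullback Y_ratio (projspace_ratio F N)
  (incl_morphism S (projspace_ratio F N)) (@serre_restricts F N d) (serre_frame hf)).
Qed.

Definition coord_pow (i : 'I_N) d (v : 'cV[F]_N) := v i ord0 ^+ d.

Lemma form_coord_pow i d : form N d (coord_pow i d).
Proof. by have := form_exp d (form_coord F i); rewrite mul1n. Qed.

Lemma coord_dom y : exists i, yrep y i ord0 != 0.
Proof. exact: exists_coord (yrep_neq0 y). Qed.

Lemma coord_dom_opn i : opn [set y : Y | yrep y i ord0 != 0].
Proof. exact: (ratio_opnD Y_ratio (form_coord F i)). Qed.

Lemma coord_frame i d : frame (Lomega S d) [set y : Y | yrep y i ord0 != 0]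
  (fun y => form_section (coord_pow i d) (incl y)).
Proof.
apply: (frame_restrict (coord_dom_opn i) _ (Lomega_frame (form_coord_pow i d))).
by move=> y; exact: expf_neq0.
Qed.

(** The powers of the coordinates trivialise the bundle on the standard affine
    charts, which cover. *)
Lemma secP d s : sec (Lomega S d) setT s <->
  forall i, exists2 g, regular [set y : Y | yrep y i ord0 != 0] g
    & forall y, yrep y i ord0 != 0 ->
        s y = smul (g y) (form_section (coord_pow i d) (incl y)).
Proof.
split=> [sS i|H].
  have [oU _ Us] := coord_frame i d.
  apply/Us => //; exact: (pullback_restricts Y_ratio) sS.
have L : sec_local (Lomega S d) by exact: pullback_local.
apply: (L _ s (ratio_opnT Y_ratio)).2 => y _.
have [i yi] := coord_dom y; have [oU _ Us] := coord_frame i d.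
exists [set y : Y | yrep y i ord0 != 0]; split=> //.
by apply: (Us _ _ oU _).2.
Qed.

Lemma sec_fib d s y : sec (Lomega S d) setT s -> serre_fib d (incl y) (s y).
Proof.
move=> /secP H; have [i yi] := coord_dom y; have [g _ ->//] := H i.
exact/serre_fib_smul/form_section_fib/form_coord_pow.
Qed.

Lemma secD d s s' : sec (Lomega S d) setT s -> sec (Lomega S d) setT s' ->
  sec (Lomega S d) setT (s + s').
Proof.
move=> /secP H /secP H'; apply/secP => i.
have [g rg sg] := H i; have [g' rg' sg'] := H' i.
exists (g + g'); first exact: (ratio_regD Y_ratio).
move=> y yi; change (s y + s' y = smul (g y + g' y) (form_section (coord_pow i d) (incl y))).
by rewrite sg // sg' // smulDl.
Qed.

Lemma secM d d' s s' : sec (Lomega S d) setT s -> sec (Lomega S d') setT s' ->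
  sec (Lomega S (d + d')) setT (s * s').
Proof.
move=> /secP H /secP H'; apply/secP => i.
have [g rg sg] := H i; have [g' rg' sg'] := H' i.
exists (g * g'); first exact: (ratio_regM Y_ratio).
move=> y yi; change (s y * s' y = smul (g y * g' y) (form_section (coord_pow i (d + d')) (incl y))).
rewrite sg // sg' //; apply/funext => v.
change (g y * form_section (coord_pow i d) (incl y) v *
  (g' y * form_section (coord_pow i d') (incl y) v) =
  g y * g' y * form_section (coord_pow i (d + d')) (incl y) v).
rewrite /form_section /coord_pow; case: ifP => _; first by rewrite exprD mulrACA.
by rewrite !mulr0.
Qed.

Lemma sec_form d f : form N d f ->
  sec (Lomega S d) setT (fun y => form_section f (incl y)).
Proof.
move=> hf; apply/secP => i.
exists (fun y => f (yrep y) / coord_pow i d (yrep y)).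
  apply/(ratio_reg Y_ratio) => y yi; exists d, f, (coord_pow i d).
  split=> //; [exact: form_coord_pow | exact: expf_neq0].
move=> y yi; apply: (serre_fibP (form_section_fib (incl y) hf)).
  exact/serre_fib_smul/form_section_fib/form_coord_pow.
by rewrite /smul !form_section_rep divfK // expf_neq0.
Qed.

(** The quotient of s by a power of a coordinate that does not vanish at y is a
    regular function, hence a ratio of forms near y. *)
Lemma sec_ratio d s y : sec (Lomega S d) setT s ->
  exists k a b, [/\ form N (k + d) a, form N k b, b (yrep y) != 0
    & forall y', b (yrep y') != 0 -> forall v, v \in val (incl y') ->
        b v * s y' v = a v].
Proof.
move=> sS; have [i yi] := coord_dom y; have [g rg sg] := (secP s).1 sS i.
have [k [a [b [Ga Gb bx gab]]]] := (ratio_reg Y_ratio _ _).1 rg y yi.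
have fC e := form_coord_pow i e.
exists (k + 1)%N, (a * coord_pow i 1 * coord_pow i d), (b * coord_pow i 1); split.
- by apply: formM => //; exact: formM.
- exact: formM.
- by apply: mulf_neq0 => //; rewrite /coord_pow expr1.
- move=> y'; rewrite mulf_eq0 negb_or /coord_pow expr1 => /andP[by0 yi'] v vy.
  have [c vE] := mem_line vy; have [sh _] := sec_fib y' sS.
  rewrite vE sh ?lrep_mem //; have -> : lrep (incl y') = yrep y' by [].
  change (b (c *: yrep y') * (c *: yrep y') i ord0 ^+ 1 * (c ^+ d * s y' (yrep y')) =
    a (c *: yrep y') * (c *: yrep y') i ord0 ^+ 1 * (c *: yrep y') i ord0 ^+ d).
  rewrite sg // /smul form_section_rep gab // (formZ _ _ Ga) (formZ _ _ Gb) !mxE.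
  rewrite /coord_pow !exprMn !expr1.
  change (lrep (incl y')) with (yrep y').
  by field.
Qed.

End Sections.

(** * Semistable points *)

Section Invariants.
Variable F : closedFieldType.
Let XF := @X F.
Let Y := subspace XF.
Definition invariants m := inv_ring XF 7 m.
Implicit Types (y : Y) (t : 'I_7 -> F).

Lemma X_closed : zclosure XF `<=` XF.
Proof.
move=> l Xl; split; apply: zclosure_idem; apply: zclosureS Xl => y [] //.
Qed.

Lemma moves_tmx t (y y' : Y) : moves (tmx t) y y' ->
  val (incl y') = <[tor t (yrep y)]>%VS.
Proof. by rewrite /moves {1}(lrep_span (incl y)) wedge_act_line wedge3_tmx. Qed.

Lemma torus_diag (g : 'M[F]_7) : torus g -> g = tmx (fun i => g i i) /\ \prod_i g i i = 1.
Proof.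
move=> [g1 gd]; have gE : g = tmx (fun i => g i i).
  apply/matrixP => i j; rewrite !mxE; case: eqP => [->//|/eqP ij].
  by have /is_diag_mxP -> := gd.
split=> //; rewrite -[RHS]g1 {2}gE det_diag; apply: eq_bigr => i _; by rewrite mxE.
Qed.

Lemma invariantsP m s : invariants m s <-> sec (Lomega XF (7 * m)) setT s /\
  forall t, \prod_i t i = 1 -> forall y y', val (incl y') = <[tor t (yrep y)]>%VS ->
    forall v, s y' (tor t v) = s y v.
Proof.
split=> -[sS H]; split=> //.
  move=> t t1 y y' yy' v; rewrite -wedge3_tmx; apply: H; first exact: tmx_torus.
  by rewrite /moves (lrep_span (incl y)) wedge_act_line wedge3_tmx.
move=> g /torus_diag[gE g1] y y'; rewrite gE => /moves_tmx yy' v.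
by rewrite wedge3_tmx; exact: H.
Qed.

Lemma root7 (x : F) : exists c, c ^+ 7 = x.
Proof.
have [c cE] := @solve_monicpoly F 7 (fun k => if k == 0%N then x else 0) isT.
exists c; rewrite cE !big_ord_recl big_ord0 /=.
by rewrite expr0 mulr1 !mul0r !addr0.
Qed.

Lemma unimodular t : (forall i, t i != 0) -> exists c t',
  [/\ c != 0, c ^+ 7 = \prod_i t i, \prod_i t' i = 1
    & forall w, tor t w = c ^+ 3 *: tor t' w].
Proof.
move=> t0; have [c c7] := root7 (\prod_i t i).
have c0 : c != 0.
  apply/eqP => c0; have : \prod_i t i != 0 by apply/prodf_neq0.
  by rewrite -c7 c0 expr0n eqxx.
exists c, (fun i => c^-1 * t i); split=> //.
  rewrite big_split /= prodr_const card_ord -c7 exprVn mulVf //.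
  exact: expf_neq0.
move=> w; rewrite -tor_const torM; congr tor; apply/funext => i.
by rewrite mulrA divff // mul1r.
Qed.

Lemma X_stable_diag t (l l' : line F N) v : (forall i, t i != 0) -> XF l ->
  v \in val l -> v != 0 -> tor t v \in val l' -> XF l'.
Proof.
move=> t0 Xl vl v0 tl; have [c [t' [c0 _ t'1 tE]]] := unimodular t0.
apply: (X_stable t'1 Xl).
have [d ->] := mem_line2 vl v0 (lrep_mem l).
rewrite torZ; apply: memvZ; rewrite -[tor t' v](scalerK (expf_neq0 3 c0)) -tE.
exact: memZ_line.
Qed.

(** A diagonal matrix is a scalar c times an element of the torus of SL(7). The
    scalar multiplies trivectors by c ^ 3, hence values in degree 7m by
    c ^ 21m, which is a power of the determinant c ^ 7. *)
Lemma invariants_equivariant m s t y y' v : invariants m s -> (forall i, t i != 0) ->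
  v \in val (incl y) -> tor t v \in val (incl y') -> v != 0 ->
  s y' (tor t v) = (\prod_i t i) ^+ (3 * m) * s y v.
Proof.
move=> /invariantsP[sS H] t0 vy ty v0; have [c [t' [c0 c7 t'1 tE]]] := unimodular t0.
have t'y : tor t' v \in val (incl y').
  rewrite -[tor t' v](scalerK (expf_neq0 3 c0)) -tE; exact: memZ_line.
have t'0 : forall i, t' i != 0 by apply: prod_neq0; rewrite t'1 oner_eq0.
have [sh _] := sec_fib y' sS.
rewrite tE sh // (H t' t'1 y).
  by rewrite -c7 -!exprM; congr (_ ^+ _ * _); lia.
have [d vE] := mem_line2 vy v0 (yrep_mem y).
have d0 : d != 0 by apply: contraNneq (yrep_neq0 y) => d0; rewrite vE d0 scale0r.
by rewrite vE torZ vline_scale // (line_span t'y) // tor_neq0.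
Qed.

Definition cnt (n : 'I_N) (Z : {set 'I_7}) : nat :=
  ((elt n o0 \in Z) + (elt n o1 \in Z) + (elt n o2 \in Z))%N.

Lemma wt_set (Z : {set 'I_7}) (r : F) n :
  wt (fun i => if i \in Z then r else 1) n = r ^+ cnt n Z.
Proof.
rewrite /wt /cnt !exprD.
by do 3 case: (_ \in Z).
Qed.

Lemma prod_set (Z : {set 'I_7}) (r : F) :
  \prod_i (if i \in Z then r else 1) = r ^+ #|Z|.
Proof. by rewrite -big_mkcond /= prodr_const. Qed.

(** The Hilbert-Mumford criterion for the one-parameter subgroups that scale
    the coordinates in Z: let r tend to 0 along the subgroup. The invariant
    section s is constant along the orbit; at the limit point it would have
    a zero, were all weights too large. *)
Lemma hilbert_mumford m s y (Z : {set 'I_7}) : (0 < m)%N -> invariants m s -> s y <> 0 ->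
  exists2 n, yrep y n ord0 != 0 & (7 * cnt n Z <= 3 * #|Z|)%N.
Proof.
move=> m0 As sy0; apply: contrapT => H.
have [sS sinv] := (invariantsP m s).1 As.
pose v := yrep y.
have lt n : v n ord0 != 0 -> (3 * #|Z| < 7 * cnt n Z)%N.
  by move=> vn; rewrite ltnNge; apply/negP => le; apply: H; exists n.
have svy : s y v != 0.
  apply/eqP => sv; apply: sy0; have sf := sec_fib y sS.
  have [zh _] := sf; apply: (serre_fibP sf (g := 0)); last exact: sv.
  by split=> // *; rewrite mulr0.
have [n0 vn0] : exists n, v n ord0 != 0 by exact: coord_dom.
(* k is the least weight that occurs in v; dividing the curve tor (t r) v by
   r ^+ k gives a curve w that extends to r = 0. *)
pose P k := [exists n, (v n ord0 != 0) && (cnt n Z == k)].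
have exP : exists k, P k by exists (cnt n0 Z); apply/existsP; exists n0; rewrite vn0 eqxx.
case: (ex_minnP exP) => k /existsP[n1 /andP[vn1 /eqP kE]] kmin.
have kle n : v n ord0 != 0 -> (k <= cnt n Z)%N.
  by move=> vn; apply: kmin; apply/existsP; exists n; rewrite vn eqxx.
pose W : 'cV[{poly F}]_N := \col_n ('X ^+ (cnt n Z - k) * (v n ord0)%:P).
pose w r := map_mx (horner_eval r) W.
have wE r n : w r n ord0 = r ^+ (cnt n Z - k) * v n ord0.
  by rewrite !mxE /horner_eval hornerM hornerXn hornerC.
pose t r i : F := if i \in Z then r else 1.
have tor_w r : tor (t r) v = r ^+ k *: w r.
  apply/colP => n; rewrite [LHS]mxE [RHS]mxE wE wt_set mulrA -exprD.
  have [->|vn] := eqVneq (v n ord0) 0; first by rewrite !mulr0.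
  by rewrite subnKC // kle.
have w1 r : w r != 0.
  apply/eqP => wr; have := wE r n1; rewrite wr mxE -kE subnn expr0 mul1r => /esym/eqP.
  by rewrite (negPf vn1).
have t0 r : r != 0 -> forall i, t r i != 0.
  by move=> r0 i; rewrite /t; case: ifP => // _; exact: oner_neq0.
have Xr r : r != 0 -> XF (mkline (w1 r)).
  move=> r0; apply: (X_stable_diag (t0 r r0) (set_valP y) (yrep_mem y) (yrep_neq0 y)).
  by rewrite -/v tor_w; apply: memZ_line; exact: mkline_mem.
have X0 : XF (mkline (w1 0)).
  apply: X_closed => U oU U0; have PG := projspace_ratio F N.
  have [d [f [[p hp ->] f0 fU]]] := (ratio_opn PG U).1 oU _ U0.
  have peq r : (peval p (w r) != 0) = (peval p (lrep (mkline (w1 r))) != 0).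
    by apply: (form_line (d := d) _ (mkline_mem _) (w1 r)); exists p.
  have : curve p W * 'X != 0.
    rewrite mulf_neq0 ?polyX_eq0 //; apply/eqP => c0; move: f0; rewrite -peq.
    by rewrite -horner_curve c0 horner0 eqxx.
  move=> /closed_nonrootP[r]; rewrite /root hornerM hornerX mulf_eq0 negb_or.
  rewrite horner_curve => /andP[pr r0]; exists (mkline (w1 r)); first exact: Xr.
  by apply: fU; rewrite -peq.
pose y0 : Y := SigSub (mem_set X0).
have [d [_ [_ [[p hp ->] [q hq ->] qy0 pq]]]] := sec_ratio y0 sS.
(* The section is p / q near the limit point y0, and its constancy along the
   orbit compares p and q on the curve w. *)
have q0 : peval q (w 0) != 0 by rewrite (form_line (d := d) _ (mkline_mem (w1 0))) //; exists q.
pose e := (7 * m * k - 3 * m * #|Z|)%N.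
have e1 : (3 * m * #|Z| < 7 * m * k)%N.
  by rewrite ![(_ * m)%N]mulnC -!mulnA ltn_pmul2l // -kE; exact: lt.
have e0 : (0 < e)%N by rewrite subn_gt0.
(* At the limit the right-hand side vanishes whereas q does not. *)
suff E : (s y v)%:P * curve q W = 'X ^+ e * curve p W.
  have := congr1 (horner^~ 0) E; rewrite !hornerM hornerC hornerXn horner_curve -/(w 0).
  by rewrite expr0n eqn0Ngt e0 mul0r => /eqP; rewrite mulf_eq0 (negPf svy) (negPf q0).
apply: (@poly_identity _ _ _ (curve q W * 'X)).
  rewrite mulf_neq0 ?polyX_eq0 //; apply/eqP => c0; move: q0.
  by rewrite -horner_curve c0 horner0 eqxx.
move=> r; rewrite !hornerM hornerX mulf_eq0 negb_or !horner_curve hornerC hornerXn -/(w r).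
move=> /andP[qr r0]; pose yr : Y := SigSub (mem_set (Xr r r0)).
have wyr : w r \in val (incl yr) by exact: mkline_mem.
have qyr : peval q (yrep yr) != 0 by rewrite -(form_line (d := d) _ wyr) //; exists q.
rewrite -(pq _ qyr _ wyr).
have [sh _] := sec_fib yr sS.
have tv : tor (t r) v \in val (incl yr) by rewrite tor_w; exact: memZ_line.
have := invariants_equivariant As (t0 r r0) (yrep_mem y) tv (yrep_neq0 y).
rewrite -/v tor_w sh // prod_set -!exprM => E.
have rne : r ^+ (#|Z| * (3 * m)) != 0 by exact: expf_neq0.
apply: (mulfI rne); rewrite mulrA -E.
have -> : (k * (7 * m) = #|Z| * (3 * m) + e)%N.
  rewrite (_ : (#|Z| * (3 * m) = 3 * m * #|Z|)%N); last exact: mulnC.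
  by rewrite subnKC 1?ltnW // mulnC.
by rewrite exprD; ring.
Qed.

End Invariants.

(** * Semistable points are translates of the slice *)

Section Classification.
Variable F : closedFieldType.
Let XF := @X F.
Let Y := subspace XF.
Implicit Types (y : Y).

(** The matroid inequality of the Hilbert-Mumford criterion. *)
Definition balanced (v : 'cV[F]_N) := forall z : pred nat,
  exists l m n : 'I_7, [/\ (l < m)%N, (m < n)%N, coord3 v l m n != 0
    & (7 * (z l + z m + z n) <= 3 * count z (iota 0 7))%N].

Lemma balanced_semistable m s y : (0 < m)%N -> invariants m s -> s y <> 0 -> balanced (yrep y).
Proof.
move=> m0 As sy z.
have [n vn le] := hilbert_mumford [set x : 'I_7 | z x]%SET m0 As sy.
have [e01 e12] := elt_lt n.
exists (elt n o0), (elt n o1), (elt n o2); split=> //; first by rewrite coord3_elt.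
move: le; rewrite /cnt !inE; congr (_ <= 3 * _)%N.
by rewrite cardsE cardE size_filter -(count_map val z) -enumT val_enum_ord.
Qed.

(** The matroid inequality for the pair {4, 5} gives a nonzero coordinate on a
    triple i < j <= 3, k >= 6. The vectors r1, r2, r3 are the corresponding
    basis of the subspace, by Cramer's rule: r1 and r2 vanish on the last two
    coordinates, r3 on the first three. The vanishing of the coordinate 4, 5, k
    says that r1 and r2 are proportional on the coordinates 4 and 5, so some
    combination a of them is supported on the first three coordinates. *)
Lemma balanced_param y : balanced (yrep y) -> exists a b c : 'I_7 -> F,
  [/\ yrep y = minors a b c, forall i : 'I_7, (2 < i)%N -> a i = 0,
      forall i : 'I_7, (4 < i)%N -> b i = 0 & forall i : 'I_7, (i < 3)%N -> c i = 0].
Proof.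
move=> bal; have [Xs Xo] : XF (incl y) := set_valP y.
pose P i j k := coord3 (yrep y) i j k.
have V1 (i j k : 'I_7) :
  [&& 2 < i, 2 < j & 2 < k]%N || (1 < (4 < i) + (4 < j) + (4 < k))%N -> P i j k = 0.
  exact: schubert_coord.
have V2 (i j k : 'I_7) : (i < 3)%N -> (j < 3)%N -> (k < 3)%N -> P i j k = 0.
  exact: opp_schubert_coord.
have [i [j [k [ij jk p0]]]] := bal (fun x => (x == 3) || (x == 4))%N; rewrite /= => cn.
have [hj hk] : (j < 3)%N /\ (4 < k)%N.
  have n1 : ~~ [&& 2 < i, 2 < j & 2 < k]%N by apply: contra p0 => h; apply/eqP/V1; rewrite h.
  have n2 : ~~ (1 < (4 < i) + (4 < j) + (4 < k))%N.
    by apply: contra p0 => h; apply/eqP/V1; rewrite h orbT.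
  have n3 : ~~ (k < 3)%N by apply: contra p0 => h; apply/eqP/V2; lia.
  lia.
pose r1 l := P l j k; pose r2 l := P i l k; pose r3 l := P i j l.
pose p := P i j k.
have cr l m n : p ^+ 2 * P l m n = det3 r1 r2 r3 l m n.
  by apply/eqP; rewrite -subr_eq0; apply/eqP; exact: schubert_cramer.
have r3z (l : 'I_7) : (l < 3)%N -> r3 l = 0 by move=> l3; apply: V2 => //; lia.
have r1z (l : 'I_7) : (4 < l)%N -> r1 l = 0.
  by move=> l4; apply: V1; rewrite l4 hk; case: (4 < j)%N; rewrite orbT.
have r2z (l : 'I_7) : (4 < l)%N -> r2 l = 0.
  by move=> l4; apply: V1; rewrite l4 hk; case: (4 < i)%N; rewrite orbT.
have p2 : p ^+ 2 != 0 by exact: expf_neq0.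
have r12 : r1 'i_3 * r2 'i_4 = r1 'i_4 * r2 'i_3.
  have : p ^+ 2 * P 'i_3 'i_4 k = 0 by rewrite V1 ?mulr0 // (ltn_trans _ hk).
  rewrite cr /det3 (r1z k) // (r2z k) // => H.
  have /eqP : (r1 'i_3 * r2 'i_4 - r1 'i_4 * r2 'i_3) * r3 k = 0 by rewrite -[RHS]H; ring.
  by rewrite mulf_eq0 (negPf p0) orbF subr_eq0 => /eqP.
have [l [m [n [lm mn q0]]]] := bal (fun x => (x < 3) || (x == 4))%N; rewrite /= => cn'.
have [hl hm hn] : [/\ (l < 3)%N, m = 'i_3 & (4 < n)%N].
  have n1 : ~~ [&& 2 < l, 2 < m & 2 < n]%N by apply: contra q0 => h; apply/eqP/V1; rewrite h.
  have n2 : ~~ (1 < (4 < l) + (4 < m) + (4 < n))%N.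
    by apply: contra q0 => h; apply/eqP/V1; rewrite h orbT.
  have : [/\ (l < 3)%N, nat_of_ord m = 3 & (4 < n)%N] by split; lia.
  by move=> [? m3 ?]; split=> //; exact: val_inj.
have r3nz : (r1 'i_3 != 0) || (r2 'i_3 != 0).
  apply: contraT; rewrite negb_or !negbK => /andP[/eqP z1 /eqP z2].
  have : p ^+ 2 * P l 'i_3 n != 0 by rewrite mulf_neq0 // -hm.
  by rewrite cr /det3 z1 z2 (r1z n) // (r2z n) // (r3z l) //; rewrite !(mul0r, mulr0, subrr, addr0) eqxx.
pose a l := r2 'i_3 * r1 l - r1 'i_3 * r2 l.
(* The basis vector completing a depends on which of r1, r2 has a nonzero
   fourth entry; in both cases that entry is the determinant of the change of
   basis. *)
pose b l := if r1 'i_3 != 0 then r1 l else r2 l.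
have b3 : b 'i_3 != 0 by rewrite /b; case: (boolP (r1 'i_3 == 0)) r3nz => //= ->.
have abc l' m' n' : det3 a b r3 l' m' n' = b 'i_3 * det3 r1 r2 r3 l' m' n'.
  rewrite /a /b; case: ifPn => [_|]; first by rewrite /det3; ring.
  by rewrite negbK => /eqP ->; rewrite /det3; ring.
pose K := p ^+ 2 * b 'i_3.
have K0 : K != 0 by exact: mulf_neq0.
exists (fun l => K^-1 * a l), b, r3; split=> //.
- apply: eq_coord3 => l' m' n'; rewrite coord3_minors.
  apply: (mulfI K0); transitivity (det3 a b r3 l' m' n').
    by rewrite abc -cr /K -/(P l' m' n'); ring.
  by rewrite /det3; field.
- move=> x x2; have [x4|x4] := ltnP 4 x.
    by rewrite /a (r1z x) // (r2z x) // !mulr0 subrr mulr0.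
  have [->|->] : x = 'i_3 \/ x = 'i_4.
    have [x3|x3] : (x = 3 :> nat) \/ (x = 4 :> nat) by lia.
      by left; exact: val_inj.
    by right; exact: val_inj.
  + by rewrite /a [r1 _ * _]mulrC subrr mulr0.
  + by rewrite /a r12 [r1 _ * _]mulrC subrr mulr0.
- by move=> x x4; rewrite /b; case: ifP => _; [exact: r1z | exact: r2z].
Qed.

(** Each entry that the diagonal matrices normalise, and each of the two vectors
    u and w, is nonzero by one instance of the matroid inequality: a vanishing
    entry would make a one-parameter subgroup destabilise y. *)
Lemma balanced_slice y : balanced (yrep y) -> exists (t : 'I_7 -> F) u0 u1 w0 w1,
  [/\ forall i, t i != 0, (u0 != 0) || (u1 != 0), (w0 != 0) || (w1 != 0)
    & yrep y = tor t (slice u0 u1 w0 w1)].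
Proof.
move=> bal; have [a [b [c [yE az bz cz]]]] := balanced_param bal.
have [Xs Xo] : XF (incl y) := set_valP y.
have PE i j k : coord3 (yrep y) i j k = det3 a b c i j k by rewrite yE coord3_minors.
have V1 (i j k : 'I_7) : coord3 (yrep y) i j k != 0 ->
  ~~ [&& 2 < i, 2 < j & 2 < k]%N /\ ~~ (1 < (4 < i) + (4 < j) + (4 < k))%N.
  by move=> p0; split; apply: contra p0 => h; apply/eqP;
     apply: schubert_coord => //; rewrite h ?orbT.
have V2 (i j k : 'I_7) : coord3 (yrep y) i j k != 0 -> (i < j)%N -> (j < k)%N ->
    (2 < k)%N.
  move=> p0 ij jk; rewrite ltnNge; apply: contra p0 => h; apply/eqP.
  by apply: opp_schubert_coord => //; lia.
have a0 (i : 'I_7) : (i < 3)%N -> a i != 0.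
  move=> i3; have [l [m [n [lm mn p0]]]] := bal (fun x => (x < 3) && (x != i))%N.
  have -> : count (fun x => (x < 3) && (x != i))%N (iota 0 7) = 2%N.
    by case: i i3 => [[|[|[|//]]] lt].
  move=> cn; have [n1 n2] := V1 _ _ _ p0.
  have [le m2] : (l = i :> nat) /\ (2 < m)%N by lia.
  move: p0; rewrite PE /det3 (az m) // (az n); last by lia.
  rewrite (cz l); last by lia.
  rewrite (val_inj le : l = i).
  by apply: contraNneq => ->; rewrite !(mul0r, mulr0, subrr, addr0).
have b0 (j : 'I_7) : (2 < j)%N -> (j < 5)%N -> b j != 0.
  move=> j2 j5; have [l [m [n [lm mn p0]]]] := bal (fun x => (x < 5) && (x != j))%N.
  have -> : count (fun x => (x < 5) && (x != j))%N (iota 0 7) = 4%N.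
    by case: j j2 j5 => [[|[|[|[|[|//]]]]] lt].
  move=> cn; have [n1 n2] := V1 _ _ _ p0.
  have [l3 me n4] : [/\ (l < 3)%N, (m = j :> nat) & (4 < n)%N] by split; lia.
  move: p0; rewrite PE /det3 (az m) ?(az n) ?(bz n) ?(cz l) //; try lia.
  rewrite (val_inj me : m = j).
  by apply: contraNneq => ->; rewrite !(mul0r, mulr0, subrr, addr0).
have c0 (k : 'I_7) : (4 < k)%N -> c k != 0.
  move=> k4; have [l [m [n [lm mn p0]]]] := bal (fun x : nat => x != k)%N.
  have -> : count (fun x : nat => x != k)%N (iota 0 7) = 6%N.
    by case: k k4 => [[|[|[|[|[|[|[|//]]]]]]] lt].
  move=> cn; have [n1 n2] := V1 _ _ _ p0.
  have ne : n = k :> nat by have := ltn_ord n; have := ltn_ord k; lia.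
  move: p0; rewrite PE /det3 (az n) ?(bz n) //; try lia.
  rewrite (val_inj ne : n = k).
  by apply: contraNneq => ->; rewrite !(mul0r, mulr0, subrr, addr0).
have [i [j [ij j3 q0]]] : exists i j : 'I_7, [/\ (i < j)%N, (j < 3)%N & a i * b j - a j * b i != 0].
  have [l [m [n [lm mn p0]]]] := bal (fun x => (x == 3) || (x == 4))%N.
  rewrite /= => cn; have [n1 n2] := V1 _ _ _ p0; have n3 := V2 _ _ _ p0 lm mn.
  have [m3 n4] : (m < 3)%N /\ (4 < n)%N by lia.
  exists l, m; split=> //; move: p0; rewrite PE /det3.
  rewrite (az n) ?(bz n) ?(cz l) ?(cz m) //; try lia.
  apply: contraNneq => q0; apply/eqP.
  transitivity (c n * (a l * b m - a m * b l)); first by ring.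
  by rewrite q0 mulr0.
have c34 : (c 'i_3 != 0) || (c 'i_4 != 0).
  have [l [m [n [lm mn p0]]]] := bal (fun x => 4 < x)%N.
  rewrite /= => cn; apply: contraT; rewrite negb_or !negbK => /andP[/eqP z3 /eqP z4].
  have cz' (x : 'I_7) : (x < 5)%N -> c x = 0.
    move=> x5; have [x3|x3] := ltnP x 3; first exact: cz.
    have [x3'|x4] : (x = 3 :> nat) \/ (x = 4 :> nat) by lia.
      by rewrite (_ : x = 'i_3) //; exact: val_inj.
    by rewrite (_ : x = 'i_4) //; exact: val_inj.
  move: p0; rewrite PE /det3 !cz' //; try lia.
  by rewrite !(mul0r, mulr0, subrr, addr0) eqxx.
pose t (i : 'I_7) := if (i < 3)%N then a i else if (i < 5)%N then b i else c i.
(* Subtracting x times a from b clears the first entry of b. *)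
pose x := b 'i_0 / a 'i_0.
exists t, (b 'i_1 / a 'i_1 - x), (b 'i_2 / a 'i_2 - x), (c 'i_3 / b 'i_3), (c 'i_4 / b 'i_4).
have t0 i' : t i' != 0.
  rewrite /t; case: ltnP => [/a0//|h]; case: ltnP => h'; first exact: b0.
  exact: c0.
split=> //.
- apply: contraT; rewrite negb_or !negbK !subr_eq0 => /andP[/eqP e1 /eqP e2].
  have bE (k : 'I_7) : (k < 3)%N -> b k = x * a k.
    move=> k3; have ak := a0 _ k3; apply: (mulIf (invr_neq0 ak)); rewrite mulfK //.
    have [k0|[k1|k2]] : k = 0%N :> nat \/ k = 1%N :> nat \/ k = 2%N :> nat by lia.
    + by rewrite (_ : k = 'i_0) //; exact: val_inj.
    + by rewrite (_ : k = 'i_1) //; exact: val_inj.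
    + by rewrite (_ : k = 'i_2) //; exact: val_inj.
  move: q0; rewrite !bE //; last by lia.
  by rewrite mulrCA (mulrCA (a j)) (mulrC (a j)) subrr eqxx.
- by case/orP: c34 => h; apply/orP; [left|right]; rewrite mulf_neq0 // invr_neq0 // b0.
- rewrite /slice tor_minors yE.
  have -> : (fun i => t i * slice_a F i) = a.
    apply/funext => i'; rewrite /slice_a /t; case: ltnP => h; first by rewrite mulr1.
    by rewrite mulr0 az.
  have -> : (fun i => t i * slice_c (c 'i_3 / b 'i_3) (c 'i_4 / b 'i_4) i) = c.
    apply/funext => -[[|[|[|[|[|[|[|//]]]]]]] lt]; rewrite /slice_c /t /=;
      try by rewrite ?mulr0 ?mulr1 // cz.
    + rewrite (_ : Ordinal lt = 'i_3); last exact: val_inj.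
      by rewrite mulrC divfK ?b0.
    + rewrite (_ : Ordinal lt = 'i_4); last exact: val_inj.
      by rewrite mulrC divfK ?b0.
  have -> : (fun i => t i * slice_b (b 'i_1 / a 'i_1 - x) (b 'i_2 / a 'i_2 - x) i)
    = (fun i => b i - x * a i).
    apply/funext => i'; rewrite /slice_b /t.
    case: i' => [[|[|[|[|[|[|[|//]]]]]]] lt] /=.
    + rewrite mulr0 (_ : Ordinal lt = 'i_0); last exact: val_inj.
      by rewrite /x divfK ?subrr // a0.
    + rewrite (_ : Ordinal lt = 'i_1); last exact: val_inj.
      by rewrite mulrBr mulrC divfK ?a0 // mulrC.
    + rewrite (_ : Ordinal lt = 'i_2); last exact: val_inj.
      by rewrite mulrBr mulrC divfK ?a0 // mulrC.
    + by rewrite az // mulr0 subr0 mulr1.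
    + by rewrite az // mulr0 subr0 mulr1.
    + by rewrite az // bz // !mulr0 subr0.
    + by rewrite az // bz // !mulr0 subr0.
  by apply/colP => n; rewrite !mxE /det3; ring.
Qed.

End Classification.

(** * Invariant sections are bihomogeneous forms of bidegree (2m, m) *)

Section TwoVariables.
Variable F : closedFieldType.

Lemma horner2_map (D : {poly {poly F}}) (x y : F) :
  D.[x%:P].[y] = (map_poly (horner_eval y) D).[x].
Proof.
transitivity (map_poly (horner_eval y) D).[horner_eval y x%:P].
  by rewrite horner_map.
by congr (_.[_]); exact: hornerC.
Qed.

Lemma exists_nonroot2 (D : {poly {poly F}}) : D != 0 -> exists x y, D.[x%:P].[y] != 0.
Proof.
move=> D0; have /closed_nonrootP[y] : lead_coef D != 0 by rewrite lead_coef_eq0.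
rewrite /root => dy.
have : map_poly (horner_eval y) D != 0.
  apply/eqP => D0'; have := congr1 (fun p : {poly F} => p`_(size D).-1) D0'.
  by rewrite coef_map coef0 => /eqP; rewrite -lead_coefE (negPf dy).
move=> /closed_nonrootP[x]; rewrite /root => xD.
by exists x, y; rewrite horner2_map.
Qed.

Lemma poly_identity2 (A B C : {poly {poly F}}) : C != 0 ->
  (forall x y, C.[x%:P].[y] != 0 -> A.[x%:P].[y] = B.[x%:P].[y]) -> A = B.
Proof.
move=> C0 AB; apply/eqP; rewrite -subr_eq0; apply: contraT => AB0.
have /exists_nonroot2[x [y]] : (A - B) * C != 0 by exact: mulf_neq0.
rewrite !hornerM !hornerD !hornerN mulf_eq0 negb_or => /andP[AB1 /AB E].
by rewrite E subrr eqxx in AB1.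
Qed.

End TwoVariables.

Section SliceValues.
Variable F : closedFieldType.
Let XF := @X F.
Let Y := subspace XF.
Let vec2 := vec2 F.
Implicit Types (z : vec2 * vec2).

Definition i20 : 'I_2 := ord0.
Definition i21 : 'I_2 := ord_max.

Definition sl z : 'cV[F]_N :=
  slice (z.1 i20 ord0) (z.1 i21 ord0) (z.2 i20 ord0) (z.2 i21 ord0).

Lemma sl_neq0 z : sl z != 0. Proof. exact: slice_neq0. Qed.

Definition yz z : Y := SigSub (mem_set (slice_X
  (z.1 i20 ord0) (z.1 i21 ord0) (z.2 i20 ord0) (z.2 i21 ord0))).

Lemma sl_mem z : sl z \in val (incl (yz z)). Proof. exact: mkline_mem. Qed.

Definition slice_value (s : Y -> 'cV[F]_N -> F) z := s (yz z) (sl z).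

Lemma slice_scale (a b : F) z : 
  tor (fun i : 'I_7 => if (i < 3)%N then b * a else if (i < 5)%N then b else 1) (sl z) =
  (b ^+ 2 * a) *: sl (a *: z.1, b *: z.2).
Proof.
pose t (i : 'I_7) := if (i < 3)%N then b * a else if (i < 5)%N then b else 1.
rewrite -/t /sl /slice tor_minors; apply/colP => n; rewrite !mxE.
have -> : (fun i => t i * slice_a F i) = (fun i => b * a * slice_a F i).
  by apply/funext => i; rewrite /t /slice_a; case: ltnP => // _; rewrite !mulr0.
have -> (u0 u1 : F) : (fun i => t i * slice_b u0 u1 i) =
    (fun i => b * slice_b (a * u0) (a * u1) i).
  by apply/funext => -[[|[|[|[|[|[|[|//]]]]]]] lt]; rewrite /t /slice_b /= ?mulr0 // mulrA.
have -> (w0 w1 : F) : (fun i => t i * slice_c w0 w1 i) = slice_c (b * w0) (b * w1).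
  by apply/funext => -[[|[|[|[|[|[|[|//]]]]]]] lt]; rewrite /t /slice_c /= ?mulr0 ?mul1r.
by rewrite /det3; ring.
Qed.

Lemma prod7 (t : 'I_7 -> F) : \prod_i t i =
  t 'i_0 * t 'i_1 * t 'i_2 * t 'i_3 * t 'i_4 * t 'i_5 * t 'i_6.
Proof.
rewrite !big_ord_recl big_ord0 mulr1 !mulrA.
by repeat congr (_ * _); congr t; exact: val_inj.
Qed.

(** The exponents come from the determinant b ^ 5 a ^ 3 of the diagonal matrix
    and the scalar b ^ 2 a: 3m times (3, 5) minus 7m times (1, 2) is (2m, m). *)
Lemma slice_value_scale m s (a b : F) z : invariants m s -> a != 0 -> b != 0 ->
  slice_value s (a *: z.1, b *: z.2) = a ^+ (2 * m) * b ^+ m * slice_value s z.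
Proof.
move=> As a0 b0; pose t (i : 'I_7) := if (i < 3)%N then b * a else if (i < 5)%N then b else 1.
have t0 i : t i != 0.
  by rewrite /t; case: ifP => _; [exact: mulf_neq0 | case: ifP => // _; exact: oner_neq0].
pose z' := (a *: z.1, b *: z.2).
have tE : tor t (sl z) = (b ^+ 2 * a) *: sl z' by exact: slice_scale.
have tz : tor t (sl z) \in val (incl (yz z')).
  by rewrite tE; apply: memZ_line; exact: sl_mem.
have := invariants_equivariant As t0 (sl_mem z) tz (sl_neq0 z).
have [sS _] := (invariantsP m s).1 As; have [sh _] := sec_fib (yz z') sS.
rewrite tE sh ?sl_mem // prod7 /t /= !mulr1 -/(slice_value s z) -/(slice_value s z') => E.
have k0 : (b ^+ 2 * a) ^+ (7 * m) != 0 by rewrite expf_neq0 // mulf_neq0 // expf_neq0.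
apply: (mulfI k0); rewrite E [RHS]mulrA; congr (_ * _).
rewrite (_ : b * a * (b * a) * (b * a) * b * b = (b ^+ 5 * a ^+ 3)); last by ring.
rewrite [LHS]exprMn [in RHS]exprMn -!exprM [RHS](_ : _ = (b ^+ (2 * (7 * m)) * b ^+ m) *
  (a ^+ (7 * m) * a ^+ (2 * m))); last by ring.
by rewrite -!exprD; congr (_ ^+ _ * _ ^+ _); lia.
Qed.

(** The coordinates of the slice are polynomials in its four parameters, so p
    becomes a polynomial p4 in four variables, written out monomial by monomial
    to make its bihomogeneous components visible. *)
Lemma comp_slice (p : {mpoly F[N]}) : exists p4 : {mpoly F[4]},
  forall z, peval p (sl z) = \sum_(k <- msupp p4) p4@_k *
     ((z.1 i20 ord0 ^+ k (inord 0) * z.1 i21 ord0 ^+ k (inord 1)) *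
     (z.2 i20 ord0 ^+ k (inord 2) * z.2 i21 ord0 ^+ k (inord 3))).
Proof.
pose x (i : nat) : {mpoly F[4]} := 'X_(inord i).
pose S := slice (x 0%N) (x 1%N) (x 2%N) (x 3%N).
exists (p \mPo [tuple S i ord0 | i < N]) => z.
pose e (i : 'I_4) := [:: z.1 i20 ord0; z.1 i21 ord0; z.2 i20 ord0; z.2 i21 ord0]`_i.
have xe k : (k < 4)%N -> (x k).@[e] = [:: z.1 i20 ord0; z.1 i21 ord0; z.2 i20 ord0; z.2 i21 ord0]`_k.
  by move=> k4; rewrite /x mevalXU /e inordK.
transitivity ((p \mPo [tuple S i ord0 | i < N]).@[e]).
  rewrite comp_mpoly_meval; apply: meval_eq => i; rewrite tnth_mktuple.
  have := map_slice (meval e) (x 0%N) (x 1%N) (x 2%N) (x 3%N).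
  by move=> /matrixP/(_ i ord0); rewrite mxE /= !xe //= => ->.
rewrite mevalE; apply: eq_bigr => k _; congr (_ * _).
rewrite !big_ord_recl big_ord0 mulr1 !mulrA.
by repeat congr (_ * _); congr (_ ^+ k _); apply: val_inj; rewrite /= inordK.
Qed.

(** The residual torus action makes s bihomogeneous of bidegree (2m, m) on the
    slice. Near the centre of the slice s = p / q with q nonzero at the centre.
    Expanding p = s q at (a u, b w) in powers of a and b and comparing the
    coefficients of a ^ 2m b ^ m shows that s times the constant term of q is
    the component of p of bidegree (2m, m). *)
Lemma slice_value_biform m s : invariants m s -> biform21 m (slice_value s).
Proof.
move=> As; have [sS _] := (invariantsP m s).1 As.
have [d [_ [_ [[p hp ->] [q hq ->] q0 pq]]]] := sec_ratio (yz (0, 0)) sS.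
have qE z : (peval q (sl z) != 0) = (peval q (yrep (yz z)) != 0).
  by apply: (form_line (d := d) _ (sl_mem z) (sl_neq0 z)); exists q.
rewrite -qE in q0.
have {}pq z : peval q (sl z) != 0 -> peval q (sl z) * slice_value s z = peval p (sl z).
  by rewrite qE => qz; apply: pq => //; exact: sl_mem.
have [p4 p4E] := comp_slice p; have [q4 q4E] := comp_slice q.
pose mon (k : 'X_{1..4}) z : F := ((z.1 i20 ord0 ^+ k (inord 0) * z.1 i21 ord0 ^+ k (inord 1)) *
     (z.2 i20 ord0 ^+ k (inord 2) * z.2 i21 ord0 ^+ k (inord 3))).
pose expand (r : {mpoly F[4]}) z : {poly {poly F}} :=
  \sum_(k <- msupp r) ((r@_k * mon k z) *: 'X^(k (inord 0) + k (inord 1)))%:P *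
    'X^(k (inord 2) + k (inord 3)).
have expandE r z (a b : F) : (expand r z).[b%:P].[a] =
    \sum_(k <- msupp r) r@_k * mon k (a *: z.1, b *: z.2).
  rewrite /expand !horner_sum; apply: eq_bigr => k _.
  rewrite hornerM hornerXn hornerC -polyC_exp !hornerE /mon /= !mxE !exprMn !exprD.
  by ring.
have coefE z : ((expand p4 z)`_m)`_(2 * m) = peval q (sl (0, 0)) * slice_value s z.
  have EQ (a b : F) : (expand q4 z).[b%:P].[a] = peval q (sl (a *: z.1, b *: z.2)).
    by rewrite expandE q4E.
  have EP (a b : F) : (expand p4 z).[b%:P].[a] = peval p (sl (a *: z.1, b *: z.2)).
    by rewrite expandE p4E.
  have Q00 : (expand q4 z)`_0`_0 = peval q (sl (0, 0)).
    by rewrite -!horner_coef0 -[0 in X in X.[_]]polyC0 EQ !scale0r.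
  have EPQ : expand p4 z = (slice_value s z *: 'X^(2 * m))%:P * 'X^m * expand q4 z.
    apply: (@poly_identity2 _ _ _ (expand q4 z * 'X * ('X)%:P)).
      rewrite !mulf_neq0 ?polyX_eq0 ?polyC_eq0 ?polyX_eq0 //.
      by apply: contraNneq q0 => e0; rewrite -Q00 e0 !coef0.
    move=> b a; rewrite !(hornerM, hornerX, hornerC) !mulf_eq0 !negb_or.
    move=> /andP[/andP[+ b0] a0]; rewrite EP EQ => qz.
    rewrite -pq // (slice_value_scale _ As) //.
    rewrite hornerZ !hornerXn -polyC_exp hornerC.
    by ring.
  rewrite EPQ -mulrA coefCM coefXnM ltnn subnn -scalerAl coefZ coefXnM ltnn subnn Q00.
  by rewrite mulrC.
have -> : slice_value s = (fun z => (peval q (sl (0, 0)))^-1 *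
   \sum_(k <- msupp p4 | (k (inord 0) + k (inord 1) == 2 * m)%N &&
      (k (inord 2) + k (inord 3) == m)%N) p4@_k * mon k z).
  apply/funext => z; apply: (mulfI q0); rewrite mulrA divff // mul1r -coefE.
  rewrite coef_sum coef_sum [in RHS]big_mkcond; apply: eq_bigr => k _.
  rewrite coefCM coefXn mulr_natr coefMn coefZ coefXn eq_sym [(_ == m)%N]eq_sym.
  by do 2 case: (_ == _); rewrite /= ?mulr1n ?mulr1 ?mulr0n ?mulr0.
apply: (graded_scale _ (biform21_graded F)); apply: biform_sum => k _ /andP[/eqP e1 /eqP e2].
rewrite -/(biform21 _); apply: (graded_scale _ (biform21_graded F)).
have fE i e : form 2 e (fun v : vec2 => v i ord0 ^+ e).
  by have := form_exp e (form_coord F i); rewrite mul1n.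
have := biform_pure (formM (fE i20 (k (inord 0))) (fE i21 (k (inord 1))))
  (formM (fE i20 (k (inord 2))) (fE i21 (k (inord 3)))).
by rewrite e1 e2.
Qed.

End SliceValues.

Section BiformInduction.
Variable F : fieldType.
Implicit Types (z : vec2 F * vec2 F).

(** The four monomials whose nonvanishing loci cover the product of the
    projective lines. *)
Definition corner (i j : bool) z : F :=
  (if i then z.1 i20 ord0 else z.1 i21 ord0) ^+ 2 * (if j then z.2 i20 ord0 else z.2 i21 ord0).
Definition mixed (j : bool) z : F :=
  z.1 i20 ord0 * z.1 i21 ord0 * (if j then z.2 i20 ord0 else z.2 i21 ord0).

Lemma corner_biform i j : biform21 1 (corner i j).
Proof.
case: i; case: j; rewrite /corner /=;
  exact: (biform_pure (form_exp 2 (form_coord F _)) (form_coord F _)).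
Qed.

Lemma mixed_biform j : biform21 1 (mixed j).
Proof.
case: j; rewrite /mixed /=;
  exact: (biform_pure (formM (form_coord F _) (form_coord F _)) (form_coord F _)).
Qed.

Variable L : nat -> (vec2 F * vec2 F -> F) -> Prop.
Hypothesis L_cst : forall c, L 0 (fun=> c).
Hypothesis L_zero : forall m, L m (fun=> 0).
Hypothesis LD : forall m P Q, L m P -> L m Q -> L m (P + Q).
Hypothesis L_scale : forall m c P, L m P -> L m (fun z => c * P z).
Hypothesis L_corner : forall m i j P, biform21 m P -> L m P -> L m.+1 (corner i j * P).
Hypothesis L_mixed : forall m j P, biform21 m P -> L m P -> L m.+1 (mixed j * P).

Let L_sum m (I : eqType) (s : seq I) P : (forall k, k \in s -> L m (P k)) ->
  L m (fun z => \sum_(k <- s) P k z).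
Proof.
elim: s => [|k s IH] H.
  by under [X in L _ X]eq_fun do rewrite big_nil; exact: L_zero.
under [X in L _ X]eq_fun do rewrite big_cons.
apply: (LD (H k _)); first by rewrite inE eqxx.
by apply: IH => j js; apply: H; rewrite inE js orbT.
Qed.

Let monomial m i j z := z.1 i20 ord0 ^+ i * z.1 i21 ord0 ^+ (2 * m - i) *
  (z.2 i20 ord0 ^+ j * z.2 i21 ord0 ^+ (m - j)).

Let monomial_biform m i j : (i <= 2 * m)%N -> (j <= m)%N -> biform21 m (monomial m i j).
Proof.
move=> im jm; have fE (k : 'I_2) e : form 2 e (fun v : vec2 F => v k ord0 ^+ e).
  by have := form_exp e (form_coord F k); rewrite mul1n.
have := biform_pure (formM (fE i20 i) (fE i21 (2 * m - i)%N)) (formM (fE i20 j) (fE i21 (m - j)%N)).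
by rewrite !subnKC.
Qed.

(** Split off the square of one of the u-variables as long as one of the
    exponents allows it; the only exception is u0 u1 in degree 1. *)
Lemma L_monomial m i j : (i <= 2 * m)%N -> (j <= m)%N ->
  L m (monomial m i j).
Proof.
elim: m i j => [|m IH] i j im jm.
  have -> : i = 0%N by lia.
  have -> : j = 0%N by lia.
  by rewrite /monomial; under [X in L _ X]eq_fun do rewrite !expr0 !mulr1; exact: L_cst.
pose b := (0 < j)%N.
have jE : exists2 j', (j' <= m)%N & forall w0 w1 : F, w0 ^+ j * w1 ^+ (m.+1 - j) =
    (if b then w0 else w1) * (w0 ^+ j' * w1 ^+ (m - j')).
  case: (posnP j) => [j0|j0]; rewrite /b; subst.
    by exists 0%N => // w0 w1; rewrite ltnn !expr0 !mul1r !subn0 exprS.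
  rewrite j0; exists j.-1; first by lia.
  by move=> w0 w1; rewrite mulrA -exprS prednK //; congr (_ * _ ^+ _); lia.
have [j' j'm {}jE] := jE.
have key i' Q : (i' <= 2 * m)%N ->
   (forall P, biform21 m P -> L m P -> L m.+1 (Q * P)) ->
   (forall z, Q z * monomial m i' j' z = monomial m.+1 i j z) -> L m.+1 (monomial m.+1 i j).
  move=> i'm hQ E; have := hQ _ (monomial_biform i'm j'm) (IH i' j' i'm j'm).
  by congr (L _ _); apply/funext => z; rewrite -E.
have [i2|i2] := leqP 2 i.
  apply: (key (i - 2)%N) (@L_corner m true b) _; first by lia.
  move=> z; rewrite /corner /mixed /monomial jE /= mulrACA; congr (_ * _); rewrite mulrA -exprD.
  by congr (_ ^+ _ * _ ^+ _); lia.
have [m0|m0] := posnP m.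
  have [i0|i1] := posnP i.
    apply: (key 0%N) (@L_corner m false b) _ => // z; rewrite /corner /mixed /monomial jE mulrACA i0 m0.
    by rewrite muln0 muln1 !subn0 !expr0 !mul1r !mulr1.
  apply: (key 0%N) (@L_mixed m b) _ => // z; rewrite /corner /mixed /monomial jE mulrACA m0.
  have -> : i = 1%N by lia.
  by rewrite muln0 muln1 !subn0 subSS subn0 !expr0 !expr1 !mulr1.
apply: (key i) (@L_corner m false b) _; first by lia.
move=> z; rewrite /corner /mixed /monomial jE /= mulrACA; congr (_ * _); rewrite mulrCA -exprD.
by congr (_ * _ ^+ _); lia.
Qed.

Lemma meval2 (p : {mpoly F[2]}) (u : vec2 F) : peval p u =
  \sum_(k <- msupp p) p@_k * (u i20 ord0 ^+ k i20 * u i21 ord0 ^+ k i21).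
Proof.
rewrite /peval mevalE; apply: eq_bigr => k _; rewrite !big_ord_recl big_ord0 mulr1.
by repeat congr (_ * _); congr (u _ _ ^+ k _); exact: val_inj.
Qed.

Lemma mdeg2 (k : 'X_{1..2}) : mdeg k = (k i20 + k i21)%N.
Proof.
rewrite mdegE !big_ord_recl big_ord0 addn0; congr (_ + _)%N; congr (k _); exact: val_inj.
Qed.

(** Biforms of bidegree (2m, m) are sums of products of the six monomials of
    bidegree (2, 1). *)
Lemma biform21_ind m P : biform21 m P -> L m P.
Proof.
move=> [s hs ->]; apply: L_sum => -[f g] /(allP hs) /= /andP[/dhomogP hf /dhomogP hg].
have -> : (fun z => peval f z.1 * peval g z.2) = (fun z =>
    \sum_(k <- msupp f) \sum_(l <- msupp g) f@_k * g@_l *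
      (z.1 i20 ord0 ^+ k i20 * z.1 i21 ord0 ^+ k i21 *
       (z.2 i20 ord0 ^+ l i20 * z.2 i21 ord0 ^+ l i21))).
  apply/funext => z; rewrite !meval2 mulr_suml; apply: eq_bigr => k _.
  by rewrite mulr_sumr; apply: eq_bigr => l _; rewrite mulrACA.
apply: L_sum => k kf; apply: L_sum => l lg; apply: L_scale.
have := hf k kf; have := hg l lg; rewrite /= !mdeg2 => lm km.
have := @L_monomial m (k i20) (l i20) _ _.
rewrite /monomial -{2}km -lm !addKn; apply; last exact: leq_addr.
by rewrite lm -km leq_addr.
Qed.

End BiformInduction.

Section Lift.
Variable F : closedFieldType.
Let vec2 := vec2 F.
Implicit Types (z : vec2 * vec2).

(** The form f lives on the whole space of trivectors, so that it defines a
    section on all of the Richardson variety and not only near the slice. *)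
Definition lift_of m (P : vec2 * vec2 -> F) (f : 'cV[F]_N -> F) :=
  [/\ form N (7 * m) f,
      forall t : 'I_7 -> F, \prod_i t i = 1 -> forall v, f (tor t v) = f v
    & forall z, f (sl z) = P z].

Definition liftable m P := exists f, lift_of m P f.

Lemma liftable_cst c : liftable 0 (fun=> c).
Proof. by exists (fun=> c); split=> //; exact: form_cst. Qed.

Lemma liftableD m P Q : liftable m P -> liftable m Q -> liftable m (P + Q).
Proof.
move=> [f [hf tf fP]] [g [hg tg gQ]]; exists (f + g); split.
- exact: formD.
- by move=> t t1 v; congr (_ + _); [exact: tf | exact: tg].
- by move=> z; congr (_ + _); [exact: fP | exact: gQ].
Qed.

Lemma liftableM m n P Q : liftable m P -> liftable n Q -> liftable (m + n) (P * Q).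
Proof.
move=> [f [hf tf fP]] [g [hg tg gQ]]; exists (f * g); split.
- by rewrite mulnDr; exact: formM.
- by move=> t t1 v; congr (_ * _); [exact: tf | exact: tg].
- by move=> z; congr (_ * _); [exact: fP | exact: gQ].
Qed.

Lemma liftable_scale m c P : liftable m P -> liftable m (fun z => c * P z).
Proof. by move=> /(liftableM (liftable_cst c)); rewrite add0n. Qed.

Lemma liftable0 m : liftable m (fun=> 0).
Proof.
exists (fun=> 0); split=> //.
by have := form_scale 0 (form_coord_pow F (ix finset.set0) (7 * m));
  congr (form _ _ _); apply/funext => v; rewrite mul0r.
Qed.

Let T := ('I_7 * 'I_7 * 'I_7)%type.
Definition coord_prod (s : seq T) (v : 'cV[F]_N) := \prod_(x <- s) coord3 v x.1.1 x.1.2 x.2.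

(** Each index occurs three times in the monomial, so a diagonal matrix acts on
    it by the cube of its determinant. *)
Lemma lift_coord_prod (s : seq T) : size s = 7%N ->
  (forall t : 'I_7 -> F, \prod_(x <- s) (t x.1.1 * t x.1.2 * t x.2) = (\prod_i t i) ^+ 3) ->
  forall P, (forall z, coord_prod s (sl z) = P z) -> liftable 1 P.
Proof.
move=> s7 st P sP; exists (coord_prod s); split=> //.
- rewrite muln1 -{}s7 {st sP}; elim: s => [|x s IH].
    by rewrite (_ : coord_prod [::] = (fun=> 1)); [exact: form_cst|apply/funext => v; rewrite /coord_prod big_nil].
  rewrite (_ : coord_prod (x :: s) = (fun v => coord3 v x.1.1 x.1.2 x.2) * coord_prod s).
    by apply: (@formM _ _ 1) => //; exact: form_coord3.
  by apply/funext => v; rewrite /coord_prod big_cons.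
- move=> t t1 v; rewrite /coord_prod; under eq_bigr do rewrite coord3_tor.
  by rewrite big_split /= st t1 expr1n mul1r.
Qed.

Lemma coord_sl z i j k : coord3 (sl z) i j k = det3 (slice_a F)
  (slice_b (z.1 i20 ord0) (z.1 i21 ord0)) (slice_c (z.2 i20 ord0) (z.2 i21 ord0)) i j k.
Proof. exact: coord3_minors. Qed.

Ltac lift_monomial s :=
  apply: (@lift_coord_prod s) => // [t|z];
  [rewrite prod7 !big_cons big_nil /=; ring
  |rewrite /coord_prod !big_cons big_nil /= !coord_sl /det3 /slice_a /slice_b /slice_c /=; ring].

(** On the slice the coordinate 1, 2, k is u0 and the coordinate 1, 2, j is
    u0 w_j for k in {6, 7} and j in {4, 5}; likewise for 1, 3 and u1. One of each
    kind gives the monomial, and five coordinates with one index in each of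
    {1, 2, 3}, {4, 5}, {6, 7}, which are 1 on the slice, balance the weights. *)
Lemma liftable_corner (i j : bool) : liftable 1 (corner i j).
Proof.
rewrite /corner; case: i; case: j.
- lift_monomial [:: ('i_0, 'i_1, 'i_3); ('i_0, 'i_1, 'i_5); ('i_0, 'i_3, 'i_5);
    ('i_1, 'i_3, 'i_5); ('i_2, 'i_4, 'i_6); ('i_2, 'i_4, 'i_6); ('i_2, 'i_4, 'i_6)].
- lift_monomial [:: ('i_0, 'i_1, 'i_4); ('i_0, 'i_1, 'i_5); ('i_0, 'i_4, 'i_5);
    ('i_1, 'i_4, 'i_5); ('i_2, 'i_3, 'i_6); ('i_2, 'i_3, 'i_6); ('i_2, 'i_3, 'i_6)].
- lift_monomial [:: ('i_0, 'i_2, 'i_3); ('i_0, 'i_2, 'i_5); ('i_0, 'i_3, 'i_5);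
    ('i_2, 'i_3, 'i_5); ('i_1, 'i_4, 'i_6); ('i_1, 'i_4, 'i_6); ('i_1, 'i_4, 'i_6)].
- lift_monomial [:: ('i_0, 'i_2, 'i_4); ('i_0, 'i_2, 'i_5); ('i_0, 'i_4, 'i_5);
    ('i_2, 'i_4, 'i_5); ('i_1, 'i_3, 'i_6); ('i_1, 'i_3, 'i_6); ('i_1, 'i_3, 'i_6)].
Qed.

Lemma liftable_mixed (j : bool) : liftable 1 (mixed j).
Proof.
rewrite /mixed; case: j.
- lift_monomial [:: ('i_0, 'i_1, 'i_3); ('i_0, 'i_2, 'i_5); ('i_0, 'i_3, 'i_5);
    ('i_1, 'i_3, 'i_5); ('i_1, 'i_4, 'i_6); ('i_2, 'i_4, 'i_6); ('i_2, 'i_4, 'i_6)].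
- lift_monomial [:: ('i_0, 'i_1, 'i_4); ('i_0, 'i_2, 'i_5); ('i_0, 'i_4, 'i_5);
    ('i_1, 'i_4, 'i_5); ('i_1, 'i_3, 'i_6); ('i_2, 'i_3, 'i_6); ('i_2, 'i_3, 'i_6)].
Qed.

Lemma liftable_biform m P : biform21 m P -> liftable m P.
Proof.
apply: biform21_ind => {m P}; [exact: liftable_cst|exact: liftable0|exact: liftableD|
  exact: liftable_scale| |].
- by move=> m i j P _ hP; rewrite -add1n; exact: liftableM (liftable_corner i j) hP.
- by move=> m j P _ hP; rewrite -add1n; exact: liftableM (liftable_mixed j) hP.
Qed.

End Lift.

(** * The ring of invariants *)

Section Ring.
Variable F : closedFieldType.
Let XF := @X F.
Let Y := subspace XF.
Let vec2 := vec2 F.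
Implicit Types (y : Y) (z : vec2 * vec2) (s : Y -> 'cV[F]_N -> F).

Definition nz z := (z.1 != 0) && (z.2 != 0).

(** The scalar c absorbs the choice of the representative of y. *)
Definition over y z := nz z /\ exists (c : F) (t : 'I_7 -> F),
  [/\ c != 0, forall i, t i != 0 & yrep y = c *: tor t (sl z)].

Lemma over_value y z : over y z -> exists2 k : F, k != 0 &
  forall m s, invariants m s -> s y (yrep y) = k ^+ m * slice_value s z.
Proof.
move=> [_ [c [t [c0 t0 yE]]]]; exists (c ^+ 7 * (\prod_i t i) ^+ 3).
  by rewrite mulf_neq0 ?expf_neq0 //; apply/prodf_neq0.
move=> m s As; have [sS _] := (invariantsP m s).1 As; have [sh _] := sec_fib y sS.
have ty : tor t (sl z) \in val (incl y).
  by rewrite -[tor _ _](scalerK c0) -yE; apply: memZ_line; exact: yrep_mem.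
rewrite {1}yE sh // (invariants_equivariant As t0 (sl_mem z) ty (sl_neq0 z)) mulrA.
by rewrite exprMn -!exprM.
Qed.

Lemma over_form y z : over y z -> exists2 k : F, k != 0 &
  forall m P f, lift_of m P f -> f (yrep y) = k ^+ m * P z.
Proof.
move=> [_ [c [t [c0 t0 yE]]]].
have [d [t' [d0 d7 t'1 tE]]] := unimodular t0.
have k0 : c * d ^+ 3 != 0 by rewrite mulf_neq0 // expf_neq0.
exists ((c * d ^+ 3) ^+ 7); first exact: expf_neq0.
move=> m P f [hf ft fP].
by rewrite yE tE scalerA (formZ _ _ hf) ft // fP -exprM.
Qed.

Lemma sec_eq0 d (s : Y -> 'cV[F]_N -> F) y : sec (Lomega XF d) setT s ->
  (s y = 0) <-> s y (yrep y) = 0.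
Proof.
move=> sS; split=> [->//|s0]; have sf := sec_fib y sS.
by apply: (serre_fibP sf (g := 0)) => //; split=> // *; rewrite mulr0.
Qed.

Lemma over_eq0 y z m s : over y z -> invariants m s -> (s y = 0) <-> slice_value s z = 0.
Proof.
move=> yz_ As; have [sS _] := (invariantsP m s).1 As.
have [k k0 kE] := over_value yz_; rewrite (sec_eq0 y sS) (kE _ _ As).
split=> [/eqP|->]; last by rewrite mulr0.
by rewrite mulf_eq0 expf_eq0 (negPf k0) andbF => /eqP.
Qed.

Lemma vec2_neq0 (u : vec2) : (u != 0) = (u i20 ord0 != 0) || (u i21 ord0 != 0).
Proof.
apply/idP/idP; last first.
  by move=> /orP[] h; apply: contraNneq h => ->; rewrite mxE.
move=> /exists_coord[k]; have [->|->] : k = i20 \/ k = i21.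
- by case: k => [[|[|//]] lt]; [left|right]; exact: val_inj.
- by move=> ->.
- by move=> ->; rewrite orbT.
Qed.

Lemma semistable_over y : semistable XF 7 y -> exists z, over y z.
Proof.
move=> [m [s [m0 As sy]]].
have [t [u0 [u1 [w0 [w1 [t0 hu hw yE]]]]]] := balanced_slice (balanced_semistable m0 As sy).
pose v2 (x0 x1 : F) : vec2 := \col_i (if i == i20 then x0 else x1).
exists (v2 u0 u1, v2 w0 w1); split; first by rewrite /nz !vec2_neq0 !mxE /= hu hw.
exists 1, t; split=> //; first exact: oner_neq0.
by rewrite scale1r yE /sl !mxE.
Qed.

Lemma corner_nz z : nz z -> exists i j, corner i j z != 0.
Proof.
rewrite /nz !vec2_neq0 => /andP[/orP hu /orP hw].
case: hu => hu; case: hw => hw; [exists true, true|exists true, false|exists false, true|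
  exists false, false]; by rewrite /corner mulf_neq0 // expf_neq0.
Qed.

(** * Sections defined by biforms *)

Definition form_sec (f : 'cV[F]_N -> F) : Y -> 'cV[F]_N -> F :=
  fun y => form_section f (incl y).

Lemma form_sec_invariant m P f : lift_of m P f -> invariants m (form_sec f).
Proof.
move=> [hf ft fP]; apply/invariantsP; split; first exact: sec_form.
move=> t t1 y y' yy' v; rewrite /form_sec /form_section ft // yy'.
have t0 : forall i, t i != 0 by apply: prod_neq0; rewrite t1 oner_eq0.
congr (if _ then _ else _); rewrite (lrep_span (incl y)).
apply/idP/idP => /vlineP[c cE]; apply/vlineP; exists c.
  pose t' i := (t i)^-1.
  have t't w : tor t' (tor t w) = w.
    rewrite torM (_ : (fun i => t' i * t i) = (fun=> 1)) ?tor_const ?expr1n ?scale1r //.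
    by apply/funext => i; rewrite /t' mulVf.
  by rewrite -[v]t't cE torZ t't.
by rewrite cE torZ.
Qed.

Lemma form_sec_value m P f z : lift_of m P f -> slice_value (form_sec f) z = P z.
Proof. by move=> [_ _ fP]; rewrite /slice_value /form_sec /form_section sl_mem fP. Qed.

Lemma invariants_lift m P : biform21 m P -> exists2 s, invariants m s & @slice_value F s = P.
Proof.
move=> /liftable_biform[f fl]; exists (form_sec f); first exact: form_sec_invariant fl.
by apply/funext => z; exact: form_sec_value fl.
Qed.

(** Sections of positive degree are determined by their restriction to the
    slice, since they vanish at all unstable points. *)
Lemma invariants_inj m s s' : (0 < m)%N -> invariants m s -> invariants m s' ->
  (forall z, nz z -> slice_value s z = slice_value s' z) -> s = s'.
Proof.
move=> m0 As As' ss'; apply/funext => y.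
have [sS _] := (invariantsP m s).1 As; have [sS' _] := (invariantsP m s').1 As'.
have [yss|yus] := pselect (semistable XF 7 y).
  have [z yz_] := semistable_over yss; have [k _ kE] := over_value yz_.
  apply: (serre_fibP (sec_fib y sS) (sec_fib y sS')).
  by rewrite -/(yrep y) (kE _ _ As) (kE _ _ As') ss' //; case: yz_.
have un r : invariants m r -> r y = 0.
  by move=> Ar; apply: contrapT => ry; apply: yus; exists m, r.
by rewrite !un.
Qed.

Lemma invariantsD m s s' : invariants m s -> invariants m s' -> invariants m (s + s').
Proof.
move=> /invariantsP[sS si] /invariantsP[sS' si']; apply/invariantsP; split; first exact: secD.
by move=> t t1 y y' yy' v; congr (_ + _); [exact: si | exact: si'].
Qed.

Lemma invariantsM m n s s' : invariants m s -> invariants n s' -> invariants (m + n) (s * s').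
Proof.
move=> /invariantsP[sS si] /invariantsP[sS' si']; apply/invariantsP; split; first by rewrite mulnDr; exact: secM.
by move=> t t1 y y' yy' v; congr (_ * _); [exact: si | exact: si'].
Qed.

Lemma slice_valueD s s' : @slice_value F (s + s') = slice_value s + slice_value s'.
Proof. by []. Qed.

Lemma slice_valueM s s' : @slice_value F (s * s') = slice_value s * slice_value s'.
Proof. by []. Qed.

Lemma invariants_scale m c s : invariants m s -> invariants m (fun y => smul c (s y)).
Proof.
move=> As; have [sS _] := (invariantsP m s).1 As.
have A1 : invariants 0 (form_sec (fun=> c)).
  by apply: (@form_sec_invariant 0 (fun=> c)); split=> //; exact: form_cst.
have := invariantsM A1 As; rewrite add0n; congr (invariants m _).
apply/funext => y; apply/funext => v; have [_ s0] := sec_fib y sS.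
change (form_section (fun=> c) (incl y) v * s y v = smul c (s y) v).
by rewrite /form_section /smul; case: ifPn => // /s0 ->; rewrite !mulr0.
Qed.

Lemma invariants_0 m : @invariants F m 0.
Proof.
have [s As _] := @invariants_lift m _ (biform0 F (2 * m) m).
have := invariants_scale 0 As; congr (invariants m _).
by apply/funext => y; apply/funext => v; rewrite /smul mul0r.
Qed.

End Ring.

(** * A Nullstellensatz for two variables *)

Section Nullstellensatz.
Variable F : closedFieldType.

Definition prime_ideal (A : comNzRingType) (I : set A) : Prop :=
  [/\ forall a b, I a -> I b -> I (a + b), forall a b, I b -> I (a * b),
      forall a b, I (a * b) -> I a \/ I b & ~ I 1].

(** A polynomial splits into linear factors, and a prime ideal that contains it
    contains one of them. *)
Lemma prime_ideal_linear (J : set {poly F}) : prime_ideal J ->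
  forall c, J c -> c != 0 -> exists y, J ('X - y%:P).
Proof.
move=> [_ JM Jp J1] c; move: {2}(size c) (leqnn (size c)) => n.
elim: n c => [|n IH] c; first by rewrite leqn0 size_poly_eq0 => ->.
move=> sc Jc c0; have [s1|s1] := eqVneq (size c) 1%N.
  case: J1; have /size_poly1P[a a0 cE] : size c == 1%N by rewrite s1.
  have := JM (a^-1)%:P c Jc; rewrite cE -polyCM mulVf //.
move/closed_rootP: s1 => [y /factor_theorem[q cE]].
rewrite cE in Jc; have [Jq|] := Jp _ _ Jc; last by exists y.
have q0 : q != 0 by apply: contraNneq c0 => q0; rewrite cE q0 mul0r.
apply: (IH q) => //.
by move: sc; rewrite cE size_Mmonic ?monicXsubC // size_XsubC addn2.
Qed.

Lemma prime_ideal0 (A : comNzRingType) (I : set A) a : prime_ideal I -> I a -> I 0.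
Proof. by move=> [_ IM _ _] /(IM 0); rewrite mul0r. Qed.

Lemma prime_ideal_sum (A : comNzRingType) (I : set A) n (f : 'I_n -> A) :
  prime_ideal I -> I 0 -> (forall i, I (f i)) -> I (\sum_(i < n) f i).
Proof.
by move=> [ID _ _ _] I0 If; apply: (big_ind I).
Qed.

(** Here X is the outer variable and Y the inner one. Take an element g of least
    degree in X. If g has positive degree, then by pseudo-division a power of
    its leading coefficient carries the ideal into (g), and any zero of g off the
    zeros of the leading coefficient will do. If g is a polynomial in Y only,
    then the ideal contains some Y - y, and the problem reduces to one variable. *)
Lemma prime_ideal_zero (I : set {poly {poly F}}) : prime_ideal I ->
  exists x y, forall f, I f -> f.[x%:P].[y] = 0.
Proof.
move=> Ip; have [ID IM Ipr I1] := Ip.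
have [allz|] := pselect (forall f, I f -> f = 0).
  by exists 0, 0 => f /allz ->; rewrite !horner0.
move=> /existsNP[g0 /not_implyP[Ig0 /eqP g00]].
pose P n := `[< exists g, [/\ I g, g != 0 & size g = n] >].
have exP : exists n, P n by exists (size g0); apply/asboolP; exists g0.
case: (ex_minnP exP) => n /asboolP[g [Ig gn0 gn]] nmin.
have sg1 : (0 < size g)%N by rewrite size_poly_gt0.
(* Modulo Y - y an element of the ideal is its image under Y := y. *)
have ImodY y : I ('X - y%:P)%:P -> forall f, I f ->
    I (map_poly polyC (map_poly (horner_eval y) f)).
  move=> Iy f If.
  suff : I (map_poly polyC (map_poly (horner_eval y) f) - f).
    by move=> /ID /(_ If); rewrite subrK.
  rewrite -[X in _ - X]coefK -[map_poly _ (map_poly _ _)]coefK.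
  set h := map_poly polyC _.
  have hE : h = \poly_(i < size f) (h`_i).
    apply/polyP => i; rewrite coef_poly; case: ltnP => // fi.
    by rewrite !coef_map /= nth_default // /horner_eval horner0.
  rewrite coefK hE poly_def poly_def -sumrB.
  apply: prime_ideal_sum => //; first exact: prime_ideal0 Ig.
  move=> i; rewrite -scalerBl -mul_polyC mulrC; apply: (IM _ _).

  rewrite !coef_map /= /horner_eval.
  have /factor_theorem[q qE] : root ((f`_i).[y]%:P - f`_i) y.
    by rewrite /root hornerD hornerN hornerC subrr.
  by rewrite qE polyCM; apply: IM.
have [s1|s1] := eqVneq (size g) 1%N.
  have /size_poly1P[c c0 gE] : size g == 1%N by rewrite s1.
  pose J := [set c : {poly F} | I c%:P].
  have Jp : prime_ideal J.
    split=> [a b|a b|a b|]; rewrite /J /=.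
    - by rewrite polyCD; exact: ID.
    - by rewrite polyCM; exact: IM.
    - by rewrite polyCM; exact: Ipr.
    - by rewrite polyC1.
  have [|y Jy] := prime_ideal_linear Jp _ c0; first by rewrite /J /= -gE.
  pose K := [set h : {poly F} | I (map_poly polyC h)].
  have Kp : prime_ideal K.
    split=> [a b|a b|a b|]; rewrite /K /=.
    - by rewrite rmorphD; exact: ID.
    - by rewrite rmorphM; exact: IM.
    - by rewrite rmorphM; exact: Ipr.
    - by rewrite rmorph1.
  have KI f : I f -> K (map_poly (horner_eval y) f) by exact: ImodY.
  have [Kz|] := pselect (forall f, K f -> f = 0).
    by exists 0, y => f /KI/Kz E; rewrite horner2_map E horner0.
  move=> /existsNP[h /not_implyP[Kh /eqP h0]].
  have [x Kx] := prime_ideal_linear Kp Kh h0.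
  exists x, y => f /KI; rewrite horner2_map; set k := map_poly _ f => Kk.
  apply: contrapT => /eqP kx; have [KD KM _ K1] := Kp; apply: K1.
  have /factor_theorem[q qE] : root (k - k.[x]%:P) x.
    by rewrite /root hornerD hornerN hornerC subrr.
  have Kc : K (k.[x]%:P).
    rewrite (_ : k.[x]%:P = (- q) * ('X - x%:P) + k); first exact/KD/Kk/KM.
    by rewrite mulNr -qE opprB subrK.
  by have := KM (k.[x]^-1)%:P _ Kc; rewrite -polyCM mulVf.
have lg0 : lead_coef g != 0 by rewrite lead_coef_eq0.
have [y ly] := closed_nonrootP _ lg0.
have sy : size (map_poly (horner_eval y) g) = size g by apply: size_map_poly_id0.
have /closed_rootP[x gx] : size (map_poly (horner_eval y) g) != 1%N by rewrite sy.
exists x, y => f If.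
have E := Pdiv.Idomain.divp_eq f g.
have r0 : Pdiv.Idomain.modp f g = 0.
  apply: contrapT => /eqP r0.
  have : (n <= size (f %% g)%R)%N.
    apply: nmin; apply/asboolP; exists (f %% g)%R; split=> //.
    rewrite (_ : (f %% g)%R = (- (f %/ g)) * g + (lead_coef g ^+ scalp f g)%:P * f).
      by apply: ID; exact: IM.
    by rewrite mul_polyC E mulNr addKr.
  by rewrite -gn leqNgt ltn_modp gn0.
have := congr1 (fun p => p.[x%:P].[y]) E; rewrite r0 addr0 hornerZ hornerM !hornerM horner_exp.
rewrite [g.[_].[_]]horner2_map (rootP gx) mulr0 => /eqP; rewrite mulf_eq0 expf_eq0.
by move: ly; rewrite /root => /negPf ->; rewrite andbF => /eqP.
Qed.

End Nullstellensatz.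

(** * The points of Proj *)

Section Charts.
Variable F : closedFieldType.
Let vec2 := vec2 F.
Implicit Types (z : vec2 * vec2).

(** The parametrisation of an affine chart of the projective line. *)
Definition cvec (A : nzRingType) (i : bool) (y : A) : 'cV[A]_2 :=
  \col_k (if (k == i20) == i then 1 else y).

Definition cpt (i j : bool) (x y : F) : vec2 * vec2 := (cvec i y, cvec j x).

Lemma corner_cpt i j x y : corner i j (cpt i j x y) = 1.
Proof. by case: i; case: j; rewrite /corner !mxE /= expr1n mulr1. Qed.

Lemma nz_cpt i j x y : nz (cpt i j x y).
Proof. by case: i; case: j; rewrite /nz !vec2_neq0 !mxE /= oner_eq0 ?orbT. Qed.

Lemma corner_chart i j z : corner i j z != 0 -> exists a b x y,
  z = (a *: (cpt i j x y).1, b *: (cpt i j x y).2).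
Proof.
have ord2 (k : 'I_2) : k = i20 \/ k = i21.
  by case: k => [[|[|//]] lt]; [left|right]; exact: val_inj.
have E (u v : vec2) a : (forall k, u k ord0 = a * v k ord0) -> u = a *: v.
  by move=> uv; apply/colP => k; rewrite mxE.
rewrite /corner mulf_eq0 expf_eq0 /= negb_or => /andP[a0 b0].
exists (if i then z.1 i20 ord0 else z.1 i21 ord0), (if j then z.2 i20 ord0 else z.2 i21 ord0).
exists ((if j then z.2 i21 ord0 else z.2 i20 ord0) / (if j then z.2 i20 ord0 else z.2 i21 ord0)),
  ((if i then z.1 i21 ord0 else z.1 i20 ord0) / (if i then z.1 i20 ord0 else z.1 i21 ord0)).
rewrite [LHS]surjective_pairing; congr (_, _); apply: E => k; rewrite mxE.
  by case: i a0 => a0; case: (ord2 k) => ->; rewrite /= ?mulr1 // mulrC divfK.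
by case: j b0 => b0; case: (ord2 k) => ->; rewrite /= ?mulr1 // mulrC divfK.
Qed.

(** Biforms of equal bidegree that agree on the chart agree where the corner
    monomial does not vanish; multiplying by it removes the restriction. *)
Lemma biform_chart_eq i j m P Q : biform21 m P -> biform21 m Q ->
  (forall x y, P (cpt i j x y) = Q (cpt i j x y)) ->
  P * corner i j = Q * corner i j.
Proof.
move=> hP hQ PQ; apply/funext => z.
change (P z * corner i j z = Q z * corner i j z).
have [->|/corner_chart[a [b [x [y ->]]]]] := eqVneq (corner i j z) 0.
  by rewrite !mulr0.
by rewrite (biformZ _ _ _ _ hP) (biformZ _ _ _ _ hQ) -surjective_pairing PQ.
Qed.

Lemma corner_exp_biform i j n : biform21 n (fun z => corner i j z ^+ n).
Proof. by have := biform21_exp n (@corner_biform F i j); rewrite mul1n. Qed.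

Lemma homogenize i j (h : {poly {poly F}}) : exists n H,
  [/\ (0 < n)%N, biform21 n H & forall x y, H (cpt i j x y) = h.[x%:P].[y]].
Proof.
pose Hom (h : {poly {poly F}}) := exists n H,
  [/\ (0 < n)%N, biform21 n H & forall x y, H (cpt i j x y) = h.[x%:P].[y]].
have HD f g : Hom f -> Hom g -> Hom (f + g).
  move=> [n [H [n0 hH HE]]] [m [K [m0 hK KE]]].
  exists (n + m)%N, (H * (fun z => corner i j z ^+ m) + (fun z => corner i j z ^+ n) * K).
  split=> //; first by rewrite addn_gt0 n0.
    apply: biformD; apply: biform21M => //; exact: corner_exp_biform.
  move=> x y; change (H (cpt i j x y) * corner i j (cpt i j x y) ^+ m +
    corner i j (cpt i j x y) ^+ n * K (cpt i j x y) = (f + g).[x%:P].[y]).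
  by rewrite corner_cpt !expr1n mulr1 mul1r HE KE !hornerD.
have HM f g : Hom f -> Hom g -> Hom (f * g).
  move=> [n [H [n0 hH HE]]] [m [K [m0 hK KE]]].
  exists (n + m)%N, (H * K); split=> //; first by rewrite addn_gt0 n0.
    exact: biform21M.
  move=> x y; change (H (cpt i j x y) * K (cpt i j x y) = (f * g).[x%:P].[y]).
  by rewrite HE KE !hornerM.
have HC c : Hom c%:P%:P.
  exists 1%N, (fun z => c * corner i j z); split=> //.
    exact: (graded_scale _ (biform21_graded F) (@corner_biform F i j)).
  by move=> x y; rewrite corner_cpt !hornerC mulr1.
have HX : Hom 'X.
  exists 1%N, (fun z => (if i then z.1 i20 ord0 else z.1 i21 ord0) ^+ 2 *
    (if j then z.2 i21 ord0 else z.2 i20 ord0)); split=> //.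
    by clear; case: j; [exact: (@corner_biform F i false) | exact: (@corner_biform F i true)].
  by move=> x y; rewrite hornerX hornerC !mxE; clear; case: i; case: j; rewrite /= expr1n mul1r.
have HY : Hom ('X)%:P.
  exists 1%N, (mixed j); split=> //; first exact: mixed_biform.
  move=> x y; rewrite hornerC hornerX /mixed !mxE; clear.
  by case: i; case: j; rewrite /= ?mul1r !mulr1.
have HCY c : Hom c%:P.
  elim/poly_ind: c => [|c a IH]; first by have := HC 0; rewrite polyC0.
  by rewrite polyCD polyCM; apply: HD => //; exact: HM.
elim/poly_ind: h => [|h c IH]; first by have := HC 0; rewrite !polyC0.
by apply: HD => //; exact: HM.
Qed.

Lemma dehomogenize i j m P : biform21 m P ->
  exists g : {poly {poly F}}, forall x y, P (cpt i j x y) = g.[x%:P].[y].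
Proof.
move=> [s _ ->].
have cE k (f : {mpoly F[2]}) (y : F) :
    (curve f (cvec k 'X)).[y] = peval f (cvec k y).
  rewrite horner_curve; congr peval; apply/colP => l; rewrite !mxE.
  by rewrite /horner_eval; case: ifP => _; rewrite ?hornerC ?hornerX.
exists (\sum_(fg <- s) (curve fg.1 (cvec i 'X))%:P * map_poly polyC (curve fg.2 (cvec j 'X))).
move=> x y; rewrite !horner_sum; apply: eq_bigr => fg _.
by rewrite !hornerM hornerC cE horner_map /= hornerC cE.
Qed.

End Charts.

Section RelevantPrimes.
Variable F : closedFieldType.
Let XF := @X F.
Let Y := subspace XF.
Let vec2 := vec2 F.
Implicit Types (z : vec2 * vec2) (s : Y -> 'cV[F]_N -> F).

Definition vanishing z m : set (Y -> 'cV[F]_N -> F) :=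
  [set s | invariants m s /\ slice_value s z = 0].

Lemma vanishing_relevant z : nz z -> relevant_prime (inv_ring XF 7) (vanishing z).
Proof.
move=> z0; split; split.
- by move=> m s [].
- by move=> m; split; [exact: invariants_0|].
- move=> m a b [Aa a0] [Ab b0]; split; first exact: invariantsD.
  by change (slice_value a z + slice_value b z = 0); rewrite a0 b0 addr0.
- move=> m n a b Aa [Ab b0]; split; first exact: invariantsM.
  by change (slice_value a z * slice_value b z = 0); rewrite b0 mulr0.
- move=> m n a b Aa Ab [_ ab0].
  have /eqP : slice_value a z * slice_value b z = 0 by exact: ab0.
  by rewrite mulf_eq0 => /orP[] /eqP h; [left|right].
- have [i [j cz]] := corner_nz z0; have [s As sE] := invariants_lift (@corner_biform F i j).
  exists 1%N, s; split=> // -[_]; rewrite sE => c0; by rewrite c0 eqxx in cz.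
Qed.

Section Relevant.
Variable p : nat -> set (Y -> 'cV[F]_N -> F).
Hypothesis pr : relevant_prime (inv_ring XF 7) p.

Let pA m s : p m s -> invariants m s. Proof. by case: pr => -[+ _ _ _] _; apply. Qed.

(* The biforms of the elements of p; in positive degree p can be recovered from
   them. *)
Let q m (P : vec2 * vec2 -> F) := exists2 s, p m s & slice_value s = P.

Let q_mem m s : (0 < m)%N -> invariants m s -> q m (slice_value s) -> p m s.
Proof.
move=> m0 As [s' ps' ss']; rewrite (_ : s = s') //.
by apply: (invariants_inj m0 As (pA ps')) => z _; rewrite ss'.
Qed.

Let qD m P Q : q m P -> q m Q -> q m (P + Q).
Proof.
move=> [s ps sP] [s' ps' sQ]; exists (s + s'); last by rewrite slice_valueD sP sQ.
by case: pr => -[_ _ + _] _; apply.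
Qed.

Let qM m n P Q : biform21 m P -> q n Q -> q (m + n) (P * Q).
Proof.
move=> /invariants_lift[a Aa aP] [s ps sQ]; exists (a * s); last by rewrite slice_valueM aP sQ.
by case: pr => -[_ _ _ +] _; apply.
Qed.

Let q_biform m P : q m P -> biform21 m P.
Proof. by move=> [s /pA As <-]; exact: slice_value_biform. Qed.

Let q_prime m n P Q : (0 < m + n)%N -> biform21 m P -> biform21 n Q ->
  q (m + n) (P * Q) -> q m P \/ q n Q.
Proof.
move=> mn /invariants_lift[a Aa aP] /invariants_lift[b Ab bQ] qPQ.
have : p (m + n) (a * b).
  by apply: q_mem => //; [exact: invariantsM | rewrite slice_valueM aP bQ].
by case: pr => _ [+ _] => /(_ _ _ _ _ Aa Ab) /[apply] -[h|h]; [left; exists a | right; exists b].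
Qed.

Let good_chart : exists i j, ~ q 1 (@corner F i j).
Proof.
apply: contrapT => H.
have qc i j : q 1 (@corner F i j).
  by apply: contrapT => nq; apply: H; exists i, j.
have qm j : q 1 (@mixed F j).
  have : q (1 + 1) (@mixed F j * @mixed F j).
    have := qM (@corner_biform F true j) (qc false j).
    congr (q _ _); apply/funext => z.
    change (corner true j z * corner false j z = mixed j z * mixed j z).
    by rewrite /corner /mixed; ring.
  by move=> /(@q_prime 1 1 _ _ isT (@mixed_biform F j) (@mixed_biform F j))[].
have qall m P : biform21 m P -> (0 < m)%N -> q m P.
  apply: (@biform21_ind F (fun m P => (0 < m)%N -> q m P)) => {m P} //.
  - by move=> m _; exists 0 => //; case: pr => -[_ + _ _] _; apply.
  - by move=> m P Q qP qQ m0; apply: qD; auto.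
  - by move=> m c P qP m0; exact: (@qM 0 m (fun=> c) P (biform_cst c) (qP m0)).
  - by move=> m i j P hP _ _; rewrite mulrC -addn1; exact: qM.
  - by move=> m j P hP _ _; rewrite mulrC -addn1; exact: qM.
case: pr => _ [_ [m [s [m0 As]]]]; apply; apply: q_mem => //.
by apply: qall => //; exact: slice_value_biform.
Qed.

(** Some corner monomial is not in p, since the corners generate the irrelevant
    ideal up to radicals. Setting it to 1 turns p into a proper prime ideal of
    polynomials in the two affine coordinates, which has a zero. Membership
    of a section of degree 0 is tested after multiplying it by the corner
    monomial, which vanishes at the unstable points. *)
Lemma relevant_vanishing : exists2 z, nz z & forall m, p m `<=` vanishing z m.
Proof.
have [i [j nq]] := good_chart.
pose B n : vec2 * vec2 -> F := fun z => corner i j z ^+ n.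
have hB n : biform21 n (B n) by exact: corner_exp_biform.
have B1 : B 1%N = corner i j by apply/funext => z; rewrite /B expr1.
have qB n : ~ q n.+1 (B n.+1).
  elim: n => [|n IH]; first by rewrite B1.
  have -> : B n.+2 = corner i j * B n.+1 by apply/funext => z; rewrite /B exprS.
  by rewrite -add1n => /(@q_prime 1 n.+1 _ _ isT (@corner_biform F i j) (hB n.+1))[].
pose I := [set g : {poly {poly F}} | exists m P,
  [/\ (0 < m)%N, q m P & forall x y, P (cpt i j x y) = g.[x%:P].[y]]].
have Bpt n x y : B n (cpt i j x y) = 1 by rewrite /B corner_cpt expr1n.
have Ip : prime_ideal I.
  split.
  - move=> f g [m [P [m0 qP PE]]] [n [Q [n0 qQ QE]]].
    exists (m + n)%N, (B n * P + B m * Q); split; first by rewrite addn_gt0 m0.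
      by apply: qD; [rewrite addnC|]; exact: qM.
    move=> x y; change (B n (cpt i j x y) * P (cpt i j x y) +
      B m (cpt i j x y) * Q (cpt i j x y) = (f + g).[x%:P].[y]).
    by rewrite !Bpt !mul1r PE QE !hornerD.
  - move=> f g [m [P [m0 qP PE]]]; have [n [H [n0 hH HE]]] := homogenize i j f.
    exists (n + m)%N, (H * P); split; [by rewrite addn_gt0 n0|exact: qM|].
    move=> x y; change (H (cpt i j x y) * P (cpt i j x y) = (f * g).[x%:P].[y]).
    by rewrite HE PE !hornerM.
  - move=> f g [m [P [m0 qP PE]]].
    have [n [H [n0 hH HE]]] := homogenize i j f.
    have [k [K [k0 hK KE]]] := homogenize i j g.
    have E : B (n + k)%N * P * corner i j = B m * (H * K) * corner i j.
      apply: (@biform_chart_eq _ _ _ (n + k + m)); first by apply: biform21M => //; exact: q_biform.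
        by rewrite addnC; apply: biform21M => //; exact: biform21M.
      move=> x y; change (B (n + k)%N (cpt i j x y) * P (cpt i j x y) =
        B m (cpt i j x y) * (H (cpt i j x y) * K (cpt i j x y))).
      by rewrite !Bpt !mul1r PE HE KE !hornerM.
    have : q (m + 1 + (n + k)) ((B m * corner i j) * (H * K)).
      have -> : (B m * corner i j) * (H * K) = corner i j * (B (n + k)%N * P).
        by rewrite [RHS]mulrC E mulrAC.
      rewrite (_ : (m + 1 + (n + k) = 1 + ((n + k) + m))%N); last by lia.
      by apply: qM; [exact: corner_biform | exact: qM].
    have hBm : biform21 (m + 1) (B m * corner i j).
      by apply: biform21M => //; exact: corner_biform.
    move=> /(q_prime _ hBm (biform21M hH hK))[|h|/(q_prime _ hH hK)[|h|h]].
    + by rewrite addn_gt0 addn1.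
    + have : q m.+1 (B m.+1).
        by move: h; rewrite addn1; congr (q _ _); apply/funext => z; rewrite /B exprSr.
      by move/qB.
    + by rewrite addn_gt0 n0.
    + by left; exists n, H.
    + by right; exists k, K.
  - move=> [m [P [m0 qP PE]]]; apply: (qB m).
    have -> : B m.+1 = corner i j * P.
      rewrite [RHS]mulrC; have <- : B m * corner i j = P * corner i j.
        apply: (@biform_chart_eq _ _ _ m); [exact: hB|exact: q_biform|].
        by move=> x y; rewrite Bpt PE !hornerC.
      by apply/funext => z; rewrite /B exprSr.
    by rewrite -add1n; exact: (qM (@corner_biform F i j) qP).
have [x [y xy0]] := prime_ideal_zero Ip.
have pos m s : (0 < m)%N -> p m s -> slice_value s (cpt i j x y) = 0.
  move=> m0 ps; have [g gE] := dehomogenize i j (slice_value_biform (pA ps)).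
  by rewrite gE; apply: xy0; exists m, (slice_value s); split=> //; exists s.
exists (cpt i j x y); first exact: nz_cpt.
move=> [|m] s ps; split; [exact: pA| |exact: pA|exact: pos ps].
have [b Ab bE] := invariants_lift (@corner_biform F i j).
have pbs : p 1%N (b * s) by case: pr => -[_ _ _ +] _ => /(_ 1%N 0%N b s Ab ps).
have : slice_value b (cpt i j x y) * slice_value s (cpt i j x y) = 0 by exact: (pos 1%N (b * s) isT pbs).
by rewrite bE corner_cpt mul1r.
Qed.

End Relevant.
End RelevantPrimes.

(** * The quotient is a product of projective lines *)

Section Quotient.
Variable F : closedFieldType.
Let XF := @X F.
Let Y := subspace XF.
Let vec2 := vec2 F.
Let Q := git_quotient XF 7.
Let P1 := P1 F.
Implicit Types (z : vec2 * vec2) (s : Y -> 'cV[F]_N -> F).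

Lemma vec2_proportional (u u' : vec2) : u != 0 -> u' != 0 ->
  u' i20 ord0 * u i21 ord0 = u' i21 ord0 * u i20 ord0 ->
  exists2 a, a != 0 & u' = a *: u.
Proof.
move=> u0 u'0 E.
suff [a aE] : exists a, u' = a *: u.
  by exists a => //; apply: contraNneq u'0 => a0; rewrite aE a0 scale0r.
have ext (v w : vec2) : v i20 ord0 = w i20 ord0 -> v i21 ord0 = w i21 ord0 -> v = w.
  move=> e0 e1; apply/colP => -[[|[|//]] lt].
    by rewrite (_ : Ordinal lt = i20) //; exact: val_inj.
  by rewrite (_ : Ordinal lt = i21) //; exact: val_inj.
move: u0; rewrite vec2_neq0 => /orP[h|h].
  exists (u' i20 ord0 / u i20 ord0); apply: ext; rewrite mxE; first by rewrite divfK.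
  by rewrite mulrAC E mulfK.
exists (u' i21 ord0 / u i21 ord0); apply: ext; rewrite mxE; last by rewrite divfK.
by rewrite mulrAC -E mulfK.
Qed.

Definition proportional z z' := exists a b, [/\ a != 0, b != 0 & z' = (a *: z.1, b *: z.2)].

Lemma vanishing_proportional z z' : proportional z z' -> vanishing z' = vanishing z.
Proof.
move=> [a [b [a0 b0 ->]]]; apply/funext => m; apply/seteqP; split=> s [As s0]; split=> //.
  have := slice_value_scale z As a0 b0; rewrite s0 => /esym/eqP.
  by rewrite !mulf_eq0 !expf_eq0 (negPf a0) (negPf b0) !andbF => /eqP.
by rewrite (slice_value_scale z As a0 b0) s0 mulr0.
Qed.

Lemma linear_form_through (u : vec2) :
  form 2 1 (fun v : vec2 => v i20 ord0 * u i21 ord0 - v i21 ord0 * u i20 ord0).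
Proof.
apply: formD; last apply: form_opp; first last.
  by have := form_scale (u i20 ord0) (form_coord F i21); congr (form _ _ _); apply/funext => v; rewrite mulrC.
by have := form_scale (u i21 ord0) (form_coord F i20); congr (form _ _ _); apply/funext => v; rewrite mulrC.
Qed.

(** A biform that is the product of a linear form vanishing at z with forms not
    vanishing at z' separates the two points. *)
Lemma vanishing_sub z z' : nz z -> nz z' ->
  (forall m, vanishing z m `<=` vanishing z' m) -> proportional z z'.
Proof.
move=> /andP[u0 w0] /andP[u0' w0'] sub.
have test P : biform21 1 P -> P z = 0 -> P z' = 0.
  by move=> /invariants_lift[s As <-] sz; have [] : vanishing z' 1 s by exact: sub.
have [k hk kz] := linear_form_nonzero u0'; have [h hh hz] := linear_form_nonzero w0'.
have [a a0 aE] : exists2 a, a != 0 & z'.1 = a *: z.1.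
  apply: vec2_proportional => //; apply/eqP; rewrite -subr_eq0.
  have := test _ (biform_pure (formM (linear_form_through z.1) hk) hh).
  move=> /(_ _)/eqP/=; rewrite !mulf_eq0 (negPf kz) (negPf hz) !orbF; apply.
  change ((z.1 i20 ord0 * z.1 i21 ord0 - z.1 i21 ord0 * z.1 i20 ord0) * k z.1 * h z.2 = 0).
  by ring.
have [b b0 bE] : exists2 b, b != 0 & z'.2 = b *: z.2.
  apply: vec2_proportional => //; apply/eqP; rewrite -subr_eq0.
  have := test _ (biform_pure (formM hk hk) (linear_form_through z.2)).
  move=> /(_ _)/eqP/=; rewrite !mulf_eq0 (negPf kz) /=; apply.
  change (k z.1 * k z.1 * (z.2 i20 ord0 * z.2 i21 ord0 - z.2 i21 ord0 * z.2 i20 ord0) = 0).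
  by ring.
by exists a, b; split=> //; rewrite -aE -bE -surjective_pairing.
Qed.

(** A relevant prime above the ideal of z lies in the ideal of some z', which is
    then the same point. *)
Lemma vanishing_max z : nz z -> proj_points (inv_ring XF 7) (vanishing z).
Proof.
move=> z0; split; first exact: vanishing_relevant.
move=> q qr sub; have [z' z0' qz'] := relevant_vanishing qr.
have /vanishing_proportional E : proportional z z'.
  by apply: vanishing_sub => // m s /sub/qz'.
by apply/funext => m; apply/seteqP; split=> [s /qz'|]; [rewrite E | exact: sub].
Qed.

Lemma proj_point_vanishing p : proj_points (inv_ring XF 7) p ->
  exists2 z, nz z & p = vanishing z.
Proof.
move=> [pr pmax]; have [z z0 pz] := relevant_vanishing pr; exists z => //.
by rewrite (pmax _ (vanishing_relevant z0)).
Qed.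

Lemma Q_param (p : Q) : exists z, nz z /\ \val (p : set_type _) = vanishing z.
Proof. by have [z z0 pz] := proj_point_vanishing (set_valP p); exists z. Qed.

Definition zQ (p : Q) : vec2 * vec2 := projT1 (cid (Q_param p)).

Lemma zQ_nz p : nz (zQ p). Proof. by rewrite /zQ; case: cid => z []. Qed.

Lemma zQ_val p : \val (p : set_type _) = vanishing (zQ p).
Proof. by rewrite /zQ; case: cid => z []. Qed.

Definition phi (p : Q) : prodspace P1 P1 :=
  (mkline (proj1 (andP (zQ_nz p))), mkline (proj2 (andP (zQ_nz p)))).

Lemma mkline_rep n (v : 'cV[F]_n) (v0 : v != 0) :
  exists2 a, a != 0 & lrep (mkline v0) = a *: v.
Proof.
have [a aE] := mem_line2 (mkline_mem v0) v0 (lrep_mem _); exists a => //.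
by apply: contraNneq (lrep_neq0 (mkline v0)) => a0; rewrite aE a0 scale0r.
Qed.

Definition rQ (p : Q) : vec2 * vec2 := prep (phi p).

Lemma rQ_nz p : nz (rQ p). Proof. by rewrite /nz !lrep_neq0. Qed.

Lemma rQ_val p : \val (p : set_type _) = vanishing (rQ p).
Proof.
rewrite zQ_val; apply/esym/vanishing_proportional.
have [a a0 aE] := mkline_rep (proj1 (andP (zQ_nz p))).
have [b b0 bE] := mkline_rep (proj2 (andP (zQ_nz p))).
by exists a, b; split=> //; rewrite /rQ /prep aE bE.
Qed.

Lemma prep_nz (l : P1 * P1) : nz (prep l). Proof. by rewrite /nz !lrep_neq0. Qed.

Definition point z (z0 : nz z) : Q := SigSub (mem_set (vanishing_max z0)).

Definition psi (l : prodspace P1 P1) : Q := point (prep_nz l).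

Lemma prep_proportional (l l' : P1 * P1) : proportional (prep l) (prep l') -> l = l'.
Proof.
move=> [a [b [a0 b0 [E1 E2]]]]; rewrite [l]surjective_pairing [l']surjective_pairing.
congr (_, _).
  by apply: (line_eq (lrep_neq0 l'.1)); [rewrite E1; apply: memZ_line|]; exact: lrep_mem.
by apply: (line_eq (lrep_neq0 l'.2)); [rewrite E2; apply: memZ_line|]; exact: lrep_mem.
Qed.

Lemma psiK : cancel psi phi.
Proof.
move=> l; apply/esym/prep_proportional; apply: vanishing_sub; [exact: prep_nz|exact: prep_nz|].
by move=> m; rewrite -/(rQ (psi l)) -rQ_val.
Qed.

Lemma phiK : cancel phi psi.
Proof. by move=> p; apply: val_inj; rewrite [RHS]rQ_val. Qed.

Lemma Q_mem p m s : invariants m s -> (\val (p : set_type _)) m s <-> slice_value s (rQ p) = 0.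
Proof. by move=> As; rewrite rQ_val; split=> [[]|]. Qed.

(** Sections and biforms correspond, so the open sets and regular functions of
    Proj are literally those of the product of projective lines. *)
Lemma Q_ratio : ratio_space rQ (@biform21 F).
Proof.
split; first exact: biform21_graded.
- move=> U; split.
    move=> [S SA ->] p [m [a [Sa ap]]]; exists m, (slice_value a).
    have Aa : invariants m a by exact: SA.
    split; first exact: slice_value_biform.
      by apply/eqP => /(Q_mem p Aa).
    by move=> q /eqP aq; exists m, a; split=> // /(Q_mem q Aa).
  move=> H; exists (fun m => [set a | invariants m a /\ forall p, slice_value a (rQ p) != 0 -> U p]).
    by move=> m a [].
  apply/seteqP; split=> p /=.
    move=> /H[m [P [/invariants_lift[a Aa <-] ap aU]]]; exists m, a; split=> //.
    by move/(Q_mem p Aa) => a0; rewrite a0 eqxx in ap.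
  by move=> [m [a [[Aa aU] ap]]]; apply: aU; apply/eqP => /(Q_mem p Aa).
- move=> U f; split=> H p Up.
    have [m [a [b [Aa Ab bp ab]]]] := H p Up.
    exists m, (slice_value a), (slice_value b).
    split; [exact: slice_value_biform|exact: slice_value_biform| |].
      by apply/eqP => /(Q_mem p Ab).
    move=> q Uq /eqP bq.
    have := ab q Uq (fun h => bq ((Q_mem q Ab).1 h)); rewrite rQ_val => -[_ E].
    have {}E : slice_value a (rQ q) - f q * slice_value b (rQ q) = 0 by exact: E.
    apply: (mulIf (introN eqP bq)); rewrite divfK; last exact/eqP.
    by apply/esym/eqP; rewrite -subr_eq0 E.
  have [m [_ [_ [/invariants_lift[a Aa <-] /invariants_lift[b Ab <-] bp ab]]]] := H p Up.
  exists m, a, b; split=> //.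
    by move/(Q_mem p Ab) => b0; rewrite b0 eqxx in bp.
  move=> q Uq bq; have bq0 : slice_value b (rQ q) != 0 by apply/eqP => /(Q_mem q Ab).
  rewrite rQ_val; split.
    have := invariantsD Aa (invariants_scale (- f q) Ab); congr (invariants m (_ + _)).
    apply/funext => y; apply/funext => v; exact: mulNr.
  change (slice_value a (rQ q) - f q * slice_value b (rQ q) = 0).
  by rewrite ab // divfK // subrr.
Qed.

Lemma phi_isomorphism : isomorphism phi.
Proof.
split.
  apply: (ratio_morphism Q_ratio (P1xP1_ratio F)) => p m a b ha hb bp.
  by exists m, a, b; split.
exists psi; last by split; [exact: phiK | exact: psiK].
apply: (ratio_morphism (P1xP1_ratio F) Q_ratio) => l m a b ha hb.
rewrite /rQ psiK => bl; exists m, a, b; split=> // l'.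
by rewrite psiK.
Qed.

(** * The quotient map *)

Let Xss := subspace (semistable XF 7).

Lemma Xss_over (x : Xss) : exists z, over (incl x) z.
Proof. exact: semistable_over (set_valP x). Qed.

Definition zss (x : Xss) : vec2 * vec2 := projT1 (cid (Xss_over x)).

Lemma zss_over x : over (incl x) (zss x).
Proof. exact: projT2 (cid (Xss_over x)). Qed.

Definition pi (x : Xss) : Q := point (proj1 (zss_over x)).

Lemma pi_quotient_map : quotient_map pi.
Proof.
move=> x m; apply/seteqP; split=> s [As s0]; split=> //.
  exact/(over_eq0 (zss_over x) As).
exact/(over_eq0 (zss_over x) As).
Qed.

(** The representative of x and that of its image are chosen independently; the
    scalar k compares them, uniformly in all degrees. *)
Lemma pi_value (x : Xss) : exists2 k : F, k != 0 & forall m P f,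
  lift_of m P f -> f (yrep (incl x)) = k ^+ m * P (rQ (pi x)).
Proof.
have [k k0 kE] := over_form (zss_over x).
have [a [b [a0 b0 zE]]] : proportional (rQ (pi x)) (zss x).
  apply: vanishing_sub; [exact: rQ_nz|exact: (proj1 (zss_over x))|].
  by move=> m; rewrite -rQ_val.
exists (k * (a ^+ 2 * b)); first by rewrite !mulf_neq0 ?expf_neq0.
move=> m P f fl; rewrite (kE _ _ _ fl) zE.
have hP : biform21 m P.
  have := slice_value_biform (form_sec_invariant fl); congr (biform21 _ _).
  by apply/funext => z; exact: form_sec_value fl.
by rewrite (biformZ _ _ _ _ hP) -surjective_pairing 2!exprMn -exprM !mulrA.
Qed.

Lemma Xss_ratio : ratio_space (fun x : Xss => yrep (incl x)) (form N).
Proof. exact: ratio_subspace (Y_ratio XF). Qed.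

Lemma pi_morphism : morphism pi.
Proof.
apply: (ratio_morphism Xss_ratio Q_ratio) => x m a b ha hb bx.
have [fa la] := liftable_biform ha; have [fb lb] := liftable_biform hb.
have fE y : fb (yrep (incl y)) != 0 -> b (rQ (pi y)) != 0 /\
    a (rQ (pi y)) / b (rQ (pi y)) = fa (yrep (incl y)) / fb (yrep (incl y)).
  have [k k0 kE] := pi_value y; rewrite (kE _ _ _ la) (kE _ _ _ lb) mulf_eq0 negb_or.
  by move=> /andP[km by0]; split=> //; rewrite -mulf_div divff // mul1r.
exists (7 * m)%N, fa, fb; split=> //; [by case: la | by case: lb |].
have [k k0 kE] := pi_value x; rewrite (kE _ _ _ lb) mulf_neq0 //.
exact: expf_neq0.
Qed.

End Quotient.

(** * Descent of the line bundle *)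

Section Projections.
Variable F : closedFieldType.
Let P1 := P1 F.

Lemma fst_morphism : morphism (fst : prodspace P1 P1 -> P1).
Proof.
apply: (ratio_morphism (P1xP1_ratio F) (projspace_ratio F 2)) => z m a b ha hb bz.
have [l hl lz] := linear_form_nonzero (lrep_neq0 z.1).
have [h hh hz] := linear_form_nonzero (lrep_neq0 z.2).
have B f : form 2 m f -> biform21 m (fun y => f y.1 * l y.1 ^+ m * h y.2 ^+ m).
  move=> hf; have := biform_pure (formM hf (form_exp m hl)) (form_exp m hh).
  by rewrite !mul1n addnn -mul2n.
exists m, (fun y => a y.1 * l y.1 ^+ m * h y.2 ^+ m), (fun y => b y.1 * l y.1 ^+ m * h y.2 ^+ m).
split; [exact: B | exact: B | by rewrite /= !mulf_neq0 ?expf_neq0 |].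
move=> y /=; rewrite !mulf_eq0 !negb_or => /andP[/andP[by0 ly] hy]; split=> //.
by rewrite -[X in _ = X / _]mulrA -[X in _ = _ / X]mulrA -mulf_div divff ?mulr1 // mulf_neq0.
Qed.

Lemma snd_morphism : morphism (snd : prodspace P1 P1 -> P1).
Proof.
apply: (ratio_morphism (P1xP1_ratio F) (projspace_ratio F 2)) => z m a b ha hb bz.
have [l hl lz] := linear_form_nonzero (lrep_neq0 z.1).
have B f : form 2 m f -> biform21 m (fun y => l y.1 ^+ (2 * m) * f y.2).
  by move=> hf; have := biform_pure (form_exp (2 * m) hl) hf; rewrite !mul1n.
exists m, (fun y => l y.1 ^+ (2 * m) * a y.2), (fun y => l y.1 ^+ (2 * m) * b y.2).
split; [exact: B | exact: B | by rewrite /= !mulf_neq0 ?expf_neq0 |].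
move=> y /=; rewrite !mulf_eq0 !negb_or => /andP[ly by0]; split=> //.
by rewrite -mulf_div divff ?mul1r.
Qed.

Let O21 := boxtimes (serre F 2 2) (serre F 2 1).

Lemma O21_restricts : sec_restricts O21.
Proof.
by apply: (tensor_restricts (P1xP1_ratio F));
  exact: (pullback_restricts (P1xP1_ratio F)).
Qed.

Definition corner1 (i : bool) (u : vec2 F) : F := (if i then u i20 ord0 else u i21 ord0) ^+ 2.
Definition corner2 (j : bool) (w : vec2 F) : F := if j then w i20 ord0 else w i21 ord0.

Lemma corner1_form i : form 2 2 (corner1 i).
Proof. by case: i; exact: (form_exp 2 (form_coord F _)). Qed.

Lemma corner2_form j : form 2 1 (corner2 j).
Proof. by case: j; exact: form_coord. Qed.

Definition corner_section i j (l : P1 * P1) : 'cV[F]_2 * 'cV[F]_2 -> F :=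
  pure (form_section (corner1 i) l.1) (form_section (corner2 j) l.2).

Lemma corner_frame i j :
  frame O21 [set l | corner i j (prep l) != 0] (corner_section i j).
Proof.
have PP := P1xP1_ratio F; have PG := projspace_ratio F 2.
pose U : set (prodspace P1 P1) := [set l | corner i j (prep l) != 0].
have oU : opn U by exact: (ratio_opnD PP (@corner_biform F i j)).
have r1 := pullback_restricts PP (f := fst) (M := serre F 2 2).
have r2 := pullback_restricts PP (f := snd) (M := serre F 2 1).
have f1 := frame_pullback PP PG fst_morphism (@serre_restricts F 2 2) (serre_frame (corner1_form i)).
have f2 := frame_pullback PP PG snd_morphism (@serre_restricts F 2 1) (serre_frame (corner2_form j)).
apply: (frame_tensor PP r1 r2).
- apply: (frame_restrict oU _ f1) => l.
  by rewrite /U /= /corner mulf_eq0 negb_or => /andP[].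
- apply: (frame_restrict oU _ f2) => l.
  by rewrite /U /= /corner mulf_eq0 negb_or => /andP[].
Qed.

Lemma corner_section_prop i j i' j' l :
  smul (corner i' j' (prep l)) (corner_section i j l) =
  smul (corner i j (prep l)) (corner_section i' j' l).
Proof.
apply/funext => -[a b]; rewrite /smul /corner_section /pure /form_section /=.
case: ifPn => [al|_]; last by rewrite !mul0r !mulr0.
case: ifPn => [bl|_]; last by rewrite !mulr0.
have [c ->] := mem_line al; have [d ->] := mem_line bl.
rewrite !(formZ _ _ (corner1_form _)) !(formZ _ _ (corner2_form _)).
by rewrite /corner /corner1 /corner2 /=; ring.
Qed.

End Projections.

Section Descent.
Variable F : closedFieldType.
Let XF := @X F.
Let Y := subspace XF.
Let Q := git_quotient XF 7.
Let Xss := subspace (semistable XF 7).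
Let O21 := boxtimes (serre F 2 2) (serre F 2 1).
Let M : bundle Q := pullback (@phi F) O21.
Let L : bundle Xss := pullback (@Defs.incl F Y (semistable XF 7)) (Lomega XF 7).
Let L' : bundle Xss := pullback (@pi F) M.

Lemma phi_morphism : morphism (@phi F).
Proof. by have [] := phi_isomorphism F. Qed.

Lemma M_frame i j : frame M [set p | corner i j (rQ p) != 0]
  (fun p => corner_section i j (phi p)).
Proof.
exact: (frame_pullback (Q_ratio F) (P1xP1_ratio F) phi_morphism (@O21_restricts F)
  (@corner_frame F i j)).
Qed.

Lemma M_restricts : sec_restricts M.
Proof. exact: (pullback_restricts (Q_ratio F)). Qed.

Lemma M_line_bundle : line_bundle M.
Proof.
apply: frames_line_bundle; first exact: pullback_local.
move=> p; have [i [j cp]] := corner_nz (rQ_nz p).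
by exists [set p | corner i j (rQ p) != 0], (fun p => corner_section i j (phi p)); split=> //;
  exact: M_frame.
Qed.

Lemma pullback_M_frame i j : frame L' [set x | corner i j (rQ (pi x)) != 0]
  (fun x => corner_section i j (phi (pi x))).
Proof.
exact: (frame_pullback (Xss_ratio F) (Q_ratio F) (@pi_morphism F) M_restricts (M_frame i j)).
Qed.

Definition corner_lift i j : 'cV[F]_N -> F :=
  projT1 (cid (@liftable_corner F i j)).

Lemma corner_liftP i j : lift_of 1 (corner i j) (corner_lift i j).
Proof. exact: projT2 (cid (@liftable_corner F i j)). Qed.

Lemma corner_lift_neq0 i j (x : Xss) :
  (corner_lift i j (yrep (incl x)) != 0) = (corner i j (rQ (pi x)) != 0).
Proof.
have [k k0 kE] := pi_value x; rewrite (kE _ _ _ (corner_liftP i j)).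
by rewrite expr1 mulf_eq0 (negPf k0).
Qed.

Lemma L_frame i j : frame L [set x | corner i j (rQ (pi x)) != 0]
  (fun x => form_section (corner_lift i j) (incl (incl x))).
Proof.
have [hf _ _] := corner_liftP i j.
have fr := frame_pullback (Xss_ratio F) (Y_ratio XF)
  (incl_morphism (semistable XF 7) (Y_ratio XF))
  (@pullback_restricts _ _ _ _ _ (Y_ratio XF) _ _ _) (@Lomega_frame F XF 7 _ hf).
apply: (frame_restrict _ _ fr).
  have := (ratio_opnD (Xss_ratio F) hf); congr (opn _).
  by apply/seteqP; split=> x /=; rewrite corner_lift_neq0.
by move=> x /=; rewrite -corner_lift_neq0.
Qed.

Definition scalar (x : Xss) : F := projT1 (cid2 (pi_value x)).

Lemma scalar_neq0 x : scalar x != 0.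
Proof. by rewrite /scalar; case: cid2. Qed.

Lemma scalarP x i j : corner_lift i j (yrep (incl x)) = scalar x * corner i j (rQ (pi x)).
Proof.
rewrite /scalar; case: cid2 => k k0 kE /=.
by rewrite (kE _ _ _ (corner_liftP i j)) expr1.
Qed.

Definition chart (x : Xss) : bool * bool :=
  xget (true, true) [set ij | corner ij.1 ij.2 (rQ (pi x)) != 0].

Lemma chartP x : corner (chart x).1 (chart x).2 (rQ (pi x)) != 0.
Proof.
rewrite /chart; case: xgetP => [//|]; have [i [j cx]] := corner_nz (rQ_nz (pi x)).
by move=> /(_ (i, j)).
Qed.

(** The comparison of the fibres at x sends the value of a corner lift to the
    value of the corresponding section of O(2) [x] O(1). Any corner that does not
    vanish at x may be used, and all give the same map. *)
Definition Psi (x : Xss) (f : 'cV[F]_N -> F) : amb M -> F :=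
  smul (f (yrep (incl x)) / (scalar x * corner (chart x).1 (chart x).2 (rQ (pi x))))
    (corner_section (chart x).1 (chart x).2 (phi (pi x))).

Lemma Psi_corner x i j c :
  Psi x (smul c (form_section (corner_lift i j) (incl (incl x)))) =
  smul c (corner_section i j (phi (pi x))).
Proof.
have k0 := scalar_neq0 x; have c0 := chartP x.
transitivity (smul (c * (scalar x * corner i j (rQ (pi x))) /
    (scalar x * corner (chart x).1 (chart x).2 (rQ (pi x))))
    (corner_section (chart x).1 (chart x).2 (phi (pi x)))).
  by congr (smul (_ / _) _); rewrite -scalarP; congr (_ * _); exact: form_section_rep.
rewrite (_ : _ / _ = c / corner (chart x).1 (chart x).2 (rQ (pi x)) * corner i j (rQ (pi x))).
  by rewrite -smulA corner_section_prop smulA divfK.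
by field; rewrite k0 c0.
Qed.

Lemma Psi_iso : @bundle_iso F Xss L L' Psi.
Proof.
apply: (frames_bundle_iso (Xss_ratio F)).
- exact: pullback_local.
- exact: pullback_local.
- exact: (pullback_restricts (Xss_ratio F)).
- exact: (pullback_restricts (Xss_ratio F)).
move=> x; have [i [j cx]] := corner_nz (rQ_nz (pi x)).
exists [set x : Xss | corner i j (rQ (pi x)) != 0],
  (fun x : Xss => form_section (corner_lift i j) (incl (incl x))),
  (fun x : Xss => corner_section i j (phi (pi x))); split=> //.
- exact: L_frame.
- exact: pullback_M_frame.
- by move=> y c _; exact: Psi_corner.
Qed.

Lemma torus_surj t (v : 'cV[F]_N) : @torus F t -> exists v', v = wedge3 t *m v'.
Proof.
move=> /torus_diag[tE t1]; rewrite tE.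
exists (tor (fun i => (t i i)^-1) v); rewrite wedge3_tmx torM.
have t0 : forall i, t i i != 0 by apply: (prod_neq0 (t := fun i => t i i)); rewrite t1 oner_eq0.
rewrite (_ : (fun i => t i i * (t i i)^-1) = (fun=> 1)).
  by rewrite tor_const expr1n scale1r.
by apply/funext => i; rewrite divff.
Qed.

Lemma moves_pi (x y : Xss) t : torus t -> moves t (incl x) (incl y) -> pi x = pi y.
Proof.
move=> Tt xy; apply: val_inj; apply/funext => m.
rewrite !pi_quotient_map; apply/seteqP; split=> s [[sS si] s0]; split=> //.
  apply/funext => v; have [v' ->] := torus_surj v Tt.
  by rewrite (si t Tt _ _ xy) s0.
by apply/funext => v; rewrite -(si t Tt _ _ xy) s0.
Qed.

(** A torus element moves the value of an invariant section to its value at the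
    new point, and both points have the same image. *)
Lemma pi_descent : is_descent (@pi F) M.
Proof.
split; first exact: M_line_bundle.
exists Psi; split; first exact: Psi_iso.
move=> t Tt x y xy f g fx gy fg; have pxy := moves_pi Tt xy.
have [i [j cx]] := corner_nz (rQ_nz (pi x)).
have [_ Lx _] := L_frame i j; have [_ fE] := Lx x cx.
have [c _ cE] : range (fun c : F => smul c (form_section (corner_lift i j) (incl (incl x)))) f.
  by rewrite -fE.
have gE : g = smul c (form_section (corner_lift i j) (incl (incl y))).
  apply/funext => v; have [v' ->] := torus_surj v Tt; rewrite fg -cE.
  have [_ si] := form_sec_invariant (corner_liftP i j).
  by rewrite /smul; congr (_ * _); exact: (esym (si t Tt _ _ xy v')).
by rewrite gE -cE !Psi_corner pxy.
Qed.

End Descent.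

Theorem lemma5p12 (R : realType) :
  let v := coset_triple (s_ 3) in
  let X := richardson R[i] v w37 in
  let P1 := projspace R[i] 2 in
  exists (pi : subspace (semistable X 7) -> git_quotient X 7)
         (phi : git_quotient X 7 -> prodspace P1 P1),
    [/\ quotient_map pi,
        isomorphism phi
      & is_descent pi (pullback phi (boxtimes (serre R[i] 2 2) (serre R[i] 2 1)))].
Proof.
move=> v X P1; exists (@pi R[i]), (@phi R[i]); split.
- exact: pi_quotient_map.
- exact: phi_isomorphism.
- exact: pi_descent.
Qed.
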